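(* Let $D$ be a strongly connected directed graph and let $U$ be an infinite set of vertices of $D$. Then there exists a butterfly minor of $D$ that is either shaped by a star, shaped by a comb, or a chain of triangles, and that has all its teeth in $U$.
   Context: Paths, and all notions below, allow trivial (single-vertex) paths unless stated otherwise. A directed graph is strongly connected if for all vertices $u,v$ it contains a directed $u$--$v$ path. **Undirected notions.** A star is a graph $K_{1,\infty}$ (one centre, countably infinitely many leaves); its teeth are its leaves, and likewise for a subdivided star. A ray is a one-way infinite path. A comb is the union of a ray $R$ with infinitely many disjoint (possibly trivial) finite paths having precisely their first vertex on $R$; the last vertices of these paths are its teeth. A vertex $v$ of a comb is a junction if $v$ has degree $3$, or $v$ is a tooth and has degree $2$. **$\mathcal{D}(G)$.** For a graph $G$, $\mathcal{D}(G)$ is the directed graph obtained from $G$ by replacing each edge $uv$ by the two directed edges $(u,v),(v,u)$. A double path is $\mathcal{D}(P)$ for a (finite) path $P$. **Arborescences and rays.** An in-arborescence is a directed graph whose underlying undirected graph is a rooted tree, with all edges directed towards the root. An out-arborescence is defined analogously with all edges directed away from the root. An in-ray (out-ray) is an in-arborescence (out-arborescence) whose underlying undirected graph is a ray with its unique vertex of degree $1$ being the root. **Dominated directed ray.** This is either the union of an out-ray $R$ with root $r$ and edges $e_v=(v,r)$ (tail $v$, head $r$) for all $v\in V(R)\setminus\{r\}$, or the union of an in-ray $R$ with root $r$ and edges $e_v=(r,v)$ (tail $r$, head $v$) for all $v\in V(R)\setminus\{r\}$. All vertices of a dominated directed ray are called its teeth. **Shaped by a star.** A directed graph $H$ is shaped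 by a star if $H$ is a dominated directed ray or there is a subdivided star $S$ such that either $H=\mathcal{D}(S)$, or $H$ is obtained from $\mathcal{D}(S)$ by replacing the unique vertex $w$ of infinite degree by a dominated directed ray with vertex set $\{w_n : n\in N_S(w)\}$ (the $w_n$ distinct) such that for every neighbour $n\in N_S(w)$ the edges $(w,n),(n,w)$ become incident with $w_n$ (i.e. become $(w_n,n),(n,w_n)$). In the latter two cases the teeth of $H$ are the vertices corresponding to the leaves of $S$. **Shaped by a comb.** A directed graph $H$ is shaped by a comb if there is a comb $C$ such that either $H=\mathcal{D}(C)$, or $H$ is obtained from $\mathcal{D}(C)$ by replacing each junction $j$ of $C$ by a directed cycle of length $3$ such that: if $d_C(j)=3$, the three strong components of $\mathcal{D}(C)-j$ become incident with distinct vertices of this directed cycle (the two edges between $j$ and a given component become incident with the same cycle vertex); otherwise the tooth $j$ is a vertex of this directed cycle and the two strong components of $\mathcal{D}(C)-j$ become incident with the two distinct other vertices of the cycle. The teeth of $H$ are the vertices corresponding to the teeth of $C$. **Chain of triangles.** This is the union of the directed graph with vertex set $\bigcup_{i\in\mathbb{N}}\{a_i,b_i,c_i\}$ (all distinct) and edge set $\{(a_i,b_i),(b_i,c_i),(c_i,a_i),(a_{i+1},a_i),(c_i,c_{i+1}): i\in\mathbb{N}\}$ with disjoint (possibly trivial) double paths $F_i$ with endpoints $b_i$ and $y_i$, $i\in\mathbb{N}$, each meeting $\bigcup_{i}\{a_i,b_i,c_i\}$ only in $b_i$. Its teeth are the vertices $y_i$, $i\in\mathbb{N}$. **Butterfly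 minor.** A tree-like model of a directed graph $H$ in a directed graph $D$ is a map $\mu$ assigning to every edge of $H$ an edge of $D$ and to every vertex of $H$ a subgraph of $D$ such that: $\mu(v)\cap\mu(w)=\emptyset$ for all distinct $v,w\in V(H)$; for every $v\in V(H)$, $\mu(v)$ is the union of an in-arborescence $T_{\mathrm{in}}^{\mu(v)}$ and an out-arborescence $T_{\mathrm{out}}^{\mu(v)}$ which have only their roots in common (the two roots coincide and this is the only common vertex); for every $e=(u,v)\in E(H)$, the edge $\mu(e)$ has its tail in $T_{\mathrm{out}}^{\mu(u)}$ and its head in $T_{\mathrm{in}}^{\mu(v)}$. $H$ is a butterfly minor of $D$ if there is a tree-like model of $H$ in $D$. Each vertex $v$ of $H$ is identified with the common root of $T_{\mathrm{in}}^{\mu(v)}$ and $T_{\mathrm{out}}^{\mu(v)}$; so ''a vertex $v$ of $H$ lies in $U\subseteq V(D)$'' means that this common root lies in $U$ (for the chosen model). *)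

(* Defs.v *)
From mathcomp Require Import all_boot all_classical.

Set Implicit Arguments.
Unset Strict Implicit.
Unset Printing Implicit Defensive.

Local Open Scope classical_set_scope.

Local Obligation Tactic := idtac.

(* Graphs carry an explicit vertex set inside an ambient type, so that the
   subgraphs of a graph are again graphs over the same type. *)
Record graph (T : Type) := Graph {
  gV : set T;
  gE : T -> T -> Prop;
  gE_V : forall u v, gE u v -> gV u;
  gE_sym : forall u v, gE u v -> gE v u;
  gE_irr : forall u, ~ gE u u }.

(* Edges are ordered pairs of vertices; loops are allowed. *)
Record digraph (T : Type) := Digraph {
  dV : set T;
  dE : T -> T -> Prop;
  dE_V : forall u v, dE u v -> dV u /\ dV v }.

Section Operations.
Variable T : Type.
Implicit Types (G : graph T) (D : digraph T).

Program Definition gunion G1 G2 : graph T :=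
  @Graph T (gV G1 `|` gV G2) (fun u v => gE G1 u v \/ gE G2 u v) _ _ _.
Next Obligation. by move=> G1 G2 u v /= [uv|uv]; [left|right]; exact: gE_V uv. Qed.
Next Obligation. by move=> G1 G2 u v /= [uv|uv]; [left|right]; exact: gE_sym. Qed.
Next Obligation. by move=> G1 G2 u /= [uu|uu]; exact: gE_irr uu. Qed.

Program Definition gbigunion (F : nat -> graph T) : graph T :=
  @Graph T (\bigcup_i gV (F i)) (fun u v => exists i, gE (F i) u v) _ _ _.
Next Obligation. by move=> F u v /= [i uv]; exists i => //; exact: gE_V uv. Qed.
Next Obligation. by move=> F u v /= [i uv]; exists i; exact: gE_sym. Qed.
Next Obligation. by move=> F u /= [i uu]; exact: gE_irr uu. Qed.

Program Definition dunion D1 D2 : digraph T :=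
  @Digraph T (dV D1 `|` dV D2) (fun u v => dE D1 u v \/ dE D2 u v) _.
Next Obligation.
by move=> D1 D2 u v /= [uv|uv]; have [Du Dv] := dE_V uv; split; by [left|right].
Qed.

Program Definition dbigunion (F : nat -> digraph T) : digraph T :=
  @Digraph T (\bigcup_i dV (F i)) (fun u v => exists i, dE (F i) u v) _.
Next Obligation. by move=> F u v /= [i uv]; have [Du Dv] := dE_V uv; split; exists i. Qed.

Program Definition doubling G : digraph T := @Digraph T (gV G) (gE G) _.
Next Obligation.
by move=> G u v uv; split; [exact: gE_V uv|exact: gE_V (gE_sym uv)].
Qed.

Program Definition underlying D : graph T :=
  @Graph T (dV D) (fun u v => u <> v /\ (dE D u v \/ dE D v u)) _ _ _.
Next Obligation. by move=> D u v /= [_ [uv|uv]]; have [Du Dv] := dE_V uv. Qed.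
Next Obligation.
move=> D u v /= [uv e]; split; first exact: nesym.
by case: e => e; [right|left].
Qed.
Next Obligation. by move=> D u /= []. Qed.

Program Definition ddelete D (x : T) : digraph T :=
  @Digraph T (dV D `\ x) (fun u v => [/\ dE D u v, u <> x & v <> x]) _.
Next Obligation. by move=> D x u v /= [uv ux vx]; have [Du Dv] := dE_V uv. Qed.

Definition subdigraph D1 D2 :=
  dV D1 `<=` dV D2 /\ forall u v, dE D1 u v -> dE D2 u v.

Definition nbr G (v : T) : set T := [set u | gE G v u].

Definition has_degree G (v : T) (n : nat) := (nbr G v #= `I_n)%card.

End Operations.

(* The vertices p 0, ..., p n form a path of length n (possibly 0). *)
Definition path_along (T : Type) (A : set T) (E : T -> T -> Prop)
    (n : nat) (p : nat -> T) :=
  [/\ forall i, i <= n -> A (p i),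
      forall i, i < n -> E (p i) (p i.+1) &
      forall i j, i <= n -> j <= n -> p i = p j -> i = j].

Section Undirected.
Variable T : Type.
Implicit Types (G P R S C : graph T) (Y : set T).

Definition connected_graph G := forall u v, gV G u -> gV G v ->
  exists n p, [/\ path_along (gV G) (gE G) n p, p 0 = u & p n = v].

Definition cycle_along G (n : nat) (p : nat -> T) :=
  [/\ 2 < n,
      forall i, i.+1 < n -> gE G (p i) (p i.+1),
      gE G (p n.-1) (p 0) &
      forall i j, i < n -> j < n -> p i = p j -> i = j].

Definition is_tree G := [/\ gV G !=set0, connected_graph G &
  forall n p, ~ cycle_along G n p].

Definition is_path P (x y : T) := exists n p,
  [/\ p 0 = x, p n = y,
      forall i j, i <= n -> j <= n -> p i = p j -> i = j,
      gV P = [set p i | i in [set i | i <= n]] &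
      forall u v, gE P u v <-> exists2 i, i < n &
        (u = p i /\ v = p i.+1) \/ (v = p i /\ u = p i.+1)].

Definition is_ray R := exists p : nat -> T,
  [/\ injective p, gV R = range p &
      forall u v, gE R u v <-> exists i,
        (u = p i /\ v = p i.+1) \/ (v = p i /\ u = p i.+1)].

Definition is_subdivided_star S := exists c (P : nat -> graph T) (y : nat -> T),
  [/\ forall i, is_path (P i) c (y i),
      forall i, y i <> c,
      forall i j, i <> j -> gV (P i) `&` gV (P j) = [set c] &
      S = gbigunion P].

Definition leaves S : set T := [set v | gV S v /\ has_degree S v 1].

(* C is a comb with set of teeth Y. *)
Definition is_comb C Y := exists R (P : nat -> graph T) (x y : nat -> T),
  [/\ is_ray R,
      forall i, is_path (P i) (x i) (y i) /\ gV (P i) `&` gV R = [set x i],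
      forall i j, i <> j -> gV (P i) `&` gV (P j) = set0,
      C = gunion R (gbigunion P) &
      Y = range y].

Definition junctions C Y : set T := [set v | gV C v /\
  (has_degree C v 3 \/ Y v /\ has_degree C v 2)].

End Undirected.

Section Directed.
Variable T : Type.
Implicit Types (D A R H K : digraph T) (G S C : graph T) (Y : set T).

Definition dreach D (u v : T) :=
  exists n p, [/\ path_along (dV D) (dE D) n p, p 0 = u & p n = v].

Definition strongly_connected D :=
  forall u v, dV D u -> dV D v -> dreach D u v.

Definition same_strong_component D (u v : T) := dreach D u v /\ dreach D v u.

(* In the tree G rooted at r, the edge uv oriented from u to v points to r:
   it is the first edge of the path from u to r. *)
Definition towards G (r u v : T) := exists n p,
  [/\ path_along (gV G) (gE G) n.+1 p, p 0 = u, p 1 = v & p n.+1 = r].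

Definition in_arborescence A (r : T) :=
  [/\ is_tree (underlying A), dV A r &
      forall u v, dE A u v -> towards (underlying A) r u v].

Definition out_arborescence A (r : T) :=
  [/\ is_tree (underlying A), dV A r &
      forall u v, dE A u v -> towards (underlying A) r v u].

Definition in_ray R (r : T) := [/\ in_arborescence R r,
  is_ray (underlying R) & has_degree (underlying R) r 1].

Definition out_ray R (r : T) := [/\ out_arborescence R r,
  is_ray (underlying R) & has_degree (underlying R) r 1].

Definition dominated_directed_ray H := exists R r,
  dV H = dV R /\
  ((out_ray R r /\ forall u v, dE H u v <->
      dE R u v \/ [/\ dV R u, u <> r & v = r]) \/
   (in_ray R r /\ forall u v, dE H u v <->
      dE R u v \/ [/\ dV R v, v <> r & u = r])).

Definition directed_triangle K := exists x y z,
  [/\ x <> y, y <> z, z <> x,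
      dV K = [set x; y; z] &
      forall u v, dE K u v <->
        [\/ u = x /\ v = y, u = y /\ v = z | u = z /\ v = x]].

(* H is obtained from doubling G by replacing every vertex j of J by the
   digraph K j; in H, the two edges between adjacent vertices x and y of G
   join a x y (the end at x) and a y x (the end at y). *)
Definition replaces G (J : set T) (K : T -> digraph T) (a : T -> T -> T) H :=
  [/\ J `<=` gV G,
      (forall i j, J i -> J j -> i <> j -> dV (K i) `&` dV (K j) = set0) /\
      (forall j, J j -> dV (K j) `&` (gV G `\` J) = set0),
      forall x y, gE G x y -> (J x -> dV (K x) (a x y)) /\ (~ J x -> a x y = x),
      dV H = (gV G `\` J) `|` \bigcup_(j in J) dV (K j) &
      forall u v, dE H u v <-> (exists2 j, J j & dE (K j) u v) \/
        (exists x y, [/\ gE G x y, u = a x y & v = a y x])].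

(* H is shaped by a star, with set of teeth Y. *)
Definition shaped_by_star H Y :=
  (dominated_directed_ray H /\ Y = dV H) \/
  exists S, [/\ is_subdivided_star S, Y = leaves S &
    H = doubling S \/
    exists w (K : T -> digraph T) a,
      [/\ gV S w /\ infinite_set (nbr S w),
          replaces S [set w] K a H,
          dominated_directed_ray (K w),
          dV (K w) = [set a w n | n in nbr S w] &
          forall m n, nbr S w m -> nbr S w n -> a w m = a w n -> m = n]].

(* H is shaped by a comb, with set of teeth Y.  A junction that is a tooth is
   itself a vertex of the triangle replacing it, and a junction of degree 3 is
   never a tooth, so the teeth of H are literally those of C. *)
Definition shaped_by_comb H Y :=
  exists C, is_comb C Y /\
    (H = doubling C \/
     exists (K : T -> digraph T) a,
       [/\ replaces C (junctions C Y) K a H,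
           forall j, junctions C Y j -> directed_triangle (K j),
           forall j m n, junctions C Y j -> nbr C j m -> nbr C j n ->
             (a j m = a j n <->
              same_strong_component (ddelete (doubling C) j) m n) &
           forall j, junctions C Y j -> ~ has_degree C j 3 ->
             dV (K j) j /\ forall n, nbr C j n -> a j n <> j]).

(* H is a chain of triangles, with set of teeth Y. *)
Definition chain_of_triangles H Y :=
  exists (a b c y : nat -> T) (B : digraph T) (P : nat -> graph T),
  let base := range a `|` range b `|` range c in
  [/\ [/\ injective a, injective b, injective c &
          forall i j, [/\ a i <> b j, b i <> c j & c i <> a j]],
      dV B = base /\
      (forall u v, dE B u v <-> exists i,
        [\/ u = a i /\ v = b i, u = b i /\ v = c i, u = c i /\ v = a i |
            (u = a i.+1 /\ v = a i) \/ (u = c i /\ v = c i.+1)]),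
      (forall i, is_path (P i) (b i) (y i) /\ gV (P i) `&` base = [set b i]) /\
      (forall i j, i <> j -> gV (P i) `&` gV (P j) = set0),
      H = dunion B (dbigunion (fun i => doubling (P i))) &
      Y = range y].

End Directed.

(* All conditions concern the vertices and edges of H only; the values of the
   fields outside dV H and dE H are irrelevant. *)
Record tree_like_model (W V : Type) (H : digraph W) (D : digraph V) :=
  TreeLikeModel {
  mu_vertex : W -> digraph V;
  mu_edge : W -> W -> V * V;
  T_in : W -> digraph V;
  T_out : W -> digraph V;
  root_of : W -> V;
  mu_vertex_sub : forall v, dV H v -> subdigraph (mu_vertex v) D;
  mu_vertex_disjoint : forall v w, dV H v -> dV H w -> v <> w ->
    dV (mu_vertex v) `&` dV (mu_vertex w) = set0;
  mu_vertex_union : forall v, dV H v ->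
    mu_vertex v = dunion (T_in v) (T_out v);
  T_in_arborescence : forall v, dV H v -> in_arborescence (T_in v) (root_of v);
  T_out_arborescence : forall v, dV H v ->
    out_arborescence (T_out v) (root_of v);
  T_in_out : forall v, dV H v ->
    dV (T_in v) `&` dV (T_out v) = [set root_of v];
  mu_edge_edge : forall u v, dE H u v -> dE D (mu_edge u v).1 (mu_edge u v).2;
  mu_edge_ends : forall u v, dE H u v ->
    dV (T_out u) (mu_edge u v).1 /\ dV (T_in v) (mu_edge u v).2 }.

(* Main.v *)
(* A model of a vertex is determined by two vertex sets I and O that meet only
   in the root r such that I reaches r inside I and r reaches O inside O: the
   arborescences can then be taken to be breadth-first.  Likewise, paths from s
   to u and from u to t contain a model of a double path that ends in u and can
   be entered from s and left to t at its other end.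

   Applying the star-comb argument to a breadth-first out-arborescence, and then
   again to an in-arborescence, yields an out-ray or vertex R, an in-ray or
   vertex S, and infinitely many u in U with paths from R to u and from u to S
   such that each vertex outside R (outside S) lies on only finitely many of
   them.  If R and S are rays that meet infinitely often, their union can
   be cut into a ladder traversable in both directions, and each u hangs from it
   either by a double path or by an ear that turns a junction into a triangle: this gives a
   comb.  Otherwise R and S may be taken disjoint, with a path from S to R.  If
   the paths from R avoid S and those to S avoid R, contracting R, S and this
   path yields a star; if only one of the two conditions fails, a star whose
   centre is a dominated ray; if both fail, a chain of triangles. *)

Require Import Defs.
From mathcomp Require Import all_boot all_classical.
From mathcomp Require Import zify.

Set Implicit Arguments.
Unset Strict Implicit.
Unset Printing Implicit Defensive.

Local Open Scope classical_set_scope.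

Local Obligation Tactic := idtac.

(** Two obstacles shape the constructions. Branch sets must be disjoint, while paths to different
    members of [U] may cross each other and the rays anywhere. Since every path is finite and a
    vertex off the core meets few paths, a greedy thinning makes the supports disjoint and, through
    an additional list per member, pushes later members further out along the rays. An arc of the
    shape that runs from [R] to [S] must not use vertices of a tooth path either, so in the
    dominated and chain cases the members are used in pairs: one supplies the tooth, the next one
    only such a crossing. The shapes also admit no mixtures: either all vertices of a dominated ray
    are teeth or none is, and either all junctions of a comb are triangles or none is. Hence a
    pigeonhole step precedes each assembly of this kind. Star and comb shapes are closed under
    reversal, which halves the work: a single orientation of the dominated ray is built, and an ear
    that leads backwards along the ladder leads forwards in the reversed one. *)

Lemma exists_choice (X Y : Type) (P : X -> Y -> Prop) :
  (forall x, exists y, P x y) -> exists f, forall x, P x (f x).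
Proof. by move=> /choice[f fP]; exists f. Qed.

(** * Equality and reversal of digraphs *)

Section Reversal.
Variable T : Type.
Implicit Types (D H : digraph T) (G : graph T).

Definition rev_digraph D : digraph T :=
  @Digraph T (dV D) (fun u v => dE D v u)
    (fun u v vu => conj (dE_V vu).2 (dE_V vu).1).

(** The shapes contain equations between records, such as [H = doubling S]; the proof fields agree
    by proof irrelevance. *)
Lemma eq_graph G1 G2 :
  gV G1 = gV G2 -> (forall u v, gE G1 u v <-> gE G2 u v) -> G1 = G2.
Proof.
case: G1 G2 => [V1 E1 a1 b1 c1] [V2 E2 a2 b2 c2] /= eqV eqE.
have eqE' : E1 = E2 by apply/funext => u; apply/funext => v; apply/propext.
by case: _ / eqV a2; case: _ / eqE' b2 c2 => b2 c2 a2; congr Graph; exact: Prop_irrelevance.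
Qed.

Lemma eq_digraph D1 D2 :
  dV D1 = dV D2 -> (forall u v, dE D1 u v <-> dE D2 u v) -> D1 = D2.
Proof.
case: D1 D2 => [V1 E1 a1] [V2 E2 a2] /= eqV eqE.
have eqE' : E1 = E2 by apply/funext => u; apply/funext => v; apply/propext.
by case: _ / eqV a2; case: _ / eqE' => a2; congr Digraph; exact: Prop_irrelevance.
Qed.

Lemma rev_digraphK D : rev_digraph (rev_digraph D) = D.
Proof. exact: eq_digraph. Qed.

Lemma underlying_rev D : underlying (rev_digraph D) = underlying D.
Proof. by apply: eq_graph => // u v /=; split=> -[? []]; split; auto. Qed.

Lemma in_arborescence_rev D r :
  in_arborescence (rev_digraph D) r <-> out_arborescence D r.
Proof.
by split=> -[t Dr tow]; split; rewrite ?underlying_rev // in t tow *; move=> u v /tow.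
Qed.

Lemma out_arborescence_rev D r :
  out_arborescence (rev_digraph D) r <-> in_arborescence D r.
Proof. by rewrite -in_arborescence_rev rev_digraphK. Qed.

End Reversal.

(** * Trees given by a parent function *)

Section ParentTree.
Variable V : Type.
Variables (A : set V) (r : V) (dep : V -> nat) (par : V -> V).
Hypothesis Ar : A r.
Hypothesis parP : forall x, A x -> x <> r -> A (par x) /\ dep x = (dep (par x)).+1.

Lemma parent_edgeV u v : [/\ A u, u <> r & v = par u] -> A u /\ A v.
Proof. by case=> Au /(parP Au)[Ap _] ->. Qed.

Definition parent_digraph : digraph V := Digraph parent_edgeV.

Lemma parent_iter x i : A x -> i <= dep x - dep r ->
  A (iter i par x) /\ dep (iter i par x) = dep x - i.
Proof.
move=> Ax; elim: i => [|i IHi] ile; first by rewrite subn0.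
have [Ai di] := IHi (ltnW ile); rewrite iterS.
case: (pselect (iter i par x = r)) => [eqr|/(parP Ai)[? d]].
  by rewrite eqr in di; lia.
by split=> //; lia.
Qed.

(** Each step to the parent lowers the depth by one and is possible everywhere except at [r], so the
    descent can only end in [r]. The depth of [r] may be any number. *)
Lemma parent_dep x : A x -> dep r <= dep x /\ (dep x = dep r -> x = r).
Proof.
move: {2}(dep x) (leqnn (dep x)) => n; elim: n x => [|n IHn] x xn Ax.
  case: (pselect (x = r)) => [->|/(parP Ax)[_ d]]; by [|lia].
case: (pselect (x = r)) => [->//|/(parP Ax)[Ap d]].
by have [||le _] := IHn (par x); [lia|by []|split; lia].
Qed.

Lemma parent_root x : A x -> iter (dep x - dep r) par x = r.
Proof.
move=> Ax; have [Ai di] := parent_iter Ax (leqnn _).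
have [le _] := parent_dep Ax.
by apply: (parent_dep Ai).2; lia.
Qed.

Lemma parent_towards u : A u -> u <> r -> towards (underlying parent_digraph) r u (par u).
Proof.
move=> Au ur; have [le ler] := parent_dep Au.
have lt : dep r < dep u by rewrite ltn_neqAle le andbT; apply/eqP => /esym/ler.
exists (dep u - dep r).-1, (fun i => iter i par u).
rewrite prednK; last lia.
split=> //; last exact: parent_root.
split=> [i ile|i ilt|i j ile jle eqij].
- by have [] := parent_iter Au ile.
- have [Ai di] := parent_iter Au (ltnW ilt).
  have nr : iter i par u <> r by move=> eqr; rewrite eqr in di; lia.
  split; last by left.
  have [_ di'] := parent_iter Au ilt.
  by move=> eqi; rewrite -eqi in di'; lia.
- have [_ di] := parent_iter Au ile; have [_ dj] := parent_iter Au jle.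
  by rewrite eqij in di; lia.
Qed.

Lemma underlying_parentE u v : gE (underlying parent_digraph) u v ->
  (A u /\ u <> r /\ v = par u) \/ (A v /\ v <> r /\ u = par v).
Proof. by case=> _ [][]; auto. Qed.

(** A vertex of maximal depth on a cycle has no child on it, so both of its neighbours are its
    parent and coincide. *)
Lemma parent_acyclic n p : ~ cycle_along (underlying parent_digraph) n p.
Proof.
case=> n2 pE pn pinj.
have [i ilt imax] : exists2 i, i < n & forall j, j < n -> dep (p j) <= dep (p i).
  have n0 : 0 < n by lia.
  pose i := [arg max_(i > Ordinal n0) dep (p (i : 'I_n))].
  exists i => // j jn; rewrite /i; case: arg_maxnP => //= k _ kmax.
  exact: (kmax (Ordinal jn)).
have up j : gE (underlying parent_digraph) (p i) (p j) -> j < n -> p j = par (p i).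
  move=> /underlying_parentE [[_ []]//|[Aj [jr eqi]]] /imax.
  by have [_ ->] := parP Aj jr; rewrite eqi ltnn.
(* The cyclic successor and predecessor of [i]; they are different indices because [n > 2]. *)
pose j := if i.+1 < n then i.+1 else 0.
pose k := if i is i'.+1 then i' else n.-1.
have jn : j < n by rewrite /j; case: ifP; lia.
have kn : k < n by rewrite /k; case: (i) ilt; lia.
have ej : gE (underlying parent_digraph) (p i) (p j).
  rewrite /j; case: ifP => [lt|ge]; first exact: pE.
  by have -> : i = n.-1 by lia.
have ek : gE (underlying parent_digraph) (p i) (p k).
  apply: gE_sym; rewrite /k; case: (i) ilt => [//|i' lt]; exact: pE.
have /(pinj _ _ jn kn) : p j = p k by rewrite (up j) // (up k).
by rewrite /j /k; case: ifP; case: (i) ilt; lia.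
Qed.

End ParentTree.

(** * Walks and their shortening to paths *)

Section Walks.
Variables (V : eqType) (A : set V) (E : V -> V -> Prop).

(** Repetitions are allowed, so that walks can be concatenated and reversed; [walk_path] removes the
    loops afterwards. *)
Definition walk (x y : V) := exists s : seq V,
  [/\ path (fun u v => `[<E u v>]) x s, last x s = y & forall z, z \in x :: s -> A z].

Lemma walk_trans y x z : walk x y -> walk y z -> walk x z.
Proof.
move=> [s [ps ls As]] [t [pt lt At]]; exists (s ++ t).
rewrite cat_path ps ls pt last_cat ls; split=> // w.
rewrite in_cons mem_cat => /or3P[/eqP->|ws|wt].
- by apply: As; rewrite mem_head.
- by apply: As; rewrite in_cons ws orbT.
- by apply: At; rewrite in_cons wt orbT.
Qed.

Lemma walk1 x y : A x -> A y -> E x y -> walk x y.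
Proof.
move=> Ax Ay xy; exists [:: y]; split=> //=; first by rewrite asboolT.
by move=> z; rewrite !inE => /orP[]/eqP->.
Qed.

Lemma walk0 x : A x -> walk x x.
Proof. by move=> Ax; exists [::]; split=> // z; rewrite inE => /eqP->. Qed.

Lemma walk_sym x y : (forall u v, E u v -> E v u) -> walk x y -> walk y x.
Proof.
move=> Esym [s [ps ls As]].
elim: s x ps ls As => [|a s IHs] x /= => [_ <- As|/andP[/asboolP xa pa] la As].
  by apply: walk0; apply: As; rewrite mem_head.
have Aa : A a by apply: As; rewrite !inE eqxx orbT.
apply: (@walk_trans a); first by apply: IHs => // z za; apply: As; rewrite in_cons za orbT.
by apply: walk1; [|apply: As; rewrite mem_head|exact: Esym].
Qed.

Lemma walk_path x y : walk x y -> exists n p, [/\ path_along A E n p, p 0 = x & p n = y].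
Proof.
case=> s [ps ls As].
case: (shortenP ps) ls As => s' ps' us' /= subs ls As.
exists (size s'), (nth x (x :: s')); split=> //; last by rewrite (last_nth x) in ls.
split.
- move=> i ile; apply: As; have := mem_nth x (s := x :: s') (n := i) ile.
  rewrite !in_cons; by case/orP=> [->//|/subs ->]; rewrite orbT.
- by move=> i ilt; have /(pathP x)/(_ i ilt)/asboolP := ps'.
- by move=> i j ile jle /eqP; rewrite nth_uniq // => /eqP.
Qed.

End Walks.

Section ParentArborescence.
Variable V : Type.
Variables (A : set V) (r : V) (dep : V -> nat) (par : V -> V).
Hypothesis Ar : A r.
Hypothesis parP : forall x, A x -> x <> r -> A (par x) /\ dep x = (dep (par x)).+1.

Lemma parent_arborescence : in_arborescence (parent_digraph parP) r.
Proof.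
split=> //; last by move=> u v /= [Au ur ->]; exact: parent_towards.
split; [by exists r| |by move=> n p; exact: parent_acyclic].
pose G := underlying (parent_digraph parP).
have wr x : A x -> @walk {classic V} (gV G) (gE G) x r.
  move: {2}(dep x) (leqnn (dep x)) => n; elim: n x => [|n IHn] x xn Ax;
    (case: (pselect (x = r)) => [->|xr]; first exact: walk0); have [Ap d] := parP Ax xr; first lia.
  apply: (@walk_trans {classic V} _ _ (par x)); last by apply: IHn => //; lia.
  by apply: walk1 => //; split; [move=> ex; rewrite -ex in d; lia|left].
move=> u v Au Av; apply: (@walk_path {classic V}); apply: (walk_trans (wr u Au)).
by apply: walk_sym (wr v Av); exact: gE_sym.
Qed.

End ParentArborescence.

(** * Reachability inside a vertex set, breadth-first trees *)

Section Reach.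
Variable V : Type.
Implicit Types (D : digraph V) (A B : set V).

(** Both ends and all vertices between them lie in [A]. This confinement is what lets disjoint
    vertex sets carry disjoint arborescences. *)
Inductive reach D A (x : V) : V -> Prop :=
| reach_refl of A x & dV D x : reach D A x x
| reach_step y z of reach D A x y & A z & dE D y z : reach D A x z.

Lemma reach_inl D A x y : reach D A x y -> A x /\ dV D x.
Proof. by elim. Qed.

Lemma reach_inr D A x y : reach D A x y -> A y /\ dV D y.
Proof. by elim=> // y' z _ _ Az e; have [] := dE_V e. Qed.

Lemma reach_trans D A y x z : reach D A x y -> reach D A y z -> reach D A x z.
Proof. by move=> xy; elim=> // z' t _ xz' At e; apply: reach_step e. Qed.

Lemma reach_edge D A x y : A x -> A y -> dE D x y -> reach D A x y.
Proof.
by move=> Ax Ay e; apply: (reach_step _ Ay e); apply: reach_refl => //; have [] := dE_V e.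
Qed.

Lemma reach_cons D A x y z : A x -> dE D x y -> reach D A y z -> reach D A x z.
Proof. by move=> Ax xy yz; apply: (reach_trans _ yz); apply: reach_edge (reach_inl yz).1 _. Qed.

Lemma reach_mono D A B x y : A `<=` B -> reach D A x y -> reach D B x y.
Proof.
move=> AB; elim=> [/AB Bx Dx|y' z _ IH /AB Bz e]; first exact: reach_refl.
exact: reach_step IH Bz e.
Qed.

Lemma reach_rev D A x y : reach D A x y -> reach (rev_digraph D) A y x.
Proof.
elim=> [Ax Dx|y' z _ IH Az e]; first exact: reach_refl.
exact: reach_cons IH.
Qed.

Lemma reach_revE D A x y : reach (rev_digraph D) A y x <-> reach D A x y.
Proof. by split=> /reach_rev; rewrite ?rev_digraphK. Qed.

End Reach.

Section BreadthFirst.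
Variables (V : Type) (D : digraph V) (A : set V) (r : V).

Fixpoint layer n : set V :=
  if n is n'.+1 then [set x | A x /\ exists2 y, layer n' y & dE D x y]
  else [set x | [/\ x = r, A x & dV D x]].

Lemma reach_layer x : reach D A x r <-> exists n, layer n x.
Proof.
split=> [xr|[n]].
  have := reach_rev xr; clear xr; elim=> [Ar Dr|y z _ [n yn] Az e]; first by exists 0.
  by exists n.+1; split=> //; exists y.
elim: n x => [|n IHn] x /=; first by case=> -> Ar Dr; exact: reach_refl.
by case=> Ax [y /IHn yr xy]; exact: reach_cons xy yr.
Qed.

(** The depth of [x] is its least layer, that is, its distance to [r] inside [A]. The parent is an
    out-neighbour in the layer just below; it cannot lie in an even lower layer, or else [x] would
    too. *)
Lemma bfs : exists (dep : V -> nat) (par : V -> V),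
  forall x, reach D A x r -> x <> r ->
  [/\ reach D A (par x) r, dE D x (par x) & dep x = (dep (par x)).+1].
Proof.
have [dep depP] : exists dep : V -> nat, forall x, reach D A x r ->
    layer (dep x) x /\ forall n, layer n x -> dep x <= n.
  apply: (@exists_choice _ _ (fun x d => reach D A x r -> layer d x /\ forall n, layer n x -> d <= n)).
  move=> x; case: (pselect (exists n, `[<layer n x>])) => [ex|nex].
    exists (ex_minn ex) => _; case: ex_minnP => m /asboolP xm mmin; split=> // n /asboolT; exact: mmin.
  by exists 0 => /reach_layer[n xn]; case: nex; exists n; exact: asboolT.
have [par parP] : exists par : V -> V, forall x, reach D A x r -> x <> r ->
    [/\ reach D A (par x) r, dE D x (par x) & dep x = (dep (par x)).+1].
  apply: (@exists_choice _ _ (fun x y => reach D A x r -> x <> r ->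
    [/\ reach D A y r, dE D x y & dep x = (dep y).+1])) => x.
  case: (pselect (reach D A x r /\ x <> r)) => [[xr nx]|no]; last by exists x => ? ?; case: no.
  have [lx minx] := depP x xr.
  case E: (dep x) lx => [|n] /=; first by case.
  move=> [Ax [y ly xy]]; exists y => _ _.
  have yr : reach D A y r by apply/reach_layer; exists n.
  split=> //; have [ly' miny] := depP y yr.
  have := miny _ ly; have : dep x <= (dep y).+1 by apply: minx; split=> //; exists y.
  by rewrite E; lia.
by exists dep, par.
Qed.

Lemma reach_arborescence (Ar : A r) : (forall x, A x -> reach D A x r) ->
  exists T : digraph V, [/\ in_arborescence T r, dV T = A & subdigraph T D].
Proof.
move=> Areach; have [dep [par parP]] := bfs.
have parP' x : A x -> x <> r -> A (par x) /\ dep x = (dep (par x)).+1.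
  by move=> Ax xr; have [pr _ d] := parP x (Areach x Ax) xr; have [] := reach_inl pr.
exists (parent_digraph parP'); split=> //; first exact: parent_arborescence.
split=> [x /= /Areach xr|u v /= [/Areach ur nr ->]]; first by have [] := reach_inl xr.
by have [] := parP u ur nr.
Qed.

End BreadthFirst.

(** * Models described by vertex sets *)

Section Models.
Variable V : Type.
Implicit Types D : digraph V.

(* The vertex sets of the two arborescences of a model of a vertex, with
   common root [r]. *)
Record branch D (I O : set V) (r : V) : Prop := Branch {
  branch_in : forall x, I x -> reach D I x r;
  branch_out : forall x, O x -> reach D O r x;
  branch_rootI : I r;
  branch_rootO : O r;
  branch_meet : forall x, I x -> O x -> x = r }.

Lemma branch_rev D I O r : branch D I O r -> branch (rev_digraph D) O I r.
Proof.
case=> hI hO Ir Or IO; split=> // x.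
- by move=> Ox; exact: (reach_rev (hO x Ox)).
- by move=> Ix; exact: (reach_rev (hI x Ix)).
- by move=> Ox Ix; exact: IO.
Qed.

Lemma branch_revE D I O r : branch (rev_digraph D) O I r <-> branch D I O r.
Proof. by split=> /branch_rev; rewrite ?rev_digraphK. Qed.

(** New vertices on the in-side lead into the old in-side and those on the out-side come from the
    old out-side, so the old root still serves. The last hypothesis keeps the two sides from meeting
    in new vertices. *)
Lemma branch_extend D (I0 O0 I' O' : set V) r : branch D I0 O0 r -> I0 `<=` I' -> O0 `<=` O' ->
  (forall x, I' x -> exists2 y, I0 y & reach D I' x y) ->
  (forall x, O' x -> exists2 y, O0 y & reach D O' y x) ->
  (forall x, I' x -> O' x -> I0 x /\ O0 x) -> branch D I' O' r.
Proof.
move=> [bI bO bIr bOr bm] II OO In On meet.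
split=> [x|x|||x Ix Ox]; [| |exact: II|exact: OO|by have [] := meet x Ix Ox; exact: bm].
  by move=> /In[y Iy xy]; apply: (reach_trans xy); apply: reach_mono (bI y Iy).
by move=> /On[y Oy xy]; apply: (reach_trans _ xy); apply: reach_mono (bO y Oy).
Qed.

Record set_model (W : Type) (H : digraph W) D (I O : W -> set V) (r : W -> V) : Prop := SetModel {
  sm_branch : forall v, dV H v -> branch D (I v) (O v) (r v);
  sm_disjoint : forall x v w, dV H v -> dV H w ->
    (I v `|` O v) x -> (I w `|` O w) x -> v = w;
  sm_edge : forall u v, dE H u v -> exists x y, [/\ O u x, I v y & dE D x y] }.

Lemma set_model_rev (W : Type) (H : digraph W) D (I O : W -> set V) (r : W -> V) :
  set_model H D I O r -> set_model (rev_digraph H) (rev_digraph D) O I r.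
Proof.
case=> br dj ed; split=> [v /br/branch_rev //|x v w|u v /ed[x [y [Ox Iy xy]]]].
  by rewrite !(setUC (O _)); exact: dj.
by exists y, x.
Qed.

Lemma branch_trees D (W : Type) (P : W -> Prop) (I O : W -> set V) (r : W -> V) :
  (forall v, P v -> branch D (I v) (O v) (r v)) -> exists T : W -> digraph V, forall v, P v ->
    [/\ in_arborescence (T v) (r v), dV (T v) = I v & subdigraph (T v) D].
Proof.
move=> br; apply: (@exists_choice _ _ (fun v T => P v ->
  [/\ in_arborescence T (r v), dV T = I v & subdigraph T D])) => v.
case: (pselect (P v)) => [Pv|]; last by exists D.
have [hI _ Ir _ _] := br v Pv.
by have [T TP] := reach_arborescence Ir hI; exists T.
Qed.

(** The in-arborescences are breadth-first trees of [D]. The out-arborescences are obtained in the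
    same way in the reversed digraph and reversed back. *)
Lemma set_model_tree_like (W : Type) (H : digraph W) D (I O : W -> set V) (r : W -> V) :
  set_model H D I O r -> exists M : tree_like_model H D, forall v, root_of M v = r v.
Proof.
move=> [br dj ed].
have [Tin TinP] := branch_trees br.
have [T' T'P] := branch_trees (fun v Hv => branch_rev (br v Hv)).
pose Tout v := rev_digraph (T' v).
have ToutP v : dV H v ->
    [/\ out_arborescence (Tout v) (r v), dV (Tout v) = O v & subdigraph (Tout v) D].
  move=> /T'P[arb TO [sub subE]]; split=> //; first exact/out_arborescence_rev.
  by split=> // x y /subE.
have [mu muP] : exists mu : W -> W -> V * V, forall u v, dE H u v ->
    [/\ O u (mu u v).1, I v (mu u v).2 & dE D (mu u v).1 (mu u v).2].
  apply: (@exists_choice _ _ (fun u (f : W -> V * V) => forall v, dE H u v ->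
    [/\ O u (f v).1, I v (f v).2 & dE D (f v).1 (f v).2])) => u.
  apply: (@exists_choice _ _ (fun v (f : V * V) => dE H u v ->
    [/\ O u f.1, I v f.2 & dE D f.1 f.2])) => v.
  case: (pselect (dE H u v)) => [uv|no]; last by exists (r u, r u).
  by have [x [y ?]] := ed u v uv; exists (x, y).
unshelve eexists (@TreeLikeModel _ _ H D (fun v => dunion (Tin v) (Tout v)) mu Tin Tout r _ _ _ _ _ _ _ _) => //.
- move=> v Hv; have [_ _ [s1 e1]] := TinP v Hv; have [_ _ [s2 e2]] := ToutP v Hv.
  by split=> [x /= [/s1|/s2]//|x y /= [/e1|/e2]].
- move=> v w Hv Hw nvw; apply/seteqP; split=> // x /= [].
  have [_ -> _] := TinP v Hv; have [_ -> _] := ToutP v Hv.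
  have [_ -> _] := TinP w Hw; have [_ -> _] := ToutP w Hw.
  by move=> xv xw; case: nvw; exact: dj xv xw.
- by move=> v Hv; have [] := TinP v Hv.
- by move=> v Hv; have [] := ToutP v Hv.
- move=> v Hv; have [_ -> _] := TinP v Hv; have [_ -> _] := ToutP v Hv.
  have [_ _ Ir Or meet] := br v Hv.
  by apply/seteqP; split=> [x [Ix Ox]|x ->//]; exact: meet.
- by move=> u v /muP[].
- move=> u v uv; have [Hu Hv] := dE_V uv; have [? ? _] := muP u v uv.
  by have [_ -> _] := TinP v Hv; have [_ -> _] := ToutP u Hu.
Qed.

End Models.

Lemma first_hit (T : Type) (a : pred T) s : has a s ->
  exists s1 x s2, [/\ s = s1 ++ x :: s2, a x & ~~ has a s1].
Proof.
move=> ha; case: (split_find ha) => x s1 s2 ax na.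
by exists s1, x, s2; rewrite -cats1 -catA.
Qed.

Lemma last_hit (T : Type) (a : pred T) s : has a s ->
  exists s1 x s2, [/\ s = s1 ++ x :: s2, a x & ~~ has a s2].
Proof.
rewrite -has_rev => /first_hit[s2 [x [s1 [eqs ax na]]]].
exists (rev s1), x, (rev s2); split; rewrite ?has_rev //.
by rewrite -(revK s) eqs rev_cat rev_cons cat_rcons.
Qed.

Lemma mem_split (T : eqType) (x : T) s : x \in s -> exists s1 s2, s = s1 ++ x :: s2.
Proof. by case/splitPr => s1 s2; exists s1, s2. Qed.

(** * Paths as sequences *)

Section ListPaths.
Variables (V : eqType) (D : digraph V).
Implicit Types (A : set V) (p q : seq V).

Definition darc : rel V := fun x y => `[<dE D x y>].

Lemma path_reach A x p : dV D x -> path darc x p -> (forall z, z \in x :: p -> A z) ->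
  reach D A x (last x p).
Proof.
elim: p x => [|y p IHp] x Dx /=; first by move=> _ Ap; apply: reach_refl => //; apply: Ap; rewrite mem_head.
move=> /andP[/asboolP xy py] Ap.
apply: (reach_cons _ xy); first by apply: Ap; rewrite mem_head.
by apply: IHp => //; [have [] := dE_V xy|move=> z zp; apply: Ap; rewrite in_cons zp orbT].
Qed.

Lemma path_dV x p y : dV D x -> path darc x p -> y \in x :: p -> dV D y.
Proof.
elim: p x => [|z p IHp] x Dx /=; first by rewrite inE => _ /eqP->.
by move=> /andP[/asboolP xz pz]; rewrite in_cons => /orP[/eqP->//|]; apply: IHp => //; have [] := dE_V xz.
Qed.

Lemma path_reach_both A x p z : dV D x -> path darc x p -> (forall z, z \in x :: p -> A z) ->
  z \in x :: p -> reach D A x z /\ reach D A z (last x p).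
Proof.
move=> Dx px Ap zp; have Dz := path_dV Dx px zp.
elim: p x Dx px Ap zp => [|y p IHp] x Dx /= => [_ Ap|/andP[/asboolP xy py] Ap].
  by rewrite inE => /eqP->; split; apply: reach_refl => //; apply: Ap; rewrite mem_head.
have Ax : A x by apply: Ap; rewrite mem_head.
have Ap' w : w \in y :: p -> A w by move=> wp; apply: Ap; rewrite in_cons wp orbT.
have Dy : dV D y by have [] := dE_V xy.
rewrite in_cons => /orP[/eqP->|/(IHp y Dy py Ap')[yz zl]].
  by split; [exact: reach_refl|apply: (reach_cons Ax xy); exact: path_reach].
by split=> //; exact: reach_cons Ax xy yz.
Qed.

Lemma sorted_dV x p y : dV D x -> x \in p -> sorted darc p -> y \in p -> dV D y.
Proof.
move=> Dx xp sp yp; case: p xp sp yp => // a [|b p] xp.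
  by rewrite !inE in xp * => _ /eqP->; move: Dx; rewrite (eqP xp).
move=> pa yp; have Da : dV D a by (case/andP: (pa) => /asboolP ab _; have [] := dE_V ab).
exact: path_dV Da pa yp.
Qed.

Lemma sorted_branch p x q : dV D x -> sorted darc (rcons p x) -> path darc x q -> ~~ has (mem (rcons p x)) q ->
  branch D [set` rcons p x] [set` x :: q] x.
Proof.
move=> Dx sp pq npq; split=> [z /= zp|z /= zq| | |z /= zp].
- have Dh w : w \in rcons p x -> dV D w.
    by apply: (sorted_dV Dx _ sp); rewrite mem_rcons mem_head.
  case: p sp zp Dh {npq} => [|a p] /= => [_|pa zp Dh].
    by rewrite inE => /eqP-> Dh; apply: reach_refl; rewrite //= inE.
  have [] := @path_reach_both [set` a :: rcons p x] a (rcons p x) z _ pa (fun _ h => h) zp.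
    by apply: Dh; rewrite mem_head.
  by rewrite last_rcons.
- by have [] := @path_reach_both [set` x :: q] x q z Dx pq (fun _ h => h) zq.
- by rewrite /= mem_rcons mem_head.
- by rewrite /= mem_head.
- rewrite in_cons => /orP[/eqP//|zq]; case/hasP: npq; by exists z.
Qed.

Lemma reach_path A x y : reach D A x y ->
  exists p, [/\ path darc x p, last x p = y, uniq (x :: p) & forall z, z \in x :: p -> A z].
Proof.
move=> xy.
have [p [px lp Ap]] : exists p, [/\ path darc x p, last x p = y & forall z, z \in x :: p -> A z].
  elim: xy => [Ax _|z t _ [p [px lp Ap]] At zt].
    by exists [::]; split=> // z; rewrite inE => /eqP->.
  exists (rcons p t); rewrite rcons_path px lp last_rcons /darc asboolT //; split=> // w.
  by rewrite -rcons_cons mem_rcons in_cons => /orP[/eqP->|/Ap].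
case: (shortenP px) lp Ap => p' px' up' sub lp Ap; exists p'; split=> // z.
rewrite in_cons => /orP[/eqP->|/sub zp]; apply: Ap; rewrite ?mem_head //.
by rewrite in_cons zp orbT.
Qed.

End ListPaths.

(** * Double paths inside the union of a path to [u] and a path from [u] *)

Section Tendrils.
Variables (V : eqType) (D : digraph V).
Implicit Types (G : set V) (p q : seq V).

(* A model inside [G] of a double path with vertices 0, ..., k, with last root
   [u], that can be entered from [s] and left at [t] at its vertex 0. *)
Record tendril G (s t u : V) k (I O : nat -> set V) (r : nat -> V) : Prop := Tendril {
  td_branch : forall j, j <= k -> branch D (I j) (O j) (r j);
  td_sub : forall j x, j <= k -> (I j `|` O j) x -> G x;
  td_disjoint : forall x i j, i <= k -> j <= k ->
    (I i `|` O i) x -> (I j `|` O j) x -> i = j;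
  td_in : I 0 s;
  td_out : O 0 t;
  td_end : r k = u;
  td_up : forall j, j < k -> exists x y, [/\ O j x, I j.+1 y & dE D x y];
  td_down : forall j, j < k -> exists x y, [/\ O j.+1 x, I j y & dE D x y] }.

Lemma tendril_mono G G' s t u k I O r :
  G `<=` G' -> tendril G s t u k I O r -> tendril G' s t u k I O r.
Proof. by move=> GG' [b su di i o e up dn]; split=> // j x jk /(su j x jk)/GG'. Qed.

Definition ncons0 T (x : T) (f : nat -> T) j := if j is j'.+1 then f j' else x.

(** The new branch becomes vertex 0 and all others move up by one. The arc from [x] to [s] leads up
    the double path and the arc from [t] to [y] leads down. *)
Lemma tendril_cons G I0 O0 r0 s0 t0 x y s t u k I O r :
  branch D I0 O0 r0 -> I0 s0 -> O0 t0 -> O0 x -> dE D x s -> I0 y -> dE D t y ->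
  (forall z, (I0 `|` O0) z -> ~ G z) -> tendril G s t u k I O r ->
  tendril ((I0 `|` O0) `|` G) s0 t0 u k.+1 (ncons0 I0 I) (ncons0 O0 O) (ncons0 r0 r).
Proof.
move=> br Is Ot Ox xs Iy ty dis [b su di i o e up dn]; split=> //.
- by case=> [|j] //; exact: b.
- by case=> [|j] z /= jk; [left|move/(su j z jk); right].
- move=> z [|i'] [|j'] //= ik jk iz jz.
  + by case: (dis z iz); exact: su jz.
  + by case: (dis z jz); exact: su iz.
  + by congr _.+1; exact: di iz jz.
- by case=> [_|j /up//]; exists x, s.
- by case=> [_|j /dn//]; exists t, y.
Qed.

(** Let [x] be the last vertex of the return path that lies on the path [s :: p]. Then [p] up to [x]
    and the return path from [x] on form a branch. What remains is a shorter instance: [p] after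
    [x], and the return path before its first vertex on the part of [p] up to [x]. *)
Lemma tendril_seq s p q : dV D s -> path (darc D) s p -> uniq (s :: p) ->
  path (darc D) (last s p) q -> uniq (last s p :: q) ->
  exists k I O r,
    tendril [set` (s :: p) ++ (last s p :: q)] s (last (last s p) q) (last s p) k I O r.
Proof.
have [n] := ubnP (size p); elim: n s p q => // n IHn s p q szp Ds ps us.
have [u eu] : exists u, u = last s p by exists (last s p).
rewrite -eu => pq uq; have up : u \in s :: p by rewrite eu mem_last.
have Du : dV D u := path_dV Ds ps up.
have [|q1 [x [q2 [eqq xp nq2]]]] := @last_hit _ (mem (s :: p)) (u :: q).
  by apply/hasP; exists u => //; exact: mem_head.
have /= {}xp : x \in s :: p by [].
have Dx : dV D x := path_dV Ds ps xp.
have [p1 [p2 eqp]] : exists p1 p2, s :: p = rcons p1 x ++ p2.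
  by have [p1 [p2 ->]] := mem_split xp; exists p1, p2; rewrite cat_rcons.
have sp1 : sorted (darc D) (rcons p1 x).
  have : sorted (darc D) (s :: p) by [].
  by rewrite eqp => /cat_sorted2[].
have pq2 : path (darc D) x q2.
  have : sorted (darc D) (u :: q) by [].
  by rewrite eqq => /cat_sorted2[].
have npq : ~~ has (mem (rcons p1 x)) q2.
  apply: contra nq2 => /hasP[z zq zp]; apply/hasP; exists z => //=.
  by change (z \in s :: p); rewrite eqp mem_cat; apply/orP; left.
have br := sorted_branch Dx sp1 pq2 npq.
have sx : s \in rcons p1 x by case: (p1) eqp => [|? ?] /= [->]; rewrite mem_head.
have lq : last u q = last x q2.
  have -> : last u q = last u (u :: q) by [].
  by rewrite eqq last_cat.
have subI z : z \in rcons p1 x -> z \in (s :: p) ++ u :: q by rewrite mem_cat eqp mem_cat => ->.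
have subO z : z \in x :: q2 -> z \in (s :: p) ++ u :: q by rewrite [in X in _ -> X]mem_cat eqq [in X in _ -> X]mem_cat => ->; rewrite !orbT.
(* If nothing follows [x] on the first path, then [x] is [u] and this branch is the end of the
   double path, with [k = 0]. *)
case: p2 eqp => [|s' p2] eqp.
  have xu : x = u by rewrite eu -[last s p]/(last s (s :: p)) eqp cats0 last_rcons.
  exists 0, (fun _ => [set` rcons p1 x]), (fun _ => [set` x :: q2]), (fun _ => x); split=> //=.
  - by move=> j z _ [/subI|/subO].
  - by move=> ? [|?] [|?].
  - by rewrite lq mem_last.
have us' : uniq (rcons p1 x ++ s' :: p2) by rewrite -eqp.
have np2 z : z \in s' :: p2 -> z \notin rcons p1 x.
  by move=> zp; apply/negP => zp1; move: us'; rewrite cat_uniq => /and3P[_ /hasP[]]; exists z.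
have eu2 : last s' p2 = u by rewrite eu -[last s p]/(last s (s :: p)) eqp last_cat.
have [|q3 [y [q4 [eqq' /= yp nq3]]]] := @first_hit _ (mem (rcons p1 x)) (u :: q).
  apply/hasP; exists x; first by rewrite eqq mem_cat mem_head orbT.
  by rewrite /= mem_rcons mem_head.
case: q3 eqq' nq3 => [[uy _] _|u' q3 [<- eqq'] nq3].
  have /negP[] : u \notin rcons p1 x by apply: np2; rewrite -eu2 mem_last.
  by rewrite uy.
have : path (darc D) x (s' :: p2).
  have : sorted (darc D) (s :: p) by [].
  by rewrite eqp cat_rcons => /cat_sorted2[].
move=> /= /andP[/asboolP xs' ps'].
have uq3 : uniq (u :: q3) by move: uq; rewrite eqq' -cat_cons cat_uniq => /and3P[].
have /and3P[pq3 /asboolP q3y _] : [&& path (darc D) u q3, darc D (last u q3) y & path (darc D) y q4].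
  by move: pq; rewrite eqq' cat_path.
(* The kept part of the return path ends before [x], because [x] itself lies on the part of [p] that
   it avoids. As the return path has no repetitions, it also avoids everything from [x] on. *)
have dis z : z \in u :: q3 -> z \notin x :: q2.
  move=> zq3; apply/negP; rewrite in_cons => /orP[/eqP zx|zq2].
    by case/hasP: nq3; exists z => //=; rewrite zx mem_rcons mem_head.
  have xq3 : x \notin u :: q3.
    by apply/negP => xq3; case/hasP: nq3; exists x => //=; rewrite mem_rcons mem_head.
  have i1 : index z (u :: q) < size (u :: q3).
    by rewrite eqq' -cat_cons index_cat zq3 index_mem.
  have i2 : size (u :: q3) <= index x (u :: q).
    by rewrite eqq' -cat_cons index_cat (negPf xq3) leq_addr.
  move: uq i1 i2; rewrite eqq cat_uniq /= => /and3P[_ /norP[xq1 nq1] /andP[xq2 _]].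
  have zq1 : z \notin q1 by apply: contra nq1 => ?; apply/hasP; exists z.
  rewrite !index_cat (negPf zq1) (negPf xq1) /= eqxx.
  case: eqP => [xz|_ i1]; first by rewrite xz zq2 in xq2.
  by rewrite addn0 => /(leq_trans i1); rewrite ltnNge leq_addr.
have [||||||k [I [O [r td]]]] := IHn s' p2 q3.
- by move: szp (congr1 size eqp); rewrite /= size_cat size_rcons /=; clear; lia.
- by have [] := dE_V xs'.
- by [].
- by move: us'; rewrite cat_uniq => /and3P[].
- by rewrite eu2.
- by rewrite eu2.
rewrite eu2 in td.
exists k.+1, (ncons0 [set` rcons p1 x] I), (ncons0 [set` x :: q2] O), (ncons0 x r).
apply: tendril_mono (tendril_cons (x := x) (y := y) (G := [set` (s' :: p2) ++ u :: q3]) (s := s') (t := last u q3) br _ _ _ _ _ _ _ td) => //=.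
- move=> z [[/subI|/subO]//|zpq].
  move: zpq; change (z \in (s' :: p2) ++ u :: q3 -> z \in (s :: p) ++ u :: q).
  rewrite !mem_cat => /orP[zp|zq]; apply/orP; [left|right].
    by rewrite eqp mem_cat zp orbT.
  by rewrite eqq' -cat_cons mem_cat zq.
- by rewrite lq mem_last.
- by rewrite mem_head.
- move=> z [] /= zh; rewrite -cat_cons mem_cat => /orP[zp|zq].
  + by have := np2 _ zp; rewrite zh.
  + by case/hasP: nq3; exists z.
  + case/hasP: nq2; exists z; last by change (z \in s :: p); rewrite eqp mem_cat; apply/orP; right.
    move: zh; rewrite in_cons => /orP[/eqP zx|//].
    by have := np2 _ zp; rewrite zx mem_rcons mem_head.
  + by have := dis _ zq; rewrite zh.
Qed.

Lemma tendril_exists G s t u : reach D G s u -> reach D G u t ->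
  exists k I O r, tendril G s t u k I O r.
Proof.
move=> su ut; have [Gs Ds] := reach_inl su.
have [p [ps lp up Gp]] := reach_path su; have [q [pq lq uq Gq]] := reach_path ut.
have := @tendril_seq s p q Ds ps up; rewrite lp lq => /(_ pq uq)[k [I [O [r td]]]].
exists k, I, O, r; apply: tendril_mono td => z /=.
by rewrite -cat_cons mem_cat => /orP[/Gp|/Gq].
Qed.

End Tendrils.

Lemma infinite_image_can (S T : Type) (h : S -> T) (k : T -> S) (A : set S) :
  (forall x, A x -> k (h x) = x) -> infinite_set A -> infinite_set (h @` A).
Proof.
move=> kh infA finA; apply: infA; apply: (sub_finite_set _ (finite_image k finA)) => x Ax.
by exists (h x); [exists x|exact: kh].
Qed.

Lemma finite_at_most_one (T : Type) (A : set T) :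
  (forall x y, A x -> A y -> x = y) -> finite_set A.
Proof.
move=> A1; case: (pselect (exists x, A x)) => [[x Ax]|no].
  by apply: (sub_finite_set _ (finite_set1 x)) => y Ay; rewrite (A1 y x).
by apply: (sub_finite_set _ (finite_set0 T)) => y Ay; case: no; exists y.
Qed.

Lemma infinite_nat_unbounded (A : set nat) :
  (forall n, exists2 m, A m & n <= m) -> infinite_set A.
Proof.
move=> unb /finite_seqP[s As].
have [m Am] := unb (\max_(i <- s) i).+1.
have ms : m \in s by rewrite As in Am.
by rewrite ltnNge leq_bigmax_seq.
Qed.

(** * The star-comb argument in a tree *)

Section Fans.
Variables (V : eqType) (D : digraph V).

Definition ray_along (R : nat -> V) := injective R /\ forall i, dE D (R i) (R i.+1).

(* Paths [st u :: P u] to the vertices [u] in [U], starting on a ray or a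
   single vertex (when [R] is constant), such that every vertex not in
   [range R] lies on finitely many of them. *)
Record fan (U : set V) (R : nat -> V) (st : V -> V) (P : V -> seq V) : Prop := Fan {
  fan_core : (forall i, R i = R 0) \/ ray_along R;
  fan_dV : forall i, dV D (R i);
  fan_start : forall u, U u -> exists i, st u = R i;
  fan_path : forall u, U u -> [/\ path (darc D) (st u) (P u), last (st u) (P u) = u & uniq (st u :: P u)];
  fan_avoid : forall u x i, U u -> x \in P u -> x <> R i;
  fan_escape : forall v, finite_set [set u | U u /\ v \in P u];
  fan_tail : forall l, finite_set [set u | U u /\ ~ exists2 i, l <= i & st u = R i] }.

Variables (A : set V) (r : V) (dep : V -> nat) (par : V -> V).
Hypothesis AD : A `<=` dV D.
Hypothesis Ar : A r.
Hypothesis dep0 : dep r = 0.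
Hypothesis parP : forall x, A x -> x <> r -> A (par x) /\ dep x = (dep (par x)).+1.
Hypothesis parE : forall x, A x -> x <> r -> dE D (par x) x.

(** For [i <= dep x] this is the ancestor of [x] at depth [i]; depth thus serves as the coordinate
    along tree paths. *)
Let anc i x := iter (dep x - i) par x.

Let ancP i x : A x -> i <= dep x -> A (anc i x) /\ dep (anc i x) = i.
Proof.
move=> Ax ile; have [|Ai ->] := parent_iter parP Ax (i := dep x - i); first by rewrite dep0; lia.
by split=> //; lia.
Qed.

Let dep_root x : A x -> dep x = 0 -> x = r.
Proof. by move=> Ax d0; apply: (parent_dep parP Ax).2; rewrite d0 dep0. Qed.

Let anc_id x : anc (dep x) x = x.
Proof. by rewrite /anc subnn. Qed.

Let anc0 x : A x -> anc 0 x = r.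
Proof. by move=> Ax; have [Aa da] := ancP Ax (leq0n _); exact: dep_root. Qed.

Let anc_anc i j x : A x -> i <= j -> j <= dep x -> anc i (anc j x) = anc i x.
Proof.
move=> Ax ij jx; have [_ dj] := ancP Ax jx; rewrite /anc -/(anc j x) dj /anc -iterD.
by congr iter; lia.
Qed.

Let anc_par i x : A x -> i < dep x -> par (anc i.+1 x) = anc i x /\ anc i.+1 x <> r.
Proof.
move=> Ax ix; have [_ d] := ancP Ax ix.
split; last by move=> e; rewrite e dep0 in d.
by rewrite /anc (_ : dep x - i = (dep x - i.+1).+1); last lia.
Qed.

Let below v x := [/\ A x, dep v <= dep x & anc (dep v) x = v].

Let tpath v x := [seq anc i x | i <- iota (dep v).+1 (dep x - dep v)].

Let mem_tpath v x z : below v x -> z \in tpath v x ->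
  [/\ dep v < dep z, dep z <= dep x & z = anc (dep z) x].
Proof.
move=> [Ax vx _] /mapP[i]; rewrite mem_iota => ib ->.
by have [|_ ->] := ancP Ax (i := i); [lia|split=> //; lia].
Qed.

Let tpathP v x : below v x ->
  [/\ path (darc D) v (tpath v x), last v (tpath v x) = x & uniq (v :: tpath v x)].
Proof.
move=> bvx; have [Ax vx av] := bvx.
have gen m i : i + m = dep x ->
    path (darc D) (anc i x) [seq anc j x | j <- iota i.+1 m] /\
    last (anc i x) [seq anc j x | j <- iota i.+1 m] = x.
  elim: m i => [|m IHm] i im /=; first by rewrite addn0 in im; rewrite im anc_id.
  have [|-> ->] := IHm i.+1; first lia.
  split=> //; rewrite andbT; apply/asboolP.
  have ix : i < dep x by lia.
  have [<- nr] := anc_par Ax ix; apply: parE => //.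
  by have [] := ancP Ax ix.
have [|p l] := gen (dep x - dep v) (dep v); first lia.
rewrite av in p l; split=> //=; apply/andP; split.
  by apply/negP => /(mem_tpath bvx)[]; rewrite ltnn.
rewrite map_inj_in_uniq ?iota_uniq // => i j; rewrite !mem_iota => ib jb e.
have [|_ <-] := ancP Ax (i := i); first lia.
by have [|_ <-] := ancP Ax (i := j); [lia|rewrite e].
Qed.

Let meet_anc x y z i : A x -> A y -> dep z <= dep x -> z = anc (dep z) x ->
  dep z <= dep y -> z = anc (dep z) y -> i <= dep z -> anc i x = anc i y.
Proof.
move=> Ax Ay zx ex zy ey iz.
by rewrite -(anc_anc Ax iz zx) -ex {1}ey (anc_anc Ay iz zy).
Qed.

(** If some [v] has infinitely many children with a member of [U] below them, one member per child
    gives a fan with the constant core [v]. Otherwise Koenig's lemma yields a ray [R] of vertices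
    that each have infinitely many members of [U] below them, and one member is kept for each index
    at which a tree path leaves [R]. *)
Lemma fan_of_tree (U : set V) : U `<=` A -> infinite_set U ->
  exists U' R st P, [/\ U' `<=` U, infinite_set U' & fan U' R st P].
Proof.
move=> UA infU.
pose Ch v := [set w | [/\ A w, w <> r, par w = v & exists2 u, U u & below w u]].
case: (pselect (exists2 v, A v & infinite_set (Ch v))) => [[v Av infCh]|finCh].
  have [h hP] : exists h : V -> V, forall w, Ch v w -> U (h w) /\ below w (h w).
    apply: (@exists_choice _ _ (fun w u => Ch v w -> U u /\ below w u)) => w.
    case: (pselect (Ch v w)) => [[_ _ _ [u Uu b]]|]; first by exists u.
    by exists v.
  have hC w : Ch v w -> anc (dep v).+1 (h w) = w.
    move=> Cw; have [Aw nr pw _] := Cw; have [_ [_ _ a]] := hP w Cw.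
    by have [_] := parP Aw nr; rewrite pw => <-.
  have hb w : Ch v w -> below v (h w).
    move=> Cw; have [Aw nr pw _] := Cw; have [Uh [Ah dh a]] := hP w Cw.
    have [_] := parP Aw nr; rewrite pw => dw; split=> //; first lia.
    have lt : dep v < dep (h w) by lia.
    by have [<- _] := anc_par Ah lt; rewrite hC.
  exists (h @` Ch v), (fun _ => v), (fun _ => v), (tpath v); split.
  - by move=> _ [w /hP[Uh _] <-].
  - exact: infinite_image_can hC infCh.
  - split=> [|i|u Uu|u|u x i|z|l].
    + by left.
    + exact: AD.
    + by exists 0.
    + by case=> w Cw <-; apply: tpathP; exact: hb.
    + by move=> [w Cw <-] /(mem_tpath (hb w Cw))[lt _ _] e; rewrite e ltnn in lt.
    + apply: finite_at_most_one => u u' /= [[w Cw <-] zw] [[w' Cw' <-] zw'].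
      have [vz zh eh] := mem_tpath (hb w Cw) zw.
      have [_ zh' eh'] := mem_tpath (hb w' Cw') zw'.
      have [_ [Ah _ _]] := hP w Cw; have [_ [Ah' _ _]] := hP w' Cw'.
      by rewrite -(hC w Cw) (meet_anc Ah Ah' zh eh zh' eh' vz) hC.
    + apply: (sub_finite_set _ (finite_set0 V)) => u /= [_ []]; by exists l.
pose big v := A v /\ infinite_set (U `&` below v).
have bigr : big r.
  split=> //; apply: (sub_infinite_set _ infU) => u Uu; split=> //.
  by have Au := UA u Uu; split=> //; rewrite dep0 //; exact: anc0.
have next v : exists w, big v -> [/\ big w, w <> r & par w = v].
  case: (pselect (big v)) => [[Av bv]|]; last by exists v.
  apply: contrapT => no; apply: bv.
  apply: (@sub_finite_set _ _ ([set v] `|` \bigcup_(w in Ch v) (U `&` below w))).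
    move=> u [Uu [Au vu a]].
    case: (ltngtP (dep v) (dep u)) vu => // [lt _|e _]; last by left; rewrite /= -a e anc_id.
    right; have [pa nr] := anc_par Au lt; have [Aa da] := ancP Au lt.
    have b : below (anc (dep v).+1 u) u by split=> //; rewrite da.
    exists (anc (dep v).+1 u); last by split.
    by split=> //; [rewrite pa|exists u].
  rewrite finite_setU; split; first exact: finite_set1.
  apply: bigcup_finite.
    by apply: contrapT => inf; case: finCh; exists v.
  move=> w [Aw nr pw _]; apply: contrapT => inf; case: no; exists w => _; split=> //.
have [nx nxP] := exists_choice next.
pose R i := iter i nx r.
have bR i : big (R i) by elim: i => [//|i IHi] /=; have [] := nxP _ IHi.
have pR i : R i.+1 <> r /\ par (R i.+1) = R i by have [] := nxP _ (bR i).
have AR i : A (R i) by have [] := bR i.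
have dR i : dep (R i) = i.
  by elim: i => [//|i IHi]; have [nr pi] := pR i; have [_ ->] := parP (AR i.+1) nr; rewrite pi IHi.
(* [m x] is the largest index at which the tree path from the root to [x] is still on [R]. *)
have [m mP] : exists m : V -> nat, forall x, A x ->
    [/\ m x <= dep x, anc (m x) x = R (m x) & forall i, i <= dep x -> anc i x = R i -> i <= m x].
  apply: (@exists_choice _ _ (fun x m => A x ->
    [/\ m <= dep x, anc m x = R m & forall i, i <= dep x -> anc i x = R i -> i <= m])) => x.
  case: (pselect (A x)) => [Ax|]; last by exists 0.
  have ex : exists i, (i <= dep x) && (anc i x == R i) by exists 0; rewrite anc0 //= eqxx.
  have bd i : (i <= dep x) && (anc i x == R i) -> i <= dep x by case/andP.
  exists (ex_maxn ex bd) => _; case: ex_maxnP => i /andP[ix /eqP e] imax; split=> // j jx ej.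
  by apply: imax; rewrite jx ej eqxx.
pose Ms := m @` U.
(* Arbitrarily large indices occur: a member of [U] below [R n] leaves the ray at index [n] or
   later. *)
have infM : infinite_set Ms.
  apply: infinite_nat_unbounded => n; have [_ bn] := bR n.
  have [u [Uu [Au nu a]]] := infinite_setN0 bn; rewrite dR in nu a.
  exists (m u); first by exists u.
  by have [_ _] := mP u Au; apply.
have [g gP] : exists g : nat -> V, forall i, Ms i -> U (g i) /\ m (g i) = i.
  apply: (@exists_choice _ _ (fun i u => Ms i -> U u /\ m u = i)) => i.
  by case: (pselect (Ms i)) => [[u Uu e]|]; [exists u|exists r].
have gU i : Ms i -> [/\ A (g i), m (g i) = i & below (R i) (g i)].
  move=> /gP[/UA Ag e]; have [le a _] := mP _ Ag; rewrite e in le a; split=> //.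
  by rewrite /below dR.
exists (g @` Ms), R, (fun u => R (m u)), (fun u => tpath (R (m u)) u); split.
- by move=> _ [i /gP[Ug _] <-].
- by apply: (infinite_image_can (k := m)) infM => i /gP[].
have lt_mem u z : (g @` Ms) u -> z \in tpath (R (m u)) u ->
    [/\ A u, m u < dep z, dep z <= dep u & z = anc (dep z) u].
  move=> [i Mi <-]; have [Ag e b] := gU i Mi; rewrite e => /(mem_tpath b).
  by rewrite dR => -[].
have max_mem u z i : (g @` Ms) u -> z \in tpath (R (m u)) u -> i <= dep z -> m u < i -> anc i u <> R i.
  move=> Gu zu iz mi ei; have [Au _ zu' _] := lt_mem u z Gu zu.
  have [_ _ mmax] := mP u Au.
  by have := mmax i (leq_trans iz zu') ei; rewrite leqNgt mi.
split=> [|i|u Uu|u|u x i|z|l].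
- right; split=> [i j e|i]; first by rewrite -(dR i) e dR.
  by have [nr <-] := pR i; exact: parE.
- exact: AD.
- by exists (m u).
- by move=> [i Mi <-]; have [_ e b] := gU i Mi; rewrite e; exact: tpathP.
- move=> Gu xu e; have [Au mz zu a] := lt_mem u x Gu xu.
  apply: (max_mem u x (dep x) Gu xu) => //; by rewrite -a e dR.
(* If two paths share [z], their ends have the same ancestors up to [z] and hence leave [R] at the
   same index. Only one member was chosen for each index. *)
- apply: finite_at_most_one => u u' /= [Gu zu] [Gu' zu'].
  have [Au mz zle a] := lt_mem u z Gu zu; have [Au' mz' zle' a'] := lt_mem u' z Gu' zu'.
  have [_ e _] := mP u Au; have [_ e' _] := mP u' Au'.
  have mm : m u = m u'.
    case: (ltngtP (m u) (m u')) => // lt.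
      case: (max_mem u z (m u') Gu zu) => //; first lia.
      by rewrite (meet_anc Au Au' zle a zle' a') //; lia.
    case: (max_mem u' z (m u) Gu' zu') => //; first lia.
    by rewrite -(meet_anc Au Au' zle a zle' a') //; lia.
  case: Gu Gu' mm => i Mi <- [j Mj <-].
  by have [_ -> _] := gU i Mi; have [_ -> _] := gU j Mj => ->.
- apply: (@sub_finite_set _ _ (g @` `I_l)); last exact: finite_image (finite_II l).
  move=> u /= [[i Mi <-] no]; have [_ e _] := gU i Mi; exists i => //=.
  by rewrite ltnNge; apply/negP => li; case: no; exists i; rewrite ?e.
Qed.

End Fans.

(** The breadth-first in-tree towards [r] in the reversed digraph is an out-tree of [D] with root
    [r]. *)
Lemma fan_exists (V : eqType) (D : digraph V) (r : V) (U : set V) :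
  dV D r -> (forall u, U u -> reach D setT r u) -> infinite_set U ->
  exists U' R st P, [/\ U' `<=` U, infinite_set U' & fan D U' R st P].
Proof.
move=> Dr Ur infU; have [dep [par parP]] := bfs (rev_digraph D) setT r.
pose A := [set x | reach (rev_digraph D) setT x r].
have Ar : A r by apply: reach_refl.
have parP1 x : A x -> x <> r -> A (par x) /\ dep x = (dep (par x)).+1.
  by move=> Ax nr; have [] := parP x Ax nr.
(* A shift that gives the root depth 0, as [fan_of_tree] requires; [bfs] says nothing about the
   depth of [r]. *)
pose dep' x := dep x - dep r.
apply: (@fan_of_tree V D A r dep' par _ Ar) => //.
- by move=> x Ax; have [] := reach_inl Ax.
- by rewrite /dep' subnn.
- move=> x Ax nr; have [Ap e] := parP1 x Ax nr; split=> //.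
  by have [le _] := parent_dep parP1 Ap; rewrite /dep' e subSn.
- by move=> x Ax nr; have [] := parP x Ax nr.
- by move=> u /Ur ru; apply/reach_revE.
Qed.

Lemma incr_leq (F : nat -> nat) k l : (forall n, F n < F n.+1) -> k < l -> F k.+1 <= F l.
Proof.
move=> FF; elim: l => // l IHl; rewrite ltnS leq_eqVlt => /orP[/eqP->//|/IHl le].
by apply: (leq_trans le); exact: ltnW.
Qed.

Lemma incr_interval (F : nat -> nat) k l i : (forall n, F n < F n.+1) ->
  F k <= i < F k.+1 -> F l <= i < F l.+1 -> k = l.
Proof.
move=> FF /andP[k1 k2] /andP[l1 l2]; case: (ltngtP k l) => // /(incr_leq FF) le.
  by have := leq_trans k2 (leq_trans le l1); rewrite ltnn.
by have := leq_trans l2 (leq_trans le k1); rewrite ltnn.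
Qed.

(** * Thinning out to disjoint supports *)

Section Selection.
Variables (V : eqType) (U : set V) (supp extra : V -> seq V).

Lemma escape_seq (W : set V) : (forall v, finite_set [set u | W u /\ v \in supp u]) ->
  forall s : seq V, finite_set [set u | W u /\ has (mem s) (supp u)].
Proof.
move=> esc; elim=> [|v s IHs].
  by apply: (sub_finite_set _ (finite_set0 V)) => u /= [_ /hasP[]].
apply: (@sub_finite_set _ _ ([set u | W u /\ v \in supp u] `|` [set u | W u /\ has (mem s) (supp u)])).
  move=> u /= [Wu /hasP[x xu]]; rewrite /= in_cons => /orP[/eqP e|xs]; [left|right]; split=> //.
    by rewrite -e.
  by apply/hasP; exists x.
by rewrite finite_setU; split.
Qed.

(** A greedy choice: [st k] lists everything that the earlier members occupy or forbid, and only
    finitely many supports meet this finite list. The lists [extra] bind later members only; filled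
    with initial segments of rays, they will force indices to increase. *)
Lemma select : infinite_set U -> (forall v, finite_set [set u | U u /\ v \in supp u]) ->
  exists f : nat -> V, [/\ forall k, U (f k),
    forall k l x, x \in supp (f k) -> x \in supp (f l) -> k = l &
    forall k l x, k < l -> x \in supp (f l) -> x \notin extra (f k)].
Proof.
move=> infU esc.
have pick (s : seq V) : exists u, U u /\ ~~ has (mem s) (supp u).
  have [u [Uu nu]] := infinite_setN0 (infinite_setD infU (escape_seq esc s)).
  by exists u; split=> //; apply/negP => h; apply: nu.
have [p pP] := exists_choice pick.
pose st k := iter k (fun s => s ++ supp (p s) ++ extra (p s)) [::].
have st_in k l x : k < l -> x \in supp (p (st k)) ++ extra (p (st k)) -> x \in st l.
  move=> kl xk; elim: l kl => // l IHl.
  by rewrite ltnS leq_eqVlt /= mem_cat => /orP[/eqP <-|/IHl ->//]; rewrite xk orbT.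
have fresh k l x : k < l -> x \in supp (p (st l)) -> x \notin supp (p (st k)) ++ extra (p (st k)).
  move=> kl xl; apply/negP => /(st_in _ _ _ kl) xs; have [_ /hasP[]] := pP (st l).
  by exists x.
exists (fun k => p (st k)); split=> [k|k l x xk xl|k l x kl /(fresh k l x kl)].
- by have [] := pP (st k).
- case: (ltngtP k l) => // lt.
    by have := fresh k l x lt xl; rewrite mem_cat xk.
  by have := fresh l k x lt xk; rewrite mem_cat xl.
- by rewrite mem_cat negb_or => /andP[].
Qed.

End Selection.

(** * Closure of the shapes under reversal *)

Section ReversedShapes.
Variable W : Type.
Implicit Types (H : digraph W) (Y : set W).

Lemma rev_doubling (G : graph W) : rev_digraph (doubling G) = doubling G.
Proof. by apply: eq_digraph => // u v; split; exact: gE_sym. Qed.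

Lemma rev_dominated H : dominated_directed_ray H -> dominated_directed_ray (rev_digraph H).
Proof.
case=> R [r [VH dom]]; exists (rev_digraph R), r; split=> //.
case: dom => [[[arb ray deg] HE]|[[arb ray deg] HE]]; [right|left]; split.
- by split; rewrite ?underlying_rev //; exact/in_arborescence_rev.
- by move=> u v /=; rewrite HE.
- by split; rewrite ?underlying_rev //; exact/out_arborescence_rev.
- by move=> u v /=; rewrite HE.
Qed.

Lemma rev_replaces (G : graph W) (J : set W) K a H : replaces G J K a H ->
  replaces G J (fun j => rev_digraph (K j)) a (rev_digraph H).
Proof.
case=> JG Kd aP VH HE; split=> // u v; rewrite /= HE; split.
  by case=> [?|[x [y [xy -> ->]]]]; [left|right; exists y, x; split=> //; exact: gE_sym].
by case=> [?|[x [y [xy -> ->]]]]; [left|right; exists y, x; split=> //; exact: gE_sym].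
Qed.

Lemma rev_shaped_by_star H Y : shaped_by_star H Y -> shaped_by_star (rev_digraph H) Y.
Proof.
case=> [[dom eY]|[S [Sst eY SH]]]; first by left; split=> //; exact: rev_dominated.
right; exists S; split=> //; case: SH => [->|[w [K [a [Sw rep dom Kw inj]]]]].
  by left; rewrite rev_doubling.
right; exists w, (fun j => rev_digraph (K j)), a; split=> //; first exact: rev_replaces.
exact: rev_dominated.
Qed.

Lemma rev_shaped_by_comb H Y : shaped_by_comb H Y -> shaped_by_comb (rev_digraph H) Y.
Proof.
case=> C [CY CH]; exists C; split=> //.
case: CH => [->|[K [a [rep tri comp tooth]]]]; first by left; rewrite rev_doubling.
right; exists (fun j => rev_digraph (K j)), a; split=> //; first exact: rev_replaces.
(* The triangle through [x], [y], [z] read backwards passes through [x], [z], [y]. *)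
move=> j /tri[x [y [z [xy yz zx VK EK]]]]; exists x, z, y; split; try exact: nesym.
  by rewrite /= VK setUAC.
move=> u v; rewrite /= EK.
by split=> -[[-> ->]|[-> ->]|[-> ->]]; first [by apply: Or31|by apply: Or32|by apply: Or33].
Qed.

End ReversedShapes.

Section Degrees.

Lemma card_set_seq (T : eqType) (s : seq T) n : uniq s -> ([set` s] #= `I_n)%card <-> n = size s.
Proof.
move=> us; have cs : ([set` s] #= `I_(size s))%card.
  elim: s us => [_|x s IHs /= /andP[xs us]].
    by rewrite (_ : [set` [::]] = set0) ?II0 //; apply/seteqP; split.
  apply/eq_cardSP; exists x; first by rewrite /= mem_head.
  rewrite (_ : _ `\ x = [set` s]); first exact: IHs.
  apply/seteqP; split=> y /=; rewrite in_cons.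
    by case=> /orP[/eqP->|//].
  by move=> ys; rewrite ys orbT; split=> // yx; rewrite -yx ys in xs.
split=> [cn|->//].
apply/card_eq_II; apply: card_eq_trans cs; by rewrite card_eq_sym.
Qed.

Lemma degree_seq (T : eqType) (G : graph T) v n s : uniq s -> (forall u, gE G v u <-> u \in s) ->
  has_degree G v n <-> n = size s.
Proof.
move=> us nb; rewrite -(card_set_seq n us) /has_degree.
by rewrite (_ : nbr G v = [set` s]) //; apply/seteqP; split=> u /= /nb.
Qed.

Lemma degree1_eq (T : Type) (G : graph T) v x y : has_degree G v 1 -> gE G v x -> gE G v y -> x = y.
Proof.
rewrite /has_degree => /eq_cardSP[z _]; rewrite II0 card_eq0 => /eqP e vx vy.
have eqz t : gE G v t -> t = z.
  move=> vt; apply: contrapT => tz.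
  by have : (nbr G v `\ z) t by []; rewrite e.
by rewrite (eqz x) // (eqz y).
Qed.

End Degrees.

Section PathGraphs.
Variables (W : Type) (f : nat -> W).

(** The conjunct [u <> v] makes this a graph for every [f]; for injective [f] it holds by itself. *)
Program Definition path_graph n : graph W :=
  @Graph W [set f i | i in [set i | i <= n]]
    (fun u v => u <> v /\ exists2 i, i < n & (u = f i /\ v = f i.+1) \/ (v = f i /\ u = f i.+1)) _ _ _.
Next Obligation. by move=> n u v /= [_ [i ilt [[-> _]|[_ ->]]]]; [exists i|exists i.+1] => //=; exact: ltnW. Qed.
Next Obligation. by move=> n u v /= [uv [i ilt e]]; split; [exact: nesym|exists i => //; case: e; auto]. Qed.
Next Obligation. by move=> n u /= []. Qed.

Lemma path_graphP n : (forall i j, i <= n -> j <= n -> f i = f j -> i = j) ->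
  is_path (path_graph n) (f 0) (f n).
Proof.
move=> inj; exists n, f; split=> // u v; split=> [[_ //]|e]; split=> // euv.
case: e => i ilt; rewrite euv => -[[-> /inj e]|[-> /inj e]]; have := e (ltnW ilt) ilt; lia.
Qed.

Program Definition ray_graph : graph W :=
  @Graph W (range f) (fun u v => u <> v /\ exists i, (u = f i /\ v = f i.+1) \/ (v = f i /\ u = f i.+1)) _ _ _.
Next Obligation. by move=> u v /= [_ [i [[-> _]|[_ ->]]]]; [exists i|exists i.+1]. Qed.
Next Obligation. by move=> u v /= [uv [i e]]; split; [exact: nesym|exists i; case: e; auto]. Qed.
Next Obligation. by move=> u /= []. Qed.

Lemma ray_graphP : injective f -> is_ray ray_graph.
Proof.
move=> inj; exists f; split=> // u v; split=> [[_ //]|e]; split=> // euv.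
by case: e => i; rewrite euv => -[[-> /inj e]|[-> /inj e]]; lia.
Qed.

End PathGraphs.

(** Butterfly minors are handled in this form throughout; arborescences appear only at the very end,
    through [set_model_tree_like]. The shape is a parameter so that reversal and passing to subsets
    of [U] are proved once. *)
Definition realizes (shape : forall W, digraph W -> set W -> Prop) (V : Type) (D : digraph V) (U : set V) :=
  exists (W : Type) (H : digraph W) (Y : set W) (I O : W -> set V) (r : W -> V),
    [/\ set_model H D I O r, shape W H Y & forall y, Y y -> U (r y)].

Lemma realizes_rev (shape : forall W, digraph W -> set W -> Prop) (V : Type) (D : digraph V) (U : set V) :
  (forall W H Y, shape W H Y -> shape W (rev_digraph H) Y) ->
  realizes shape (rev_digraph D) U -> realizes shape D U.
Proof.
move=> srev [W [H [Y [I [O [r [mod sh YU]]]]]]].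
exists W, (rev_digraph H), Y, O, I, r; split=> //; last exact: srev.
by have := set_model_rev mod; rewrite rev_digraphK.
Qed.

(** * Concrete stars and dominated rays *)

Section Stars.
Variable m : nat -> nat.

(** All spokes have the centre [(0, 0)] in position 0. The codes [(i, 0)] with [i > 0] remain free
    and become further vertices of the dominated ray in [dom_star]. *)
Definition spoke i j : nat * nat := if j is 0 then (0, 0) else (i, j).

Definition star := gbigunion (fun i => path_graph (spoke i) (m i).+1).

Lemma spoke_inj i j i' j' : spoke i j = spoke i' j' -> j = j' /\ (0 < j -> i = i').
Proof. by case: j j' => [|j] [|j'] //= [-> ->]. Qed.

Lemma star_subdivided : is_subdivided_star star.
Proof.
exists (0, 0), (fun i => path_graph (spoke i) (m i).+1), (fun i => (i, (m i).+1)); split=> //.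
- move=> i; apply: (@path_graphP _ (spoke i) (m i).+1) => j j' _ _ /spoke_inj[]//.
- move=> i i' ii'; apply/seteqP; split=> v /=.
    case=> -[j _ <-] [j' _ /spoke_inj[e ij]]; case: j e ij => [//|j] e ij.
    by case: ii'; rewrite ij // e.
  by move=> ->; split; exists 0.
Qed.

Lemma star_V v : gV star v <-> v = (0, 0) \/ 0 < v.2 <= (m v.1).+1.
Proof.
split=> [[i _ [[|j] jm <-]]|]; [by left|by right|].
case=> [->|]; first by exists 0 => //; exists 0.
by case: v => i [|j] //= jm; exists i => //; exists j.+1.
Qed.

Lemma star_E u v : gE star u v <-> exists i j, j < (m i).+1 /\
  ((u = spoke i j /\ v = spoke i j.+1) \/ (v = spoke i j /\ u = spoke i j.+1)).
Proof.
split=> [[i [_ [j jm e]]]|[i [j [jm e]]]]; first by exists i, j.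
exists i; split; last by exists j.
by case: e => -[-> ->] /spoke_inj[]; lia.
Qed.

(** The centre has the two neighbours [(0, 1)] and [(1, 1)], and an inner vertex of a spoke has two
    neighbours on it; only the ends of spokes can have degree 1. *)
Lemma star_leaf v : leaves star v -> exists i, v = (i, (m i).+1).
Proof.
move=> [/star_V vS deg].
case: vS => [e|].
  have nb i : gE star v (i, 1) by apply/star_E; exists i, 0; split=> //; left.
  by have := degree1_eq deg (nb 0) (nb 1).
case: v deg => i [|j] //= deg; rewrite ltnS leq_eqVlt => /orP[/eqP->|jm]; first by exists i.
have e1 : gE star (i, j.+1) (spoke i j) by apply/star_E; exists i, j; split; [lia|right].
have e2 : gE star (i, j.+1) (i, j.+2) by apply/star_E; exists i, j.+1; split; [lia|left].
by have := degree1_eq deg e1 e2; case: (j) => [|?] //= []; lia.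
Qed.

Lemma star_nbr0 : nbr star (0, 0) = range (fun i => (i, 1)).
Proof.
apply/seteqP; split=> v /=; last by case=> i _ <-; apply/star_E; exists i, 0; split=> //; left.
move=> /star_E[i [[|j] [jm [[e1 e2]|[e1 e2]]]]] //; first by exists i.
Qed.

End Stars.

Section DominatedRay.

(** This is the in-ray version of a dominated ray, with root [(0, 0)]. The out-ray version arises
    from it by reversal. *)
Definition dom_edge (u v : nat * nat) := [/\ u.2 = 0, v.2 = 0 & u.1 = v.1.+1 \/ (u.1 = 0 /\ 0 < v.1)].

Program Definition dom_ray : digraph (nat * nat) :=
  @Digraph (nat * nat) [set v | v.2 = 0] dom_edge _.
Next Obligation. by move=> u v []. Qed.

Let rayV : set (nat * nat) := [set v | v.2 = 0].
Let par (v : nat * nat) := (v.1.-1, v.2).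

Lemma rayVS v : rayV v -> v <> (0, 0) -> exists n, v = (n.+1, 0).
Proof. by case: v => [[|n] j]; rewrite /rayV /= => -> //; exists n. Qed.

Lemma dom_ray_par v : rayV v -> v <> (0, 0) -> rayV (par v) /\ v.1 = (par v).1.+1.
Proof. by move=> v0 /(rayVS v0)[n ->]. Qed.

Lemma dom_rayP : dominated_directed_ray dom_ray.
Proof.
pose R := parent_digraph dom_ray_par.
have RE u v : gE (underlying R) u v <-> [/\ u.2 = 0, v.2 = 0 & u.1 = v.1.+1 \/ v.1 = u.1.+1].
  split=> [[_ [[Ru nu ->]|[Rv nv ->]]]|].
  - by have [n ->] := rayVS Ru nu; split=> //; left.
  - by have [n ->] := rayVS Rv nv; split=> //; right.
  case: u v => n j [n' j'] /= [-> -> [->|->]]; split; try (by case; lia).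
    by left; split.
  by right; split.
exists R, (0, 0); split=> //; right; split; first split.
- exact: (@parent_arborescence _ rayV (0, 0) (fun v => v.1)).
- exists (fun n => (n, 0)); split=> [n n' [//]||u v].
    apply/seteqP; split=> [[n j] nj|_ [n _ <-]//]; exists n => //.
    by have -> : j = 0 := nj.
  rewrite RE; split=> [[]|[i [[-> ->]|[-> ->]]]]; [|by split=> //; right|by split=> //; left].
  by case: u v => n j [n' j'] /= -> -> [->|->]; [exists n'|exists n]; [right|left].
- apply/(@degree_seq _ _ _ _ [:: (1, 0)]) => // u; rewrite RE inE /=.
  split=> [[_ e [|]]//|/eqP->]; last by split=> //; right.
  by case: u e => n j /= -> ->.
- move=> u v; rewrite /= /dom_edge; split.
    case: u v => n j [n' j'] /= [-> -> [->|[-> lt]]]; first by left; split.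
    by right; split=> // -[e]; rewrite e in lt.
  case=> [[Ru nu ->]|[Rv nv ->]].
    by have [n ->] := rayVS Ru nu; split=> //; left.
  by have [n ->] := rayVS Rv nv; split=> //; right.
Qed.

End DominatedRay.

Section DominatedStar.
Variable m : nat -> nat.

Definition spike (u v : nat * nat) := [/\ u.1 = v.1, u.2 <= (m u.1).+1, v.2 <= (m v.1).+1 &
  u.2 = v.2.+1 \/ v.2 = u.2.+1].

Program Definition dom_star : digraph (nat * nat) :=
  @Digraph (nat * nat) [set v | v.2 <= (m v.1).+1] (fun u v => dom_edge u v \/ spike u v) _.
Next Obligation. by move=> u v /= [[-> -> _]|[]]. Qed.

(** At the centre, the edge to spoke [i] moves to the ray vertex [(i, 0)]; elsewhere the end of an
    edge stays where it was. *)
Definition attach (x y : nat * nat) : nat * nat := if x.2 is 0 then (y.1, 0) else x.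

Lemma dom_star_shaped : shaped_by_star dom_star (leaves (star m)).
Proof.
right; exists (star m); split=> //; first exact: star_subdivided.
right; exists (0, 0), (fun _ => dom_ray), attach; split.
- split; first by apply/star_V; left.
  rewrite star_nbr0; apply: (@infinite_image_can _ _ _ fst) => //; exact: infinite_nat.
- split.
  + by move=> v ->; apply/star_V; left.
  + split; first by move=> i j -> ->.
    move=> j _; apply/seteqP; split=> // -[i k] [/= -> [/star_V[//|/=]]]; by case.
  + move=> x y /star_E[i [j [jm e]]]; split=> [->//|nx].
    by case: e nx => -[e1 e2]; rewrite ?e1 ?e2; case: (j) => [|k] nx //; case: nx.
  + apply/seteqP; split=> [[i [|j]] /= vm|[i j] /=].
    * by right; exists (0, 0).
    * by left; split=> //; apply/star_V; right.
    * by case=> [[/star_V[//|/=/andP[]//]]|[_ _ e]]; have -> : j = 0 by [].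
  + move=> u v /=; split.
      case=> [d|[e um vm s]]; first by left; exists (0, 0).
      case: u v e um vm s => i j [i' j'] /= <- um vm s; right.
      case: s => e; subst.
        exists (spoke i j'.+1), (spoke i j'); split=> //; last by case: (j').
        by apply/star_E; exists i, j'; split=> //; right.
      exists (spoke i j), (spoke i j.+1); split=> //; last by case: (j).
      by apply/star_E; exists i, j; split=> //; left.
    case=> [[_ _ d]|[x [y [/star_E[i [j [jm e]]] -> ->]]]]; first by left.
    right; case: e => -[-> ->]; case: j jm => [|j] jm; rewrite /attach /spoke /spike /=; split=> //; try lia; by [left|right].
- exact: dom_rayP.
- rewrite star_nbr0; apply/seteqP; split=> [[i j] j0|_ [_ [i _ <-] <-]//]; have -> : j = 0 by [].
  by exists (i, 1) => //; exists i.
- by move=> x y; rewrite star_nbr0 => -[i _ <-] [j _ <-]; rewrite /attach /= => -[->].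
Qed.

End DominatedStar.

(** * Stars assembled from disjoint tendrils *)

Section StarModels.
Variables (V : eqType) (D : digraph V) (U : set V).
Variables (m : nat -> nat) (G : nat -> set V) (s t u : nat -> V).
Variables (I O : nat -> nat -> set V) (r : nat -> nat -> V).
Hypothesis td : forall i, tendril D (G i) (s i) (t i) (u i) (m i) (I i) (O i) (r i).
Hypothesis Gdis : forall i j x, G i x -> G j x -> i = j.
Hypothesis uU : forall i, U (u i).

Lemma tendrils_disjoint i j i' j' x : j <= m i -> j' <= m i' ->
  (I i j `|` O i j) x -> (I i' j' `|` O i' j') x -> (i, j) = (i', j').
Proof.
move=> jm jm' xj xj'.
have ii' : i = i' by apply: Gdis (td_sub (td i) jm xj) (td_sub (td i') jm' xj').
by subst i'; congr pair; exact: (td_disjoint (td i) jm jm' xj xj').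
Qed.

Lemma star_realizes (Ic Oc : set V) rc : branch D Ic Oc rc ->
  (forall i x, G i x -> ~ (Ic `|` Oc) x) ->
  (forall i, exists2 x, Oc x & dE D x (s i)) -> (forall i, exists2 y, Ic y & dE D (t i) y) ->
  realizes shaped_by_star D U.
Proof.
move=> br dis toS fromT.
(* Position [j.+1] on spoke [i] is vertex [j] of tendril [i], because a tendril is joined to the
   centre by one further edge. *)
pose cl (T : Type) (c : T) (f : nat -> nat -> T) (v : nat * nat) := if v.2 is j.+1 then f v.1 j else c.
exists (nat * nat)%type, (doubling (star m)), (leaves (star m)), (cl _ Ic I), (cl _ Oc O), (cl _ rc r).
split.
- split.
  + move=> [i [|j]] /star_V[e|/= jm]; rewrite /cl /= ?e; by [|exact: br|exact: (td_branch (td i))].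
  + move=> x [i [|j]] [i' [|j']] /star_V /= Hv /star_V /= Hw xv xw.
    * by case: Hv Hw => [->|//] [->|//].
    * case: Hw => [//|jm]; case: (dis i' x) => //; exact: (td_sub (td i') jm xw).
    * case: Hv => [//|jm]; case: (dis i x) => //; exact: (td_sub (td i) jm xv).
    * case: Hv Hw => [//|jm] [//|jm'].
      by have [-> ->] := tendrils_disjoint jm jm' xv xw.
  + move=> v w /star_E[i [[|j] [jm [[-> ->]|[-> ->]]]]] /=.
    * by have [x Ox xs] := toS i; exists x, (s i); split=> //; exact: td_in (td i).
    * by have [y Iy ty] := fromT i; exists (t i), y; split=> //; exact: td_out (td i).
    * exact: (td_up (td i)).
    * exact: (td_down (td i)).
- by right; exists (star m); split=> //; [exact: star_subdivided|left].
- by move=> v /star_leaf[i ->] /=; rewrite /cl /= (td_end (td i)).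
Qed.

(** Vertex 0 of tendril [k] models vertex [k] of the dominated ray. If all tendrils are trivial,
    this is a bare dominated ray; if none is, the remaining vertices of tendril [k] form a spoke.
    The predecessor of [m k] compensates for the successor in the spoke lengths of [star]. *)
Lemma dom_realizes : (forall k, exists x y, [/\ O k.+1 0 x, I k 0 y & dE D x y]) ->
  (forall k, exists x y, [/\ O 0 0 x, I k.+1 0 y & dE D x y]) ->
  (forall k, m k = 0) \/ (forall k, 0 < m k) ->
  realizes shaped_by_star D U.
Proof.
move=> down up.
have dom v w : dom_edge v w -> exists x y, [/\ O v.1 v.2 x, I w.1 w.2 y & dE D x y].
  case: v w => n j [n' j'] [/= -> -> [->|[->]]]; first exact: down.
  by case: n' => [//|n'] _; exact: up.
case=> [m0|mpos].
- exists (nat * nat)%type, dom_ray, (dV dom_ray), (fun v => I v.1 v.2), (fun v => O v.1 v.2), (fun v => r v.1 v.2).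
  split.
  + split=> //.
    * by move=> [i j] /= ->; apply: (td_branch (td i)).
    * by move=> x [i j] [i' j'] /= -> ->; exact: tendrils_disjoint.
  + by left; split=> //; exact: dom_rayP.
  + by move=> [i j] /= ->; rewrite -(m0 i) (td_end (td i)).
- exists (nat * nat)%type, (dom_star (fun k => (m k).-1)), (leaves (star (fun k => (m k).-1))),
    (fun v => I v.1 v.2), (fun v => O v.1 v.2), (fun v => r v.1 v.2).
  split.
  + split.
    * by move=> [i j] /=; rewrite prednK // => jm; apply: (td_branch (td i)).
    * by move=> x [i j] [i' j'] /=; rewrite !prednK //; exact: tendrils_disjoint.
    * move=> [i j] [i' j'] /= [/dom//|[/= <-]]; rewrite !prednK // => jm jm' [e|e]; rewrite e in jm jm' *.
        exact: (td_down (td i)).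
      exact: (td_up (td i)).
  + exact: dom_star_shaped.
  + by move=> v /star_leaf[i ->] /=; rewrite prednK // (td_end (td i)).
Qed.

End StarModels.

(* [inl (n, 0)] lies on the spine of the comb, [inl (n, j)] on the path to the
   tooth at [n]; a triangle at [n] consists of [inl (n, 0)] and the vertices
   [inr (n, true)] and [inr (n, false)] on its left and right. *)
Definition code := (nat * nat + nat * bool)%type.

(** * Concrete combs, plain and with triangles *)

Section Combs.
Variables (m phi : nat -> nat).
Hypothesis phi_inj : injective phi.

Definition site n := exists k, n = phi k.

Definition comb := gunion (ray_graph (fun n => inl (n, 0) : code))
  (gbigunion (fun k => path_graph (fun j => inl (phi k, j) : code) (m (phi k)))).

Definition comb_teeth : set code := range (fun k => inl (phi k, m (phi k)) : code).

Lemma combP : is_comb comb comb_teeth.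
Proof.
exists (ray_graph (fun n => inl (n, 0) : code)),
  (fun k => path_graph (fun j => inl (phi k, j) : code) (m (phi k))),
  (fun k => inl (phi k, 0)), (fun k => inl (phi k, m (phi k))); split=> //.
- by apply: ray_graphP => i j [].
- move=> k; split; first by apply: (@path_graphP _ (fun j => inl (phi k, j) : code)) => i j _ _ [].
  apply/seteqP; split=> v /=; first by case=> -[j jm <-] [n _ [_ <-]].
  by move=> ->; split; [exists 0|exists (phi k)].
- move=> k l kl; apply/seteqP; split=> // v /= [[j _ <-] [j' _ [/phi_inj e _]]].
  by case: kl.
Qed.

Lemma comb_V v : gV comb v <-> exists n j, v = inl (n, j) /\ (j = 0 \/ site n /\ j <= m n).
Proof.
split=> [[[n _ <-]|[k _ [j jm <-]]]|[n [j [-> [->|[[k ->] jm]]]]]].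
- by exists n, 0; split=> //; left.
- by exists (phi k), j; split=> //; right; split=> //; exists k.
- by left; exists n.
- by right; exists k => //; exists j.
Qed.

Definition comb_step (u v : code) := (exists n, u = inl (n, 0) /\ v = inl (n.+1, 0)) \/
  (exists n j, [/\ site n, j < m n, u = inl (n, j) & v = inl (n, j.+1)]).

Lemma comb_E u v : gE comb u v <-> comb_step u v \/ comb_step v u.
Proof.
split=> [[[_ [n [[-> ->]|[-> ->]]]]|[k [_ [j jm [[-> ->]|[-> ->]]]]]]|].
- by left; left; exists n.
- by right; left; exists n.
- by left; right; exists (phi k), j; split=> //; exists k.
- by right; right; exists (phi k), j; split=> //; exists k.
case=> -[[n [-> ->]]|[n [j [[k ->] jm -> ->]]]].
- left; split; first by case=> /esym; lia.
  by exists n; left.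
- right; exists k; split; first by case; lia.
  by exists j => //; left.
- left; split; first by case; lia.
  by exists n; right.
- right; exists k; split; first by case; lia.
  by exists j => //; right.
Qed.

Let siteb n := `[<site n>].

Definition comb_nbrs n j : seq code :=
  if j is j'.+1 then inl (n, j') :: (if j < m n then [:: inl (n, j.+1)] else [::])
  else (if n is n'.+1 then [:: inl (n', 0)] else [::]) ++ inl (n.+1, 0) ::
       (if siteb n && (0 < m n) then [:: inl (n, 1)] else [::]).

Lemma comb_nbrsP n j u : gV comb (inl (n, j)) -> gE comb (inl (n, j)) u <-> u \in comb_nbrs n j.
Proof.
move=> /comb_V[n' [j' [[<- <-] jV]]] {n' j'}; rewrite comb_E; split.
  case=> -[[n' [e1 e2]]|[n' [j' [Sn jm e1 e2]]]].
  - by case: e1 => ? ?; subst; rewrite /= mem_cat mem_head orbT.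
  - case: e1 => ? ?; subst; case: j' jm {jV} => [|j'] jm /=; last by rewrite jm in_cons mem_head orbT.
    by rewrite mem_cat in_cons /siteb asboolT // jm mem_head !orbT.
  - by case: e2 => ? ?; subst; rewrite /= mem_head.
  - by case: e2 => ? ?; subst; rewrite /= mem_head.
case: j jV => [|j] jV.
  rewrite /= mem_cat in_cons => /or3P[].
  - by case: n {jV} => [//|n]; rewrite inE => /eqP->; right; left; exists n.
  - by move=> /eqP->; left; left; exists n.
  - by case: ifP => // /andP[/asboolP Sn m0]; rewrite inE => /eqP->; left; right; exists n, 0.
case: jV => [//|[Sn jm]].
rewrite /= in_cons => /orP[/eqP->|]; first by right; right; exists n, j.
by case: ifP => // jm'; rewrite inE => /eqP->; left; right; exists n, j.+1.
Qed.

Lemma comb_nbrs_uniq n j : uniq (comb_nbrs n j).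
Proof.
have ne (a b : nat * nat) : a <> b -> (inl a : code) \notin [:: inl b].
  by move=> ab; rewrite inE; apply/eqP => -[].
case: j => [|j] /=; last by case: ifP => //= _; rewrite ne // => -[]; lia.
have ne' (a b c : nat * nat) : a <> b -> a <> c -> (inl a : code) \notin [:: inl b; inl c].
  by move=> ab ac; rewrite in_cons negb_or ne // andbT; apply/eqP => -[].
case: n => [|n] /=; case: ifP => //= _; rewrite ?ne' ?ne //; by case; lia.
Qed.

Hypothesis phi_pos : forall k, 0 < phi k.

Definition comb_sites : set code := [set v | exists2 n, site n & v = inl (n, 0)].

Lemma comb_degree n j d : gV comb (inl (n, j)) ->
  has_degree comb (inl (n, j)) d <-> d = size (comb_nbrs n j).
Proof. by move=> nV; apply: degree_seq (comb_nbrs_uniq n j) _ => u; exact: comb_nbrsP. Qed.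

(** As sites are positive, the spine vertex at a site has two neighbours on the spine. With a
    nontrivial tooth path it has degree 3, and otherwise it is itself a tooth, of degree 2. All
    other vertices have degree at most 2, and a tooth off the spine has degree 1. *)
Lemma comb_junctions : junctions comb comb_teeth = comb_sites.
Proof.
apply/seteqP; split=> v /=.
  case=> Cv; have /comb_V[n [j [ev jV]]] := Cv; subst v; rewrite !comb_degree //.
  case: j Cv jV => [|j] Cv jV.
    case: (pselect (site n)) => [Sn|nS]; first by move=> _; exists n.
    rewrite /= size_cat /= /siteb asboolF //=; case=> [|[[k _ [e _]]]]; last by case: nS; exists k.
    by case: (n).
  case: jV => [//|[Sn jm]] /=; case: ifP => /= jm' [//|[[k _ [e1 e2]]]] // _.
  by rewrite e1 in e2; rewrite e2 ltnn in jm'.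
case=> n Sn ->; have Cv : gV comb (inl (n, 0)) by apply/comb_V; exists n, 0; split=> //; left.
split=> //; rewrite !comb_degree //=; case: Sn => k e.
have npos : 0 < n by rewrite e.
rewrite size_cat /= /siteb asboolT /=; last by exists k.
case: n npos e {Cv} => // n _ e /=; case: (posnP (m n.+1)) => [m0|mp]; last by left.
by right; split=> //; exists k => //; rewrite -e m0.
Qed.

Section Doubled.
Variables (V : eqType) (D : digraph V) (U : set V).
Variables (G : nat -> set V) (s t u : nat -> V).
Variables (I O : nat -> nat -> set V) (r : nat -> nat -> V).
Hypothesis td : forall i, tendril D (G i) (s i) (t i) (u i) (m i) (I i) (O i) (r i).
Hypothesis Gdis : forall i j x, G i x -> G j x -> i = j.
Hypothesis uU : forall k, U (u (phi k)).

Lemma comb_realizes :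
  (forall n, exists x y, [/\ O n 0 x, I n.+1 0 y & dE D x y]) ->
  (forall n, exists x y, [/\ O n.+1 0 x, I n 0 y & dE D x y]) ->
  realizes shaped_by_comb D U.
Proof.
move=> fwd bwd.
pose f (T : Type) (F : nat -> nat -> T) (v : code) := if v is inl w then F w.1 w.2 else F 0 0.
exists code, (doubling comb), comb_teeth, (f _ I), (f _ O), (f _ r); split.
- split.
  + move=> v /comb_V[n [j [-> jV]]]; apply: (td_branch (td n)); by case: jV => [->|[]].
  + move=> x v w /comb_V[n [j [-> jV]]] /comb_V[n' [j' [-> jV']]] /= xv xw; congr inl.
    have jm : j <= m n by case: jV => [->|[]].
    have jm' : j' <= m n' by case: jV' => [->|[]].
    have nn' : n = n' by apply: Gdis (td_sub (td n) jm xv) (td_sub (td n') jm' xw).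
    by subst n'; congr pair; exact: (td_disjoint (td n) jm jm' xv xw).
  + move=> v w /comb_E[][[n [-> ->]]|[n [j [_ jm -> ->]]]] /=; [exact: fwd| |exact: bwd|].
      exact: (td_up (td n)).
    exact: (td_down (td n)).
- by exists comb; split; [exact: combP|left].
- by move=> _ [k _ <-] /=; rewrite (td_end (td _)).
Qed.

End Doubled.

(** The orientation follows an ear that leads forwards: from the left vertex into the tendril, from
    there to the right vertex, and back to the left along the ladder. *)
Definition triangle_edge n (u v : code) := [\/ u = inr (n, true) /\ v = inl (n, 0),
  u = inl (n, 0) /\ v = inr (n, false) | u = inr (n, false) /\ v = inr (n, true)].

Program Definition triangle n : digraph code :=
  @Digraph code [set inr (n, true); inl (n, 0); inr (n, false)] (triangle_edge n) _.
Next Obligation.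
by move=> n u v [[-> ->]|[-> ->]|[-> ->]]; split=> /=; [left; left|left; right|left; right|right|right|left; left].
Qed.

Lemma triangleP n : directed_triangle (triangle n).
Proof. by exists (inr (n, true)), (inl (n, 0)), (inr (n, false)); split. Qed.

Definition code_node (v : code) := match v with inl w => w.1 | inr w => w.1 end.

(** A neighbour on the tooth path has the same position as the site itself, so comparing positions
    separates left, right and tooth. *)
Definition comb_port (x y : code) : code :=
  if x is inl (n, 0) then
    if siteb n then
      if code_node y < n then inr (n, true) else
      if n < code_node y then inr (n, false) else x
    else x
  else x.

Lemma triangle_node n v : dV (triangle n) v -> code_node v = n.
Proof. by case=> [[->|->]|->]. Qed.

Let K (v : code) := triangle (code_node v).

Lemma comb_portP x y : gE comb x y ->
  (comb_sites x -> dV (K x) (comb_port x y)) /\ (~ comb_sites x -> comb_port x y = x).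
Proof.
move=> xy; split=> [[n Sn ->]|nS]; rewrite /comb_port.
  rewrite /siteb asboolT // /K /=; case: ifP => _; first by left; left.
  by case: ifP => _; [right|left; right].
case: x xy nS => // -[n [|j]] // xy nS; rewrite /siteb asboolF // => Sn.
by apply: nS; exists n.
Qed.

Program Definition triangle_comb : digraph code :=
  @Digraph code ((gV comb `\` comb_sites) `|` \bigcup_(j in comb_sites) dV (K j))
    (fun u v => (exists2 j, comb_sites j & dE (K j) u v) \/
      (exists x y, [/\ gE comb x y, u = comb_port x y & v = comb_port y x])) _.
Next Obligation.
move=> u v [[j Sj e]|[x [y [xy -> ->]]]].
  by have [? ?] := dE_V e; split; right; exists j.
have gen x' y' : gE comb x' y' -> ((gV comb `\` comb_sites) `|` \bigcup_(j in comb_sites) dV (K j)) (comb_port x' y').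
  move=> xy'; have [p1 p2] := comb_portP xy'.
  case: (pselect (comb_sites x')) => [Sx|nS]; first by right; exists x' => //; exact: p1.
  by left; rewrite p2 //; split=> //; exact: gE_V xy'.
by split; apply: gen => //; exact: gE_sym.
Qed.

(** No edge that avoids the spine vertex at [n] changes whether the position is below, equal to or
    above [n]. This tells apart the components left after deleting a junction. *)
Lemma comb_side n x y : dreach (ddelete (doubling comb) (inl (n, 0))) x y ->
  (code_node x < n) = (code_node y < n) /\ (n < code_node x) = (n < code_node y).
Proof.
case=> l [p [[_ pE _] <- <-]]; elim: l pE => // l IHl pE.
have [|-> ->] := IHl; first by move=> i il; apply: pE; exact: ltnW.
have [/comb_E e n1 n2] := pE l (leqnn _).
have aux n' : (inl (n', 0) : code) <> inl (n, 0) -> (inl (n'.+1, 0) : code) <> inl (n, 0) ->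
    (n' < n) = (n'.+1 < n) /\ (n < n') = (n < n'.+1).
  move=> ne1 ne2; have a : n' <> n by move=> ee; rewrite ee in ne1.
  have b : n'.+1 <> n by move=> ee; rewrite ee in ne2.
  by clear -a b; lia.
case: e n1 n2 => -[[n' [-> ->]]|[n' [j [_ _ -> ->]]]] //= n1 n2; first exact: aux.
by have [-> ->] := aux n' n2 n1.
Qed.

Lemma triangle_comb_shaped : shaped_by_comb triangle_comb comb_teeth.
Proof.
have jV j : junctions comb comb_teeth j -> exists2 n, site n & j = inl (n, 0).
  by rewrite comb_junctions.
exists comb; split; first exact: combP.
right; exists K, comb_port; rewrite comb_junctions; split.
- split=> //.
  + by move=> j [n _ ->]; apply/comb_V; exists n, 0; split=> //; left.
  + split.
      move=> _ _ [n _ ->] [n' _ ->] nn'; apply/seteqP; split=> // v.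
      by case=> /triangle_node e1 /triangle_node e2; case: nn'; rewrite -[n]/(code_node (inl (n, 0))) -e1 e2.
    move=> _ [n Sn ->]; apply/seteqP; split=> // v /= [Kv [/comb_V[n' [j [ev _]]] nS]].
    by subst v; case: Kv => [[//|e]|//]; apply: nS; exists n.
  + by move=> x y; exact: comb_portP.
- by move=> j _; exact: triangleP.
- move=> _ x y [n Sn ->] nx ny.
  have Cn : gV comb (inl (n, 0)) by exact: gE_V nx.
  have Cx : gV comb x by exact: gE_V (gE_sym nx).
  have xn : x <> inl (n, 0) by move=> e; move: nx; rewrite e; exact: gE_irr.
  split=> [e|[xy _]]; last first.
    have [e1 e2] := comb_side xy.
    by rewrite /comb_port e1 e2.
  (* The neighbours of a site lie on pairwise different sides, so the port determines the
     neighbour. *)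
  have xy : x = y.
    have npos : 0 < n by case: Sn => k ->.
    have cases z : nbr comb (inl (n, 0)) z -> [\/ z = inl (n.-1, 0) /\ comb_port (inl (n, 0)) z = inr (n, true),
        z = inl (n.+1, 0) /\ comb_port (inl (n, 0)) z = inr (n, false) |
        z = inl (n, 1) /\ comb_port (inl (n, 0)) z = inl (n, 0)].
      move=> /(comb_nbrsP z Cn) /=; rewrite mem_cat in_cons => /or3P[| |].
      - case: (n) npos Sn => // n' _ Sn'; rewrite inE => /eqP->; apply: Or31.
        by rewrite /comb_port /siteb asboolT //= ltnSn.
      - move=> /eqP->; apply: Or32.
        by rewrite /comb_port /siteb asboolT //= ltnNge leqnSn ltnSn.
      - case: ifP => // _; rewrite inE => /eqP->; apply: Or33.
        by rewrite /comb_port /siteb asboolT //= ltnn.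
    by case: (cases x nx) e => -[-> ->]; case: (cases y ny) => -[-> ->].
  have xx : dreach (ddelete (doubling comb) (inl (n, 0))) x x.
    exists 0, (fun _ => x); split=> //; split=> [i _|i|i j]; [by split|by []|].
    by rewrite !leqn0 => /eqP-> /eqP->.
  by rewrite -xy; split.
(* A degree other than 3 means that no tooth path leaves the spine here; both neighbours are on the
   spine and use the outer two triangle vertices. *)
- move=> j [n Sn ->] deg; split; first by left; right.
  move=> x nx; rewrite /comb_port /siteb asboolT //.
  have Cn : gV comb (inl (n, 0)) by exact: gE_V nx.
  have npos : 0 < n by case: Sn => k ->.
  move: deg nx; rewrite comb_degree // => deg /(comb_nbrsP x Cn); move: deg.
  rewrite /= !size_cat /= mem_cat in_cons.
  case: (n) npos => // n' _ /=; case: ifP => [//|_] _.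
  by rewrite !inE => /or3P[/eqP->|/eqP->|//] /=; rewrite ltnSn // ltnNge leqnSn.
Qed.
End Combs.

(** * Chains of triangles and combs with triangles, assembled from tendrils *)

Section TriangleModels.
Variables (V : eqType) (D : digraph V) (U : set V) (m phi : nat -> nat).
Variables (G : nat -> set V) (s t u : nat -> V).
Variables (I O : nat -> nat -> set V) (r : nat -> nat -> V).
Variables (I2 O2 : nat -> bool -> set V) (r2 : nat -> bool -> V).

Definition code_case (T : Type) (f : nat -> nat -> T) (g : nat -> bool -> T) (v : code) : T :=
  match v with inl w => f w.1 w.2 | inr w => g w.1 w.2 end.

Hypothesis td : forall i, tendril D (G i) (s i) (t i) (u i) (m i) (I i) (O i) (r i).
Hypothesis Gdis : forall i j x, G i x -> G j x -> i = j.

(** Different positions are separated by the disjoint regions [G n], so only branches at one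
    position have to be compared. Both assemblies below share this. *)
Lemma code_disjoint (P : set code) :
  (forall n j, P (inl (n, j)) -> j <= m n) ->
  (forall n b x, P (inr (n, b)) -> (I2 n b `|` O2 n b) x -> G n x) ->
  (forall n b x, P (inr (n, b)) -> (I2 n b `|` O2 n b) x -> forall j, j <= m n -> ~ (I n j `|` O n j) x) ->
  (forall n b b' x, P (inr (n, b)) -> P (inr (n, b')) ->
     (I2 n b `|` O2 n b) x -> (I2 n b' `|` O2 n b') x -> b = b') ->
  forall x v w, P v -> P w ->
    (code_case I I2 v `|` code_case O O2 v) x -> (code_case I I2 w `|` code_case O O2 w) x -> v = w.
Proof.
move=> Pm PG Pn Pb x [[n j]|[n b]] [[n' j']|[n' b']] /= Pv Pw xv xw.
- have jm := Pm _ _ Pv; have jm' := Pm _ _ Pw.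
  have e : n = n' by apply: Gdis (td_sub (td n) jm xv) (td_sub (td n') jm' xw).
  by subst n'; rewrite (td_disjoint (td n) jm jm' xv xw).
- have jm := Pm _ _ Pv.
  have e : n = n' by apply: Gdis (td_sub (td n) jm xv) (PG _ _ _ Pw xw).
  by subst n'; case: (Pn _ _ _ Pw xw _ jm).
- have jm := Pm _ _ Pw.
  have e : n = n' by apply: Gdis (PG _ _ _ Pv xv) (td_sub (td n') jm xw).
  by subst n'; case: (Pn _ _ _ Pv xv _ jm).
- have e : n = n' by apply: Gdis (PG _ _ _ Pv xv) (PG _ _ _ Pw xw).
  by subst n'; rewrite (Pb _ _ _ _ Pv Pw xv xw).
Qed.

Variable tri : set nat.
Hypothesis br2 : forall k b, tri k -> branch D (I2 k b) (O2 k b) (r2 k b).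
Hypothesis G2 : forall k b x, tri k -> (I2 k b `|` O2 k b) x -> G k x.
Hypothesis dis2 : forall k b x j, tri k -> (I2 k b `|` O2 k b) x -> j <= m k -> ~ (I k j `|` O k j) x.
Hypothesis dis22 : forall k x, tri k -> (I2 k true `|` O2 k true) x -> ~ (I2 k false `|` O2 k false) x.

Let dis2b k b b' x : tri k -> (I2 k b `|` O2 k b) x -> (I2 k b' `|` O2 k b') x -> b = b'.
Proof. by case: b b' => -[] // Tk h1 h2; [case: (dis22 Tk h1)|case: (dis22 Tk h2)]. Qed.

Lemma chain_realizes : (forall k, tri k) -> (forall k, U (u k)) ->
  (forall k, exists x y, [/\ O2 k true x, I k 0 y & dE D x y]) ->
  (forall k, exists x y, [/\ O k 0 x, I2 k false y & dE D x y]) ->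
  (forall k, exists x y, [/\ O2 k false x, I2 k true y & dE D x y]) ->
  (forall k, exists x y, [/\ O2 k.+1 true x, I2 k true y & dE D x y]) ->
  (forall k, exists x y, [/\ O2 k false x, I2 k.+1 false y & dE D x y]) ->
  realizes chain_of_triangles D U.
Proof.
move=> triT uU ab bc ca aa cc.
pose a i : code := inr (i, true); pose b i : code := inl (i, 0).
pose c i : code := inr (i, false); pose y i : code := inl (i, m i).
pose base : set code := range a `|` range b `|` range c.
pose P i := path_graph (fun j => inl (i, j) : code) (m i).
pose E (v w : code) := exists i, [\/ v = a i /\ w = b i, v = b i /\ w = c i, v = c i /\ w = a i |
            (v = a i.+1 /\ w = a i) \/ (v = c i /\ w = c i.+1)].
have EV v w : E v w -> base v /\ base w.
  have ba i : base (a i) by left; left; exists i.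
  have bb i : base (b i) by left; right; exists i.
  have bc' i : base (c i) by right; exists i.
  by case=> i [[-> ->]|[-> ->]|[-> ->]|[[-> ->]|[-> ->]]].
pose B : digraph code := Digraph EV.
exists code, (dunion B (dbigunion (fun i => doubling (P i)))), (range y),
  (code_case I I2), (code_case O O2), (code_case r r2).
have HV v : dV (dunion B (dbigunion (fun i => doubling (P i)))) v ->
    match v with inl (n, j) => j <= m n : Prop | inr (n, _) => tri n end.
  case=> [[[[i _ <-]|[i _ <-]]|[i _ <-]]|[i _ [j jm <-]]] //=; exact: triT.
split.
- split.
  + by move=> [[n j]|[n b']] /HV jm /=; [exact: (td_branch (td n))|exact: br2].
  + apply: code_disjoint.
    * by move=> n j /HV.
    * by move=> n b' x /HV; exact: G2.
    * by move=> n b' x /HV Tn xb j jm; exact: dis2 xb jm.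
    * by move=> n b1 b2 x /HV Tn _; exact: dis2b.
  + move=> v w [[i [[-> ->]|[-> ->]|[-> ->]|[[-> ->]|[-> ->]]]]|[i [_ [j jm [[-> ->]|[-> ->]]]]]] /=.
    * exact: ab.
    * exact: bc.
    * exact: ca.
    * exact: aa.
    * exact: cc.
    * exact: (td_up (td i)).
    * exact: (td_down (td i)).
- exists a, b, c, y, B, P; split=> //.
  + by split=> [i j []|i j []|i j []|i j] //; split.
  + split=> [i|i j ij].
      split; first by apply: (@path_graphP _ (fun j => inl (i, j) : code)) => j j' _ _ [].
      apply/seteqP; split=> v /=; last by move=> ->; split; [exists 0|left; right; exists i].
      by case=> -[j _ <-] [[[n _ //]|[n _ [<- <-]]]|[n _ //]].
    by apply/seteqP; split=> // v /= [[k _ <-] [k' _ [e _]]]; case: ij.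
- by move=> _ [i _ <-] /=; rewrite (td_end (td i)).
Qed.

Hypothesis phi_inj : injective phi.
Hypothesis phi_pos : forall k, 0 < phi k.

Let siteb n := `[<site phi n>].
(** What position [n] shows to its left ([b = true]) or right ([b = false]) neighbour: a vertex of
    the triangle at a site, the spine vertex elsewhere. *)
Let side (T : Type) (f : nat -> nat -> T) (g : nat -> bool -> T) b n := if siteb n then g n b else f n 0.

Lemma triangle_comb_realizes : (forall k, tri (phi k)) -> (forall k, U (u (phi k))) ->
  (forall k, exists x y, [/\ O2 (phi k) true x, I (phi k) 0 y & dE D x y]) ->
  (forall k, exists x y, [/\ O (phi k) 0 x, I2 (phi k) false y & dE D x y]) ->
  (forall k, exists x y, [/\ O2 (phi k) false x, I2 (phi k) true y & dE D x y]) ->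
  (forall n, exists x y, [/\ side O O2 false n x, side I I2 true n.+1 y & dE D x y]) ->
  (forall n, exists x y, [/\ side O O2 true n.+1 x, side I I2 false n y & dE D x y]) ->
  realizes shaped_by_comb D U.
Proof.
move=> triS uU lq qr rl fwd bwd.
exists code, (triangle_comb m phi), (comb_teeth m phi),
  (code_case I I2), (code_case O O2), (code_case r r2).
have HV v : dV (triangle_comb m phi) v ->
    match v with inl (n, j) => j <= m n : Prop | inr (n, _) => tri n end.
  by case=> [[/comb_V[n [j [-> [->|[]]]]]]|[_ [n [k ->] ->] [[->|->]|->]]] //=.
split.
- split.
  + by move=> [[n j]|[n b']] /HV jm /=; [exact: (td_branch (td n))|exact: br2].
  + apply: code_disjoint.
    * by move=> n j /HV.
    * by move=> n b' x /HV; exact: G2.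
    * by move=> n b' x /HV Tn xb j jm; exact: dis2 xb jm.
    * by move=> n b1 b2 x /HV Tn _; exact: dis2b.
  + move=> v w [[_ [_ [k ->] ->] [[-> ->]|[-> ->]|[-> ->]]]|[x [y [/comb_E xy -> ->]]]] /=.
    * exact: lq.
    * exact: qr.
    * exact: rl.
    * have right n : comb_port phi (inl (n, 0)) (inl (n.+1, 0)) = if siteb n then inr (n, false) else inl (n, 0).
        by rewrite /comb_port /= ltnNge leqnSn ltnSn.
      have left n : comb_port phi (inl (n.+1, 0)) (inl (n, 0)) = if siteb n.+1 then inr (n.+1, true) else inl (n.+1, 0).
        by rewrite /comb_port /= ltnSn.
      have stay n j : comb_port phi (inl (n, j)) (inl (n, j.+1)) = inl (n, j).
        by case: j => //=; rewrite ltnn if_same.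
      case: xy => -[[n [-> ->]]|[n [j [_ jm -> ->]]]]; rewrite ?right ?left ?stay.
      - have := fwd n; rewrite /side; case: ifP; case: ifP => _ _ //=.
      - exact: (td_up (td n)).
      - have := bwd n; rewrite /side; case: ifP; case: ifP => _ _ //=.
      - exact: (td_down (td n)).
- exact: triangle_comb_shaped.
- by move=> _ [k _ <-] /=; rewrite (td_end (td _)).
Qed.

End TriangleModels.

Lemma ray_reach (V : Type) (D : digraph V) (R : nat -> V) (A : set V) i j :
  (forall l, dE D (R l) (R l.+1)) -> i <= j -> (forall l, i <= l <= j -> A (R l)) -> reach D A (R i) (R j).
Proof.
move=> RE; elim: j => [|j IHj].
  by rewrite leqn0 => /eqP-> A0; apply: reach_refl; [exact: A0|have [] := dE_V (RE 0)].
rewrite leq_eqVlt => /orP[/eqP-> A0|ij Al].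
  by apply: reach_refl; [apply: A0; rewrite leqnn|have [] := dE_V (RE j.+1)].
apply: (reach_step _ _ (RE j)); last by apply: Al; rewrite leqnn ltnW.
apply: IHj => // l /andP[il lj]; apply: Al; rewrite il; exact: leqW.
Qed.

Lemma ray_bound (V : eqType) (R : nat -> V) (s : seq V) : injective R ->
  exists n, forall i, R i \in s -> i <= n.
Proof.
move=> inj; elim: s => [|x s [n nP]]; first by exists 0.
case: (pselect (exists j, R j = x)) => [[j e]|no].
  exists (maxn j n) => i; rewrite in_cons -e => /orP[/eqP/inj->|/nP]; rewrite leq_max ?leqnn // => ->.
  by rewrite orbT.
by exists n => i; rewrite in_cons => /orP[/eqP e|/nP//]; case: no; exists i.
Qed.

(** * Enlarging the first branch of a tendril *)

Section Extension.
Variables (V : eqType) (D : digraph V).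

Definition upd0 T (x : T) (f : nat -> T) j := if j is 0 then x else f j.

(** Vertex 0 can absorb pieces of a ray or of the ladder while the rest stays as it is: the new sets
    meet [G] only in the old branch 0, hence none of the higher branches. *)
Lemma tendril_extend (G : set V) s t u k I O r (I' O' : set V) s' t' :
  tendril D G s t u k I O r -> I 0 `<=` I' -> O 0 `<=` O' ->
  (forall x, I' x -> exists2 y, I 0 y & reach D I' x y) ->
  (forall x, O' x -> exists2 y, O 0 y & reach D O' y x) ->
  (forall x, (I' `|` O') x -> G x -> (I 0 `|` O 0) x) ->
  (forall x, I' x -> O' x -> I 0 x /\ O 0 x) -> I' s' -> O' t' ->
  tendril D (G `|` (I' `|` O')) s' t' u k (upd0 I' I) (upd0 O' O) r.
Proof.
move=> td II OO In On dis meet Is Ot.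
have [b su di i o e up dn] := td.
split=> //.
- case=> [_|j]; last exact: b.
  exact: branch_extend (b 0 (leq0n _)) II OO In On meet.
- by case=> [|j] x jk /= xj; [right|left; exact: su xj].
- move=> x [|j] [|j'] //= jk jk' xj xj'.
  + by apply: (di x 0 j'.+1 jk jk' _ xj'); apply: dis xj _; exact: su _ _ jk' xj'.
  + by apply: (di x j.+1 0 jk jk' xj); apply: dis xj' _; exact: su _ _ jk xj.
  + exact: di xj xj'.
- by case=> [|j] /up[x [y [Ox Iy xy]]]; exists x, y; split=> //; exact: OO.
- by case=> [|j] /dn[x [y [Ox Iy xy]]]; exists x, y; split=> //; exact: II.
Qed.

Record tendril_data := TendrilData { tdS : V; tdT : V; tdK : nat;
  tdI : nat -> set V; tdO : nat -> set V; tdR : nat -> V }.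

Definition tendril_of G u d := tendril D G (tdS d) (tdT d) u (tdK d) (tdI d) (tdO d) (tdR d).

Lemma tendril_data_exists G s t u : reach D G s u -> reach D G u t ->
  exists d, [/\ tendril_of G u d, tdS d = s & tdT d = t].
Proof.
move=> su ut; have [k [I [O [r td]]]] := tendril_exists su ut.
by exists (TendrilData s t k I O r).
Qed.

End Extension.

(** * Two cores joined by a hub *)

Section Setups.
Variable V : eqType.
Implicit Types (D : digraph V) (U : set V) (R S : nat -> V) (P Q : V -> seq V) (a : seq V).

(* The vertices of [a] form a path from [S 0] to [R 0]. *)
Record hub D R S a : Prop := Hub {
  hub_path : forall x, x \in a -> reach D [set` a] (S 0) x /\ reach D [set` a] x (R 0);
  hub_R0 : R 0 \in a;
  hub_S0 : S 0 \in a;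
  hub_R : forall i, R i \in a -> R i = R 0;
  hub_S : forall i, S i \in a -> S i = S 0;
  hub_RS : forall i j, R i = S j -> R i = R 0 /\ S j = S 0 }.

Lemma hub_rev D R S a : hub D R S a -> hub (rev_digraph D) S R a.
Proof.
case=> p r0 s0 r s rs; split=> //.
- by move=> x /p[h1 h2]; split; exact: reach_rev.
- by move=> i j e; have [] := rs j i (esym e).
Qed.

(** [Q u] is a path of the reversed digraph from [ts u] to [u]; read backwards, it leads from [u] to
    [S] in [D]. *)
Record setup D U R st P S ts Q a : Prop := Setup {
  setup_inf : infinite_set U;
  setup_R : fan D U R st P;
  setup_S : fan (rev_digraph D) U S ts Q;
  setup_hub : hub D R S a;
  setup_P : forall u x, U u -> x \in P u -> x \notin a;
  setup_Q : forall u x, U u -> x \in Q u -> x \notin a;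
  setup_U : forall u, U u -> u \notin a }.

Lemma setup_rev D U R st P S ts Q a : setup D U R st P S ts Q a ->
  setup (rev_digraph D) U S ts Q R st P a.
Proof.
case=> inf fr fs h p q ua; split=> //; last exact: hub_rev.
by rewrite rev_digraphK.
Qed.

Lemma fan_sub D U U' R st P : U' `<=` U -> fan D U R st P -> fan D U' R st P.
Proof.
move=> UU [c dv s p av e t]; split=> //.
- by move=> u /UU; exact: s.
- by move=> u /UU; exact: p.
- by move=> u x i /UU; exact: av.
- by move=> v; apply: sub_finite_set (e v) => u [/UU].
- by move=> l; apply: sub_finite_set (t l) => u [/UU].
Qed.

Lemma setup_sub D U U' R st P S ts Q a : U' `<=` U -> infinite_set U' ->
  setup D U R st P S ts Q a -> setup D U' R st P S ts Q a.
Proof.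
move=> UU inf [_ fr fs h p q ua]; split=> //; try exact: fan_sub UU _.
- by move=> u x /UU; exact: p.
- by move=> u x /UU; exact: q.
- by move=> u /UU; exact: ua.
Qed.

(** On a ray the vertex [v] has only one index, and [fan_tail] leaves few starts up to it. For a
    constant core this fails, as all paths start in the same vertex. *)
Lemma fan_start_escape D U R st P v : ray_along D R -> fan D U R st P ->
  finite_set [set u | U u /\ st u = v].
Proof.
move=> [inj _] f; case: (pselect (exists i, v = R i)) => [[i ->]|no].
  apply: sub_finite_set (fan_tail f i.+1) => u [Uu e]; split=> // -[j ij].
  by rewrite e => /inj e'; rewrite e' ltnn in ij.
apply: sub_finite_set (finite_set0 V) => u [Uu e]; case: no.
by have [i e'] := fan_start f Uu; exists i; rewrite -e.
Qed.

Lemma fan_last D U R st P u : fan D U R st P -> U u -> u \in P u \/ exists i, u = R i.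
Proof.
move=> f Uu; have [_ l _] := fan_path f Uu; case e: (P u) l => [|x p] /= l.
  by right; have [i e'] := fan_start f Uu; exists i; rewrite -e' l.
by left; rewrite -{1}l mem_last.
Qed.

Lemma fan_core_reach D U R st P i : fan D U R st P -> reach D (range R) (R 0) (R i).
Proof.
move=> f; case: (fan_core f) => [c|[_ RE]].
  by rewrite (c i); apply: reach_refl; [exists 0|exact: fan_dV f 0].
by apply: ray_reach => // l _; exists l.
Qed.

Section StarCase.
Variables (D : digraph V) (U : set V) (R S : nat -> V) (st ts : V -> V) (P Q : V -> seq V) (a : seq V).
Hypothesis su : setup D U R st P S ts Q a.
Hypothesis PS : forall u x i, U u -> x \in P u -> x <> S i.
Hypothesis QR : forall u x i, U u -> x \in Q u -> x <> R i.

(** The centre of the star is a single branch with root [R 0]: [S] and the hub lead into it, and [R]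
    leads out of it. By the two hypotheses the paths touch this branch only where they start. *)
Lemma star_case : realizes shaped_by_star D U.
Proof.
have fR := setup_R su; have fS := setup_S su; have h := setup_hub su.
pose supp u := P u ++ Q u.
have [|f [fU fdis _]] := @select V U supp (fun _ => [::]) (setup_inf su).
  move=> v; apply: (@sub_finite_set _ _ ([set u | U u /\ v \in P u] `|` [set u | U u /\ v \in Q u])).
    by move=> u [Uu]; rewrite mem_cat => /orP[]; [left|right].
  by rewrite finite_setU; split; [exact: fan_escape fR v|exact: fan_escape fS v].
(* If [u] is on [R], it is not on [Q u], so [Q u] is empty and [u] is also on [S]. The cores meet
   only in [R 0], which belongs to the hub, and the hub contains no member of [U]. *)
have uR u i : U u -> u <> R i.
  move=> Uu e; case: (fan_last fS Uu) => [uQ|[j e']]; first exact: (QR Uu uQ e).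
  have [e1 _] := hub_RS h (etrans (esym e) e').
  by have := setup_U su Uu; rewrite e e1 (hub_R0 h).
have uS u i : U u -> u <> S i.
  move=> Uu e; case: (fan_last fR Uu) => [uP|[j e']]; first exact: (PS Uu uP e).
  have [_ e1] := hub_RS h (etrans (esym e') e).
  by have := setup_U su Uu; rewrite e e1 (hub_S0 h).
have dE u : exists d, U u -> [/\ tendril_of D [set` supp u] u d,
    dE D (st u) (tdS d) & dE D (tdT d) (ts u)].
  case: (pselect (U u)) => [Uu|nU]; last by exists (TendrilData u u 0 (fun _ => set0) (fun _ => set0) (fun _ => u)).
  have [pP lP _] := fan_path fR Uu; have [pQ lQ _] := fan_path fS Uu.
  have [i stR] := fan_start fR Uu; have [j tsS] := fan_start fS Uu.
  case eP: (P u) pP lP => [|s p] /=; first by move=> _ e; case: (uR u i Uu); rewrite -e.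
  move=> /andP[/asboolP es pp] lp.
  case eQ: (Q u) pQ lQ => [|t q] /=; first by move=> _ e; case: (uS u j Uu); rewrite -e.
  move=> /andP[/asboolP et qq] lq.
  have [||d [tdd ds dt]] := @tendril_data_exists V D [set` supp u] s t u.
  - rewrite -[X in reach _ _ _ X]lp; apply: path_reach => //; first by have [] := dE_V es.
    by move=> z zp; rewrite /= /supp mem_cat eP zp.
  - apply/reach_revE; rewrite -[X in reach _ _ _ X]lq; apply: path_reach => //; first by have [] := dE_V et.
    by move=> z zp; rewrite /= /supp mem_cat eQ zp orbT.
  by exists d => _; split=> //; rewrite ?ds ?dt.
have [d dP] := exists_choice dE.
pose Ic := range S `|` [set` a].
have toR0 x : Ic x -> reach D Ic x (R 0).
  have [_ s0R] := hub_path h (hub_S0 h).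
  have aR y z : reach D [set` a] y z -> reach D Ic y z by apply: reach_mono; right.
  case=> [[i _ <-]|/(hub_path h)[_]]; last exact: aR.
  apply: reach_trans (aR _ _ s0R); apply/reach_revE.
  by apply: reach_mono (fan_core_reach i fS) => y; left.
have br : branch D Ic (range R) (R 0).
  split=> //.
  - by move=> _ [i _ <-]; exact: fan_core_reach fR.
  - by right; exact: hub_R0 h.
  - move=> x [[j _ <-] [i _ e]|xa [i _ e]]; first by rewrite -e; have [] := hub_RS h e.
    by rewrite -e; apply: (hub_R h); rewrite e.
apply: (@star_realizes V D U (fun k => tdK (d (f k))) (fun k => [set` supp (f k)]) (fun k => tdS (d (f k)))
  (fun k => tdT (d (f k))) f (fun k => tdI (d (f k))) (fun k => tdO (d (f k))) (fun k => tdR (d (f k)))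
  _ _ _ Ic (range R) (R 0) br).
- by move=> k; have [] := dP (f k) (fU k).
- exact: fdis.
- exact: fU.
- move=> k x /=; rewrite mem_cat => /orP[xP|xQ] [[[i _ e]|xa]|[i _ e]].
  + exact: (PS (fU k) xP (esym e)).
  + by have := setup_P su (fU k) xP; rewrite xa.
  + exact: (fan_avoid fR (fU k) xP (esym e)).
  + exact: (fan_avoid fS (fU k) xQ (esym e)).
  + by have := setup_Q su (fU k) xQ; rewrite xa.
  + exact: (QR (fU k) xQ (esym e)).
- move=> k; have [_ e _] := dP (f k) (fU k); exists (st (f k)) => //.
  by have [i ->] := fan_start fR (fU k); exists i.
- move=> k; have [_ _ e] := dP (f k) (fU k); exists (ts (f k)) => //.
  by left; have [i ->] := fan_start fS (fU k); exists i.
Qed.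

End StarCase.
End Setups.

Lemma infinite_split (T : Type) (A B : set T) : infinite_set A ->
  infinite_set (A `&` B) \/ infinite_set (A `\` B).
Proof.
move=> inf; case: (pselect (finite_set (A `&` B))) => [f1|]; last by left.
right=> f2; apply: inf; apply: (@sub_finite_set _ _ ((A `&` B) `|` (A `\` B))).
  by move=> x Ax; case: (pselect (B x)); [left|right].
by rewrite finite_setU.
Qed.

Lemma realizes_sub (shape : forall W, digraph W -> set W -> Prop) (V : Type) (D : digraph V) (U U' : set V) :
  U' `<=` U -> realizes shape D U' -> realizes shape D U.
Proof.
by move=> UU [W [H [Y [I [O [r [mo sh YU]]]]]]]; exists W, H, Y, I, O, r; split=> // y /YU/UU.
Qed.

(** * First and last visits of a path to a ray *)

Section Rays.
Variable V : eqType.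

(** If [S] were constant, its only vertex would lie on [P u] for infinitely many [u], contrary to
    [fan_escape]. *)
Lemma crossing_ray (D : digraph V) U R st P S ts Q a : setup D U R st P S ts Q a ->
  (forall u, U u -> exists2 x, x \in P u & exists i, x = S i) -> ray_along (rev_digraph D) S.
Proof.
move=> su PS; case: (fan_core (setup_S su)) => // c.
case: (setup_inf su); apply: sub_finite_set (fan_escape (setup_R su) (S 0)) => u Uu; split=> //.
by have [x xP [i e]] := PS u Uu; rewrite -(c i) -e.
Qed.

Variables (D : digraph V) (U : set V) (R S : nat -> V) (st ts : V -> V) (P Q : V -> seq V) (a : seq V).
Hypothesis su : setup D U R st P S ts Q a.

Definition hits_ray u := exists2 x, x \in P u & exists i, x = S i.

(** The first visit to [S] yields a connection from [R] to [S] with interior [X] off [S]. The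
    interior may be empty, whence the alternative for the first vertex [y]. *)
Lemma first_on_ray u : U u -> hits_ray u -> exists (X : seq V) (c : nat), [/\ {subset X <= P u}, S c \in P u,
  forall x i, x \in X -> x <> S i,
  forall x, x \in X -> reach D ([set` X] `|` [set S c]) x (S c) &
  exists2 y, dE D (st u) y & y = S c \/ y \in X].
Proof.
move=> Uu [x xP Sx]; have [pP _ _] := fan_path (setup_R su) Uu.
have [|X [y [p [e /asboolP[c yc] nX]]]] := @first_hit _ (fun x => `[<exists i, x = S i>]) (P u).
  by apply/hasP; exists x => //; exact: asboolT.
subst y; exists X, c; move: pP; rewrite e -cat_rcons cat_path => /andP[pX _].
have XS z i : z \in X -> z <> S i.
  by move=> zX zS; case/hasP: nX; exists z => //; apply: asboolT; exists i.
split=> //.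
- by move=> z zX; rewrite cat_rcons mem_cat zX.
- by rewrite cat_rcons mem_cat mem_head orbT.
- case: X pX {e nX XS} => // z X /= /andP[/asboolP ez pX] w wX.
  have [] := @path_reach_both _ D ([set` z :: X] `|` [set S c]) z (rcons X (S c)) w _ pX.
  + by have [] := dE_V ez.
  + move=> v; rewrite -rcons_cons mem_rcons in_cons => /orP[/eqP->|vX]; by [right|left].
  + by rewrite -rcons_cons mem_rcons in_cons wX orbT.
  by rewrite last_rcons.
- case: X pX {e nX XS} => [|z X] /= /andP[/asboolP ez _]; first by exists (S c) => //; left.
  by exists z => //; right; exact: mem_head.
Qed.

Lemma last_on_ray u : U u -> hits_ray u -> exists (p : seq V) (c : nat), [/\ {subset p <= P u}, S c \in P u,
  forall x i, x \in p -> x <> S i, path (darc D) (S c) p & last (S c) p = u].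
Proof.
move=> Uu [x xP Sx]; have [pP lP _] := fan_path (setup_R su) Uu.
have [|p' [y [p [e /asboolP[c yc] np]]]] := @last_hit _ (fun x => `[<exists i, x = S i>]) (P u).
  by apply/hasP; exists x => //; exact: asboolT.
subst y; exists p, c; move: pP lP; rewrite e cat_path last_cat => /andP[_ /= /andP[_ pp]] lp.
split=> //.
- by move=> z zp; rewrite mem_cat in_cons zp !orbT.
- by rewrite mem_cat mem_head orbT.
- by move=> z i zp zS; case/hasP: np; exists z => //; apply: asboolT; exists i.
Qed.

End Rays.

(** * One of the two path systems crosses the other ray: dominated rays *)

Section DominatedCase.
Variables (V : eqType) (D : digraph V).
Variables (R S : nat -> V) (st ts : V -> V) (P Q : V -> seq V) (a : seq V).

(** The tendril of [u] lives on [S N, ..., S M] and on the vertices [G] off [S]; independently, [X]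
    leads from [st u] to [S C]. In the assembly a member serves in only one of these two ways. *)
Record dom_data := DomData { dmN : nat; dmM : nat; dmC : nat; dmG : seq V; dmX : seq V;
  dmT : tendril_data V }.

Definition supp u := P u ++ ts u :: Q u.

Record dom_spec u (w : dom_data) : Prop := DomSpec {
  dm_le : dmN w <= dmM w;
  dm_N : S (dmN w) \in supp u;
  dm_M : S (dmM w) \in supp u;
  dm_C : S (dmC w) \in supp u;
  dm_G : {subset dmG w <= supp u};
  dm_X : {subset dmX w <= supp u};
  dm_S : forall x i, x \in dmG w ++ dmX w -> x <> S i;
  dm_a : forall x, x \in dmG w ++ dmX w -> x \notin a;
  dm_R : forall x i, x \in dmG w ++ dmX w -> x <> R i;
  dm_reach : forall x, x \in dmX w -> reach D ([set` dmX w] `|` [set S (dmC w)]) x (S (dmC w));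
  dm_enter : exists2 y, dE D (st u) y & y = S (dmC w) \/ y \in dmX w;
  dm_td : tendril_of D ([set S i | i in [set i | dmN w <= i <= dmM w]] `|` [set` dmG w]) u (dmT w);
  dm_tdS : tdS (dmT w) = S (dmM w);
  dm_tdT : tdT (dmT w) = S (dmN w) }.

Lemma dom_data_exists U : setup D U R st P S ts Q a ->
  (forall u, U u -> hits_ray S P u) -> (forall u x i, U u -> x \in Q u -> x <> R i) ->
  forall u, exists w, U u -> dom_spec u w.
Proof.
move=> su PS QR u; have fS := setup_S su.
have [_ SE] := crossing_ray su PS.
case: (pselect (U u)) => [Uu|nU]; last first.
  by exists (DomData 0 0 0 [::] [::] (TendrilData u u 0 (fun _ => set0) (fun _ => set0) (fun _ => u))).
have [X [c [XP cP XS Xr Xe]]] := first_on_ray su Uu (PS u Uu).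
have [p [i [pP iP pS pp lp]]] := last_on_ray su Uu (PS u Uu).
have [j tsj] := fan_start fS Uu; have [pQ lQ _] := fan_path fS Uu.
(* The path to [u] leaves [S] for the last time at [i], and the way back from [u] joins [S] at [j],
   in unknown order. As [S] is directed downwards, the tendril is entered at the larger index and
   left at the smaller one. *)
pose N := minn i j; pose M := maxn i j.
pose G := [set S l | l in [set l | N <= l <= M]] `|` [set` p ++ Q u].
have GS l : N <= l <= M -> G (S l) by move=> lb; left; exists l.
have down k l : N <= k -> k <= l -> l <= M -> reach D G (S l) (S k).
  move=> Nk kl lM; apply/reach_revE; apply: ray_reach => // l' /andP[kl' l'l]; apply: GS.
  by rewrite (leq_trans Nk) // (leq_trans l'l).
have toU : reach D G (S M) u.
  apply: (@reach_trans _ _ _ (S i)); first by apply: down; rewrite ?geq_minl ?leq_maxl.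
  rewrite -[X in reach _ _ _ X]lp; apply: path_reach => //; first by have [] := dE_V (SE i).
  move=> z; rewrite in_cons => /orP[/eqP->|zp]; last by right; rewrite /= mem_cat zp.
  by apply: GS; rewrite geq_minl leq_maxl.
have fromU : reach D G u (S N).
  apply: (@reach_trans _ _ _ (S j)); last by apply: down; rewrite ?geq_minr ?leq_maxr.
  apply/reach_revE; rewrite -tsj -[X in reach _ _ _ X]lQ; apply: path_reach => //.
    by rewrite tsj; have [] := dE_V (SE j).
  move=> z; rewrite in_cons => /orP[/eqP->|zp]; last by right; rewrite /= mem_cat zp orbT.
  by rewrite tsj; apply: GS; rewrite geq_minr leq_maxr.
have [d [td ds dt]] := tendril_data_exists toU fromU.
have suP x : x \in P u -> x \in supp u by rewrite /supp mem_cat => ->.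
have suQ x : x \in Q u -> x \in supp u by rewrite /supp mem_cat in_cons => ->; rewrite !orbT.
have iu : S i \in supp u by exact: suP.
have ju : S j \in supp u by rewrite -tsj /supp mem_cat mem_head orbT.
exists (DomData N M c (p ++ Q u) X d) => _; split=> //=.
- by rewrite geq_min leq_maxl.
- by rewrite /N /minn; case: ifP.
- by rewrite /M /maxn; case: ifP.
- exact: suP.
- by move=> x; rewrite mem_cat => /orP[/pP/suP|/suQ].
- by move=> x /XP/suP.
- move=> x l; rewrite !mem_cat => /orP[/orP[xp|xQ]|xX]; [exact: pS|exact: (fan_avoid fS Uu xQ)|exact: XS].
- move=> x; rewrite !mem_cat => /orP[/orP[xp|xQ]|xX]; [|exact: (setup_Q su Uu xQ)|].
    exact: (setup_P su Uu (pP _ xp)).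
  exact: (setup_P su Uu (XP _ xX)).
- move=> x l; rewrite !mem_cat => /orP[/orP[xp|xQ]|xX]; [|exact: (QR _ _ _ Uu xQ)|].
    exact: (fan_avoid (setup_R su) Uu (pP _ xp)).
  exact: (fan_avoid (setup_R su) Uu (XP _ xX)).
Qed.

Lemma supp_escape U : setup D U R st P S ts Q a -> ray_along (rev_digraph D) S ->
  forall v, finite_set [set u | U u /\ v \in supp u].
Proof.
move=> su Sray v.
apply: (@sub_finite_set _ _ ([set u | U u /\ v \in P u] `|` ([set u | U u /\ ts u = v] `|` [set u | U u /\ v \in Q u]))).
  move=> u [Uu]; rewrite mem_cat in_cons => /or3P[?|/eqP e|?]; [left|right; left|right; right]; split=> //.
rewrite !finite_setU; split; first exact: fan_escape (setup_R su) v.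
by split; [exact: fan_start_escape Sray (setup_S su)|exact: fan_escape (setup_S su) v].
Qed.

Section Assembly.
Variables (U : set V) (w : V -> dom_data).
Hypothesis su : setup D U R st P S ts Q a.
Hypothesis wP : forall u, U u -> dom_spec u (w u).
Hypothesis Sray : ray_along (rev_digraph D) S.
Hypothesis K01 : (forall u, U u -> tdK (dmT (w u)) = 0) \/ (forall u, U u -> 0 < tdK (dmT (w u))).

(** Vertex [k] of the dominated ray consists of the first branch of the tendril of [u k], the
    stretch of [S] up to the next tendril, and the connection [X k] from [R], which enters this
    stretch at [C k]. The arcs along the ray come from [S], and the arcs from its root come from
    [R]. *)
Lemma dom_assembly : realizes shaped_by_star D U.
Proof.
have [Sinj SE] := Sray; have h := setup_hub su.
have SE' i : dE D (S i.+1) (S i) := SE i.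
have [hi hiP] := exists_choice (fun u => ray_bound (supp u) Sinj).
(* The extra list of a member contains all [S i] up to its largest index on [S], so later members
   use strictly larger indices. *)
have [f [fU supp_dis fdis]] := select (fun u => [seq S i | i <- iota 0 (hi u).+1]) (setup_inf su)
  (supp_escape su Sray).
have lt_index k l i : k < l -> S i \in supp (f l) -> hi (f k) < i.
  move=> kl iS; rewrite ltnNge; apply/negP => ik; case/negP: (fdis k l _ kl iS).
  by apply/mapP; exists i => //; rewrite mem_iota.
(* Odd members carry the teeth and even ones the connections from [R]. Leaving out [f 0] makes all
   indices positive, so that [S 0] remains with the hub. *)
pose u k := f k.*2.+1; pose v k := f k.*2.+2.
have uU k : U (u k) by exact: fU.
pose N k := dmN (w (u k)); pose M k := dmM (w (u k)); pose C k := dmC (w (v k)).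
pose G k := dmG (w (u k)); pose X k := dmX (w (v k)); pose d k := dmT (w (u k)).
have NM k : N k <= M k := dm_le (wP (uU k)).
have N0 k : 0 < N k by apply: leq_ltn_trans (lt_index 0 _ _ _ (dm_N (wP (uU k)))).
have MC k : M k < C k.
  apply: leq_ltn_trans (lt_index _ _ _ (ltnSn k.*2.+1) (dm_C (wP (fU _)))).
  exact: hiP (dm_M (wP (uU k))).
have CN k : C k < N k.+1.
  apply: leq_ltn_trans (lt_index k.*2.+2 _ _ _ (dm_N (wP (uU k.+1)))); last by rewrite doubleS.
  exact: hiP (dm_C (wP (fU _))).
have NS k : N k < N k.+1 := leq_ltn_trans (NM k) (ltn_trans (MC k) (CN k)).
pose Z := range R `|` [set` a].
have ZS i : Z (S i) -> i = 0.
  case=> [[j _ e]|/(hub_S h)/Sinj//].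
  by have [_ /Sinj] := hub_RS h e.
have ZG k x : x \in G k -> ~ Z x.
  move=> xG [[j _ e]|xa].
    by apply: (dm_R (wP (uU k)) (x := x) (i := j)); rewrite ?e // mem_cat xG.
  by have := dm_a (wP (uU k)) (x := x); rewrite mem_cat xG xa => /(_ isT).
have ZX k x : x \in X k -> ~ Z x.
  move=> xG [[j _ e]|xa].
    by apply: (dm_R (wP (fU k.*2.+2)) (x := x) (i := j)); rewrite ?e // mem_cat xG orbT.
  by have := dm_a (wP (fU k.*2.+2)) (x := x); rewrite mem_cat xG xa orbT => /(_ isT).
have SG k i : S i \in G k -> False.
  by move=> xG; apply: (dm_S (wP (uU k)) (x := S i) (i := i)) => //; rewrite mem_cat xG.
have SX k i : S i \in X k -> False.
  by move=> xG; apply: (dm_S (wP (fU k.*2.+2)) (x := S i) (i := i)) => //; rewrite mem_cat xG orbT.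
have GX k l x : x \in G k -> x \in X l -> False.
  move=> /(dm_G (wP (uU k))) xk /(dm_X (wP (fU l.*2.+2))) xl.
  by have := supp_dis _ _ _ xk xl; clear; lia.
pose B k := [set S i | i in [set i | N k <= i <= M k]] `|` [set` G k].
have td k : tendril_of D (B k) (u k) (d k) := dm_td (wP (uU k)).
pose I' k := tdI (d k) 0 `|` ([set S i | i in [set i | M k < i < N k.+1]] `|` [set` X k]).
(* The out-side of the root of the dominated ray continues down to [S 0], through the hub to [R 0]
   and along all of [R]; from there every [X k] can be entered. *)
pose E k := if k is 0 then Z `|` [set S i | i in [set i | i < N 0]] else set0.
pose O' k := tdO (d k) 0 `|` E k.
have IB k x : tdI (d k) 0 x -> B k x by move=> Ix; apply: (td_sub (td k) (leq0n _)); left.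
have OB k x : tdO (d k) 0 x -> B k x by move=> Ox; apply: (td_sub (td k) (leq0n _)); right.
have IM k : tdI (d k) 0 (S (M k)) by rewrite -(dm_tdS (wP (uU k))); exact: td_in (td k).
have ON k : tdO (d k) 0 (S (N k)) by rewrite -(dm_tdT (wP (uU k))); exact: td_out (td k).
have BI k x : B k x -> ([set S i | i in [set i | M k < i < N k.+1]] `|` [set` X k]) x -> False.
  move=> [[i /= /andP[i1 i2] <-]|xG] [[j /= /andP[j1 j2] e]|xX].
  - by move: e j1 => /Sinj->; rewrite ltnNge i2.
  - exact: SX xX.
  - by subst x; exact: SG xG.
  - exact: GX xG xX.
have BE k x : B k x -> E k x -> False.
  case: k => // -[[i /= /andP[i1 i2] <-]|xG] [Zx|[j /= j1 e]].
  - by move: i1; rewrite (ZS _ Zx) leqn0 => /eqP e; have := N0 0; rewrite e.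
  - by move: e j1 => /Sinj->; rewrite ltnNge i1.
  - exact: ZG xG Zx.
  - by subst x; exact: SG xG.
have IE k x : ([set S i | i in [set i | M k < i < N k.+1]] `|` [set` X k]) x -> E k x -> False.
  case: k => // -[[i /= /andP[i1 i2] <-]|xG] [Zx|[j /= j1 e]].
  - by move: i1; rewrite (ZS _ Zx).
  - by move: e j1 => /Sinj->; rewrite ltnNge (leq_trans (NM 0)) // ltnW.
  - exact: ZX xG Zx.
  - by subst x; exact: SX xG.
have SMI k i : M k <= i -> i < N k.+1 -> I' k (S i).
  rewrite leq_eqVlt => /orP[/eqP<-|Mi] iN; first by left.
  by right; left; exists i => //=; rewrite Mi.
have toM k i : M k <= i -> i < N k.+1 -> reach D (I' k) (S i) (S (M k)).
  move=> Mi iN; apply/reach_revE; apply: ray_reach => // l /andP[l1 l2].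
  by apply: SMI => //; exact: leq_ltn_trans iN.
have XI k x : x \in X k -> reach D (I' k) x (S (C k)).
  move=> xX; apply: reach_mono (dm_reach (wP (fU k.*2.+2)) xX) => y [yX|->]; first by right; right.
  by apply: SMI; [exact: ltnW (MC k)|exact: CN].
have td' k : tendril D (B k `|` (I' k `|` O' k)) (S (M k)) (S (N k)) (u k) (tdK (d k))
    (upd0 (I' k) (tdI (d k))) (upd0 (O' k) (tdO (d k))) (tdR (d k)).
  apply: (tendril_extend (td k)).
  - by move=> x; left.
  - by move=> x; left.
  - have [bI _ bIr _ _] := td_branch (td k) (leq0n _).
    move=> x [Ix|[[i /= /andP[i1 i2] <-]|xX]].
    + by exists x => //; apply: reach_refl; [left|have [] := reach_inl (bI x Ix)].
    + by exists (S (M k)) => //; apply: toM => //; exact: ltnW.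
    + exists (S (M k)) => //; apply: (reach_trans (XI k x xX)); apply: toM; [exact: ltnW (MC k)|exact: CN].
  - have [_ bO _ bOr _] := td_branch (td k) (leq0n _).
    move=> x [Ox|Ex].
      by exists x => //; apply: reach_refl; [left|have [] := reach_inr (bO x Ox)].
    case: k bO bOr Ex => [|//] bO bOr Ex; exists (S (N 0)) => //.
    have SO i : i <= N 0 -> O' 0 (S i).
      by rewrite leq_eqVlt => /orP[/eqP->|iN]; [left|right; right; exists i].
    have dn i : i <= N 0 -> reach D (O' 0) (S (N 0)) (S i).
      by move=> iN; apply/reach_revE; apply: ray_reach => // l /andP[_ lN]; exact: SO.
    case: Ex => [Zx|[i iN <-]]; last by apply: dn; exact: ltnW.
    apply: (reach_trans (dn 0 (leq0n _))).
    have aO y z : reach D [set` a] y z -> reach D (O' 0) y z.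
      by apply: reach_mono => t ta; right; left; right.
    case: Zx => [[i _ <-]|xa]; last by have [r1 _] := hub_path h xa; exact: aO.
    have [r1 _] := hub_path h (hub_R0 h); apply: (reach_trans (aO _ _ r1)).
    by apply: reach_mono (fan_core_reach i (setup_R su)) => y Ry; right; left; left.
  - move=> x [[Ix|nx]|[Ox|nx]] Bx; [by left|by case: (BI k x)|by right|by case: (BE k x)].
  - move=> x [Ix|nx] [Ox|ex] //.
    + by case: (BE k x (IB _ _ Ix)).
    + by case: (BI k x (OB _ _ Ox)).
    + by case: (IE k x nx).
  - by left.
  - by left.
pose Reg k := B k `|` (I' k `|` O' k).
have RegP k x : Reg k x -> [\/ exists2 i, x = S i & N k <= i < N k.+1,
    x \in G k ++ X k | k = 0 /\ (Z x \/ exists2 i, x = S i & i < N 0)].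
  have RB : B k x -> [\/ exists2 i, x = S i & N k <= i < N k.+1,
      x \in G k ++ X k | k = 0 /\ (Z x \/ exists2 i, x = S i & i < N 0)].
    case=> [[i /= /andP[i1 i2] <-]|xG].
      by apply: Or31; exists i => //; rewrite i1 (leq_ltn_trans i2) // (ltn_trans (MC k)).
    by apply: Or32; rewrite mem_cat; apply/orP; left.
  case=> [//|[[/IB//|[[i /= /andP[i1 i2] <-]|xX]]|[/OB//|]]].
  - by apply: Or31; exists i => //; rewrite (leq_trans (NM k)) //; exact: ltnW.
  - by apply: Or32; rewrite mem_cat; apply/orP; right.
  - case: (k) => [|//] [Zx|[i iN <-]]; apply: Or33; split=> //; [by left|].
    by right; exists i.
have nS k x i : x \in G k ++ X k -> x <> S i.
  by rewrite mem_cat => /orP[xG|xX] e; subst x; [exact: SG xG|exact: SX xX].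
have nZ k x : x \in G k ++ X k -> ~ Z x.
  by rewrite mem_cat => /orP[xG|xX]; [exact: ZG xG|exact: ZX xX].
have GXdis k l x : x \in G k ++ X k -> x \in G l ++ X l -> k = l.
  rewrite !mem_cat => /orP[/(dm_G (wP (uU k)))|/(dm_X (wP (fU k.*2.+2)))] xk
    /orP[/(dm_G (wP (uU l)))|/(dm_X (wP (fU l.*2.+2)))] xl;
    have := supp_dis _ _ _ xk xl; clear; lia.
have low i k : i < N 0 -> N k <= i -> False.
  move=> i1 i2; case: k i2 => [|k] i2; first by rewrite leqNgt i1 in i2.
  by have := leq_trans (ltn_trans i1 (NS 0)) (leq_trans (incr_leq NS (ltn0Sn k)) i2); rewrite ltnn.
have Regdis k l x : Reg k x -> Reg l x -> k = l.
  move=> /RegP[[i -> ik]|xk|[-> xk]] /RegP[[j ej jl]|xl|[-> xl]] //.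
  - by move: ej jl => /Sinj <-; exact: incr_interval NS ik.
  - by case: (nS _ _ _ xl erefl).
  - case/andP: ik => i1 i2; case: xl => [/ZS i0|[j /Sinj <-]]; last by move/low => /(_ _ i1).
    by move: (N0 k); rewrite i0 leqn0 in i1; rewrite (eqP i1).
  - by case: (nS _ _ _ xk ej).
  - exact: GXdis xk xl.
  - by case: xl => [/(nZ _ _ xk)//|[j /(nS _ _ _ xk)]].
  - case/andP: jl => i1 i2; subst x; case: xk => [/ZS i0|[i /Sinj <-]]; last by move/low => /(_ _ i1).
    by move: (N0 l); rewrite i0 leqn0 in i1; rewrite (eqP i1).
  - by case: xk => [/(nZ _ _ xl)//|[j /(nS _ _ _ xl)]].
apply: (@dom_realizes V D U (fun k => tdK (d k)) Reg (fun k => S (M k)) (fun k => S (N k)) u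
  (fun k => upd0 (I' k) (tdI (d k))) (fun k => upd0 (O' k) (tdO (d k))) (fun k => tdR (d k)) td' Regdis uU).
- move=> k; exists (S (N k.+1)), (S (N k.+1).-1); split.
  + by left.
  + by apply: SMI; have := CN k; have := MC k; clear; lia.
  + by rewrite -{1}(prednK (N0 k.+1)).
- move=> k; have [y e yP] := dm_enter (wP (fU k.+1.*2.+2)).
  exists (st (v k.+1)), y; split=> //=.
    by right; left; left; have [i ->] := fan_start (setup_R su) (fU k.+1.*2.+2); exists i.
  case: yP => [->|yX]; last by right; right.
  by apply: SMI; [exact: ltnW (MC k.+1)|exact: CN].
- by case: K01 => [K|K]; [left|right] => k; apply: K.
Qed.

End Assembly.

(** Infinitely many members have a trivial tendril or infinitely many have a nontrivial one; the
    assembly needs a uniform kind. *)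
Lemma dom_case U : setup D U R st P S ts Q a ->
  (forall u, U u -> hits_ray S P u) -> (forall u x i, U u -> x \in Q u -> x <> R i) ->
  realizes shaped_by_star D U.
Proof.
move=> su PS QR; have [w wP] := exists_choice (dom_data_exists su PS QR).
have Sray := crossing_ray su PS.
have [inf|inf] := infinite_split [set u | tdK (dmT (w u)) = 0] (setup_inf su).
  apply: (@realizes_sub _ _ _ _ (U `&` [set u | tdK (dmT (w u)) = 0])); first by move=> u [].
  apply: (@dom_assembly _ w) => //; first by apply: setup_sub inf su => u [].
    by move=> u [/wP].
  by left=> u [].
apply: (@realizes_sub _ _ _ _ (U `\` [set u | tdK (dmT (w u)) = 0])); first by move=> u [].
apply: (@dom_assembly _ w) => //; first by apply: setup_sub inf su => u [].
  by move=> u [/wP].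
by right=> u [_ /= ne]; rewrite lt0n; apply/eqP.
Qed.

End DominatedCase.

(** * Both path systems cross: chains of triangles *)

Section ChainCase.
Variables (V : eqType) (D : digraph V) (U : set V).
Variables (R S : nat -> V) (st ts : V -> V) (P Q : V -> seq V) (a : seq V).
Hypothesis su : setup D U R st P S ts Q a.
Hypothesis PS : forall u, U u -> hits_ray S P u.
Hypothesis QR : forall u, U u -> hits_ray R Q u.

(** The tendril of [u], with vertices in [G], leads from [S A] to [R B]; the connection [X] leads
    from [R E] to [S C]. *)
Record rung_data := RungData { rgA : nat; rgB : nat; rgC : nat; rgE : nat; rgG : seq V; rgX : seq V;
  rgT : tendril_data V }.

Definition rung_support u := st u :: P u ++ ts u :: Q u.

Record rung_spec u (w : rung_data) : Prop := RungSpec {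
  rg_A : S (rgA w) \in rung_support u;
  rg_B : R (rgB w) \in rung_support u;
  rg_C : S (rgC w) \in rung_support u;
  rg_E : R (rgE w) \in rung_support u;
  rg_G : {subset rgG w <= rung_support u};
  rg_X : {subset rgX w <= rung_support u};
  rg_S : forall x i, x \in rgG w ++ rgX w -> x <> S i;
  rg_R : forall x i, x \in rgG w ++ rgX w -> x <> R i;
  rg_reach : forall x, x \in rgX w -> reach D ([set` rgX w] `|` [set S (rgC w)]) x (S (rgC w));
  rg_enter : exists2 y, dE D (R (rgE w)) y & y = S (rgC w) \/ y \in rgX w;
  rg_td : tendril_of D [set` rgG w] u (rgT w);
  rg_tdS : dE D (S (rgA w)) (tdS (rgT w));
  rg_tdT : dE D (tdT (rgT w)) (R (rgB w)) }.

Lemma rung_data_exists u : exists w, U u -> rung_spec u w.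
Proof.
have fR := setup_R su; have fS := setup_S su.
case: (pselect (U u)) => [Uu|nU]; last first.
  by exists (RungData 0 0 0 0 [::] [::] (TendrilData u u 0 (fun _ => set0) (fun _ => set0) (fun _ => u))).
have [X [c [XP cP XS Xr Xe]]] := first_on_ray su Uu (PS Uu).
have [p [i [pP iP pS pp lp]]] := last_on_ray su Uu (PS Uu).
have [q [j [qP jP qR pq lq]]] := last_on_ray (setup_rev su) Uu (QR Uu).
have [e ste] := fan_start fR Uu.
(* [P u] hits [S] and is therefore not empty; so it contains its end [u], and its vertices avoid
   [R]. *)
have uR l : u <> R l.
  move=> el; have [x xP _] := PS Uu; have [_ lP _] := fan_path fR Uu.
  case eP: (P u) xP lP => [//|y p'] _ /= lP; apply: (fan_avoid fR Uu (x := u) (i := l)) => //.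
  by rewrite eP -{1}lP mem_last.
have uS l : u <> S l.
  move=> el; have [x xQ _] := QR Uu; have [_ lQ _] := fan_path fS Uu.
  case eQ: (Q u) xQ lQ => [//|y p'] _ /= lQ; apply: (fan_avoid fS Uu (x := u) (i := l)) => //.
  by rewrite eQ -{1}lQ mem_last.
case: p pP pS pp lp => [|s p] pP pS; first by move=> _ /= e'; case: (uS i).
move=> /= /andP[/asboolP es pp] lp.
case: q qP qR pq lq => [|t q] qP qR; first by move=> _ /= e'; case: (uR j).
move=> /= /andP[/asboolP et pq] lq.
have sU : reach D [set` (s :: p) ++ (t :: q)] s u.
  rewrite -[X in reach _ _ _ X]lp; apply: path_reach => //; first by have [] := dE_V es.
  by move=> z zp; rewrite /= -cat_cons mem_cat zp.
have Ut : reach D [set` (s :: p) ++ (t :: q)] u t.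
  apply/reach_revE; rewrite -[X in reach _ _ _ X]lq; apply: path_reach => //; first by have [] := dE_V et.
  by move=> z zp; rewrite /= -cat_cons mem_cat zp orbT.
have [d [td ds dt]] := tendril_data_exists sU Ut.
have suP x : x \in P u -> x \in rung_support u by rewrite /rung_support in_cons mem_cat => ->; rewrite orbT.
have suQ x : x \in Q u -> x \in rung_support u by rewrite /rung_support in_cons mem_cat in_cons => ->; rewrite !orbT.
exists (RungData i j c e ((s :: p) ++ (t :: q)) X d) => _.
have PR x l : x \in P u -> x <> R l by move=> xP; exact: (fan_avoid fR Uu xP).
have QS x l : x \in Q u -> x <> S l by move=> xQ; exact: (fan_avoid fS Uu xQ).
split; rewrite /rgA /rgB /rgC /rgE /rgG /rgX /rgT ?ds ?dt //.
- exact: suP.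
- exact: suQ.
- exact: suP.
- by rewrite -ste /rung_support mem_head.
- by move=> x; rewrite mem_cat => /orP[/pP/suP|/qP/suQ].
- by move=> x /XP/suP.
- by move=> x l; rewrite !mem_cat => /orP[/orP[xp|xQ]|xX]; [exact: pS|exact: (QS _ _ (qP _ xQ))|exact: XS].
- by move=> x l; rewrite !mem_cat => /orP[/orP[xp|xQ]|xX]; [exact: (PR _ _ (pP _ xp))|exact: qR|exact: (PR _ _ (XP _ xX))].
- by rewrite -ste.
Qed.

Lemma chain_case : realizes chain_of_triangles D U.
Proof.
have [w wP] := exists_choice rung_data_exists.
have fR := setup_R su; have fS := setup_S su; have h := setup_hub su.
have Sray := crossing_ray su PS.
have Rray := crossing_ray (setup_rev su) QR; rewrite rev_digraphK in Rray.
have [Sinj SE] := Sray; have [Rinj RE] := Rray.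
have SE' i : dE D (S i.+1) (S i) := SE i.
have [hS hSP] := exists_choice (fun u => ray_bound (rung_support u) Sinj).
have [hR hRP] := exists_choice (fun u => ray_bound (rung_support u) Rinj).
have esc v : finite_set [set u | U u /\ v \in rung_support u].
  apply: (@sub_finite_set _ _ ([set u | U u /\ v \in supp ts P Q u] `|` [set u | U u /\ st u = v])).
    by move=> u [Uu]; rewrite in_cons => /orP[/eqP e|?]; [right|left].
  rewrite finite_setU; split; first exact: supp_escape su Sray v.
  exact: fan_start_escape Rray fR.
have [f [fU supp_dis fdis]] := select (fun u => [seq S i | i <- iota 0 (hS u).+1] ++
  [seq R i | i <- iota 0 (hR u).+1]) (setup_inf su) esc.
have lt_S k l i : k < l -> S i \in rung_support (f l) -> hS (f k) < i.
  move=> kl iS; rewrite ltnNge; apply/negP => ik; case/negP: (fdis k l _ kl iS).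
  by rewrite mem_cat; apply/orP; left; apply/mapP; exists i => //; rewrite mem_iota.
have lt_R k l i : k < l -> R i \in rung_support (f l) -> hR (f k) < i.
  move=> kl iS; rewrite ltnNge; apply/negP => ik; case/negP: (fdis k l _ kl iS).
  by rewrite mem_cat; apply/orP; right; apply/mapP; exists i => //; rewrite mem_iota.
(* [u k] supplies the tooth path with the two arcs at it, and [v k] the arc that closes the
   triangle. As [f 0] is left out, only positive indices of [S] occur, where [S] and [R] are
   disjoint. *)
pose u k := f k.*2.+1; pose v k := f k.*2.+2.
have uU k : U (u k) by exact: fU.
have wu k := wP _ (uU k); have wv k := wP _ (fU k.*2.+2).
pose A k := rgA (w (u k)); pose B k := rgB (w (u k)); pose C k := rgC (w (v k)); pose E k := rgE (w (v k)).
pose G k := rgG (w (u k)); pose X k := rgX (w (v k)); pose d k := rgT (w (u k)).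
have A0 k : 0 < A k by apply: leq_ltn_trans (lt_S 0 _ _ _ (rg_A (wu k))).
have B0 k : 0 < B k by apply: leq_ltn_trans (lt_R 0 _ _ _ (rg_B (wu k))).
have AC k : A k < C k.
  by apply: leq_ltn_trans (lt_S _ _ _ (ltnSn k.*2.+1) (rg_C (wv k))); exact: hSP (rg_A (wu k)).
have BE k : B k < E k.
  by apply: leq_ltn_trans (lt_R _ _ _ (ltnSn k.*2.+1) (rg_E (wv k))); exact: hRP (rg_B (wu k)).
have CA k : C k < A k.+1.
  apply: leq_ltn_trans (lt_S k.*2.+2 _ _ _ (rg_A (wu k.+1))); last by rewrite doubleS.
  exact: hSP (rg_C (wv k)).
have EB k : E k < B k.+1.
  apply: leq_ltn_trans (lt_R k.*2.+2 _ _ _ (rg_B (wu k.+1))); last by rewrite doubleS.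
  exact: hRP (rg_E (wv k)).
have AA k : A k < A k.+1 := ltn_trans (AC k) (CA k).
have BB k : B k < B k.+1 := ltn_trans (BE k) (EB k).
pose segS k := [set S i | i in [set i | A k <= i < A k.+1]].
pose segR k := [set R i | i in [set i | B k <= i < B k.+1]].
have SR i j : 0 < i -> S i <> R j.
  by move=> i0 e; have [_ /Sinj e'] := hub_RS h (esym e); rewrite e' in i0.
have segSR k l x : segS k x -> segR l x -> False.
  move=> [i /= /andP[i1 _] <-] [j _ /esym]; apply: SR; exact: leq_trans (A0 k) i1.
have nS k x i : x \in G k ++ X k -> x <> S i.
  by rewrite mem_cat => /orP[xG|xX]; [apply: (rg_S (wu k))|apply: (rg_S (wv k))]; rewrite mem_cat ?xG ?xX ?orbT.
have nR k x i : x \in G k ++ X k -> x <> R i.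
  by rewrite mem_cat => /orP[xG|xX]; [apply: (rg_R (wu k))|apply: (rg_R (wv k))]; rewrite mem_cat ?xG ?xX ?orbT.
have GXdis k l x : x \in G k ++ X k -> x \in G l ++ X l -> k = l.
  rewrite !mem_cat => /orP[/(rg_G (wu k))|/(rg_X (wv k))] xk
    /orP[/(rg_G (wu l))|/(rg_X (wv l))] xl;
    have := supp_dis _ _ _ xk xl; clear; lia.
have GXn k x : x \in G k -> x \in X k -> False.
  move=> /(rg_G (wu k)) xk /(rg_X (wv k)) xl.
  by have := supp_dis _ _ _ xk xl; clear; lia.
have inG k x : x \in G k -> x \in G k ++ X k by rewrite mem_cat => ->.
have inX k x : x \in X k -> x \in G k ++ X k by rewrite mem_cat => ->; rewrite orbT.
have segS_n k l x : segS k x -> x \in G l ++ X l -> False.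
  by move=> [i _ <-] /(nS _ _ i).
have segR_n k l x : segR k x -> x \in G l ++ X l -> False.
  by move=> [i _ <-] /(nR _ _ i).
pose Reg k := [set` G k ++ X k] `|` (segS k `|` segR k).
have Regdis k l x : Reg k x -> Reg l x -> k = l.
  move=> [xk|[sk|rk]] [xl|[sl|rl]].
  - exact: GXdis xk xl.
  - by case: (segS_n _ _ _ sl xk).
  - by case: (segR_n _ _ _ rl xk).
  - by case: (segS_n _ _ _ sk xl).
  - case: sk sl => i ik <- [j jl /Sinj e]; subst j.
    exact: incr_interval AA ik jl.
  - by case: (segSR _ _ _ sk rl).
  - by case: (segR_n _ _ _ rk xl).
  - by case: (segSR _ _ _ sl rk).
  - case: rk rl => i ik <- [j jl /Rinj e]; subst j.
    exact: incr_interval BB ik jl.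
have sA k i : A k <= i -> i < A k.+1 -> segS k (S i) by move=> i1 i2; exists i => //=; rewrite i1.
have rB k i : B k <= i -> i < B k.+1 -> segR k (R i) by move=> i1 i2; exists i => //=; rewrite i1.
(* [true] stands for [a k], which collects a stretch of [S] and is left at its last vertex
   [S (A k)]. [false] stands for [c k], which is entered at [R (B k)] and spreads along a stretch of
   [R]. *)
pose I2 k b := if b then segS k `|` [set` X k] else [set R (B k)].
pose O2 k b := if b then [set S (A k)] else segR k.
pose r2 k b := if b then S (A k) else R (B k).
have DS i : dV D (S i) by have [] := dE_V (SE' i).
have DR i : dV D (R i) by have [] := dE_V (RE i).
have downS k i : A k <= i -> i < A k.+1 -> reach D (segS k) (S i) (S (A k)).
  move=> i1 i2; apply/reach_revE; apply: ray_reach => // l /andP[l1 l2].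
  by apply: sA => //; exact: leq_ltn_trans i2.
have td k : tendril D (Reg k) (tdS (d k)) (tdT (d k)) (u k) (tdK (d k)) (tdI (d k)) (tdO (d k)) (tdR (d k)).
  by apply: tendril_mono (rg_td (wu k)) => x xG; left; exact: inG.
have tdG k j x : j <= tdK (d k) -> (tdI (d k) j `|` tdO (d k) j) x -> x \in G k.
  by move=> jk xj; exact: (td_sub (rg_td (wu k)) jk xj).
have br2 k b : setT k -> branch D (I2 k b) (O2 k b) (r2 k b).
  move=> _; case: b; split.
  - move=> x [[i /= /andP[i1 i2] <-]|xX].
      by apply: reach_mono (downS k i i1 i2) => y; left.
    apply: (@reach_trans _ _ _ (S (C k))); last first.
      by apply: reach_mono (downS k (C k) (ltnW (AC k)) (CA k)) => y; left.
    apply: reach_mono (rg_reach (wv k) xX) => y [yX|->]; first by right.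
    by left; apply: sA; [exact: ltnW (AC k)|exact: CA].
  - by move=> x ->; apply: reach_refl => //; exact: DS.
  - by left; apply: sA (leqnn _) (AA k).
  - by [].
  - by [].
  - by move=> x ->; apply: reach_refl => //; exact: DR.
  - move=> x [i /= /andP[i1 i2] <-]; apply: ray_reach => // l /andP[l1 l2].
    by apply: rB => //; exact: leq_ltn_trans i2.
  - by [].
  - by apply: rB (leqnn _) (BB k).
  - by [].
apply: (@chain_realizes V D U (fun k => tdK (d k)) Reg (fun k => tdS (d k)) (fun k => tdT (d k)) u
  (fun k => tdI (d k)) (fun k => tdO (d k)) (fun k => tdR (d k)) I2 O2 r2 td Regdis setT br2) => //.
- move=> k [] x _ /=.
    case=> [[sx|xX]|->]; [by right; left|by left; exact: inX|right; left].
    exact: sA (leqnn _) (AA k).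
  by case=> [->|sx]; right; right => //; exact: rB (leqnn _) (BB k).
- move=> k b x j _ xb jk xj; have xG := tdG _ _ _ jk xj.
  case: b xb => -[xb|xb].
  + case: xb => [sx|xX]; [exact: segS_n sx (inG _ _ xG)|exact: GXn xG xX].
  + by apply: segS_n (inG _ _ xG); rewrite xb; exact: sA (leqnn _) (AA k).
  + by apply: segR_n (inG _ _ xG); rewrite xb; exact: rB (leqnn _) (BB k).
  + exact: segR_n xb (inG _ _ xG).
- move=> k x _ xt xf.
  have rx : segR k x by case: xf => [->|//]; exact: rB (leqnn _) (BB k).
  case: xt => [[sx|xX]|e].
  + exact: segSR sx rx.
  + exact: segR_n rx (inX _ _ xX).
  + by apply: segSR _ rx; rewrite e; exact: sA (leqnn _) (AA k).
- move=> k; exists (S (A k)), (tdS (d k)); split=> //; [exact: td_in (td k)|exact: rg_tdS (wu k)].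
- move=> k; exists (tdT (d k)), (R (B k)); split=> //; [exact: td_out (td k)|exact: rg_tdT (wu k)].
- move=> k; have [y e yP] := rg_enter (wv k); exists (R (E k)), y; split=> //.
    by apply: rB; [exact: ltnW (BE k)|exact: EB].
  case: yP => [->|yX]; last by right.
  by left; apply: sA; [exact: ltnW (AC k)|exact: CA].
- move=> k; exists (S (A k.+1)), (S (A k.+1).-1); split=> //.
    by left; apply: sA; have := AA k; clear; lia.
  by rewrite -{1}(prednK (A0 k.+1)).
- move=> k; exists (R (B k.+1).-1), (R (B k.+1)); split=> //.
    by apply: rB; have := BB k; clear; lia.
  by rewrite -{2}(prednK (B0 k.+1)).
Qed.

End ChainCase.

(** * Finding the hub *)

Section Hubs.
Variables (V : eqType) (D : digraph V).
Hypothesis D_strong : forall x y, dV D x -> dV D y -> reach D setT x y.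

Definition shift_seq (R : nat -> V) l i := R (l + i).

Lemma fan_shift (E : digraph V) U R st P l : fan E U R st P ->
  fan E (U `&` [set u | exists2 i, l <= i & st u = R i]) (shift_seq R l) st P.
Proof.
move=> f; have := @fan_sub V E U (U `&` [set u | exists2 i, l <= i & st u = R i]) R st P (fun u h => h.1) f.
case=> [c dv s p av e t]; split=> //.
- case: c => [c|[inj RE]]; [left|right].
    by move=> i; rewrite /shift_seq (c (l + i)) (c (l + 0)).
  by split=> [i j /inj/addnI//|i]; rewrite /shift_seq addnS.
- by move=> i; exact: dv.
- by move=> u [_ [i li ->]]; exists (i - l); rewrite /shift_seq subnKC.
- by move=> u x i Uu xP; exact: (av u x (l + i) Uu xP).
- move=> m; apply: sub_finite_set (t (l + m)) => u [Uu no]; split=> // -[i li e']; apply: no.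
  by exists (i - l); rewrite /shift_seq ?subnKC //; lia.
Qed.

(** For two rays take the largest index at which [R] is on [S]. If one core is constant, all
    meetings are in the same vertex and any indices will do. *)
Lemma last_meeting U R st P S ts Q : fan D U R st P -> fan (rev_digraph D) U S ts Q ->
  ~ [/\ ray_along D R, ray_along (rev_digraph D) S & infinite_set [set i | exists j, R i = S j]] ->
  (exists i j, R i = S j) ->
  exists i j, R i = S j /\ forall i' j', i <= i' -> j <= j' -> R i' = S j' -> R i' = R i /\ S j' = S j.
Proof.
move=> fR fS nv [i [j e]].
case: (fan_core fR) => [cR|rR].
  exists i, j; split=> // i' j' _ _ e'; have eR : R i' = R i by rewrite (cR i') (cR i).
  by split=> //; rewrite -e' eR.
case: (fan_core fS) => [cS|rS].
  exists i, j; split=> // i' j' _ _ e'; have eS : S j' = S j by rewrite (cS j') (cS j).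
  by split=> //; rewrite e' eS.
have fin : finite_set [set i | exists j, R i = S j].
  by apply: contrapT => inf; apply: nv; split.
have [s es] := (finite_seqP _).1 fin.
have ex : exists n, `[<exists j, R n = S j>] by exists i; apply: asboolT; exists j.
have bd n : `[<exists j, R n = S j>] -> n <= \max_(n <- s) n.
  move=> /asboolP h; apply: leq_bigmax_seq => //.
  by have : [set i | exists j, R i = S j] n by []; rewrite es.
case: (ex_maxnP ex bd) => n /asboolP[m enm] nmax; exists n, m; split=> // i' j' ni _ e'.
have : i' <= n by apply: nmax; apply: asboolT; exists j'.
move=> in'; have ein : i' = n by apply/eqP; rewrite eqn_leq in' ni.
by subst i'; split=> //; rewrite -e' enm.
Qed.

(** If the cores meet, they are cut off at a last meeting, which is the hub. Otherwise a path from
    [S 0] to [R 0] is followed from its last vertex on [S] to the next one on [R], and the cores are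
    cut off at these two. *)
Lemma hub_exists U R st P S ts Q : fan D U R st P -> fan (rev_digraph D) U S ts Q ->
  ~ [/\ ray_along D R, ray_along (rev_digraph D) S & infinite_set [set i | exists j, R i = S j]] ->
  exists l k a, hub D (shift_seq R l) (shift_seq S k) a.
Proof.
move=> fR fS nv.
case: (pselect (exists i j, R i = S j)) => [meet|no].
  have [i [j [e mx]]] := last_meeting fR fS nv meet.
  exists i, j, [:: R i]; rewrite /shift_seq; split; rewrite ?addn0 ?e ?mem_head //.
  - move=> x; rewrite inE => /eqP->; have Dx : dV D (S j) := fan_dV fS j.
    by split; apply: reach_refl; rewrite //= mem_head.
  - by move=> n; rewrite inE => /eqP.
  - by move=> n; rewrite inE => /eqP.
  - by move=> n m; rewrite -e; move/mx; rewrite e; apply; exact: leq_addr.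
have ne i j : R i <> S j by move=> e; apply: no; exists i, j.
have [q [pq lq uq _]] := reach_path (D_strong (fan_dV fS 0) (fan_dV fR 0)).
have [|p1 [y [p2 [e /asboolP[k yk] np2]]]] := @last_hit _ (fun x => `[<exists k, x = S k>]) (S 0 :: q).
  by rewrite /= asboolT //; exists 0.
subst y.
have pp2 : path (darc D) (S k) p2.
  have : sorted (darc D) (S 0 :: q) by [].
  by rewrite e => /cat_sorted2[].
have lp2 : last (S k) p2 = R 0.
  by rewrite -lq -[last (S 0) q]/(last (S 0) (S 0 :: q)) e last_cat.
have [|p3 [y [p4 [e2 /asboolP[l yl] np3]]]] := @first_hit _ (fun x => `[<exists l, x = R l>]) p2.
  apply/hasP; exists (R 0); last by apply: asboolT; exists 0.
  have := mem_last (S k) p2; rewrite lp2 in_cons => /orP[/eqP e'|//].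
  by case: (ne 0 k).
subst y.
have p3S x i : x \in p3 -> x <> S i.
  move=> xp ex; case/hasP: np2; exists x; last by apply: asboolT; exists i.
  by rewrite e2 mem_cat xp.
have p3R x i : x \in p3 -> x <> R i.
  by move=> xp ex; case/hasP: np3; exists x => //; apply: asboolT; exists i.
have pp3 : path (darc D) (S k) (rcons p3 (R l)).
  by move: pp2; rewrite e2 -cat_rcons cat_path => /andP[].
have DSk : dV D (S k) := fan_dV fS k.
exists l, k, (S k :: rcons p3 (R l)); rewrite /shift_seq; split; rewrite ?addn0 ?mem_head //.
- move=> x xa; have := @path_reach_both _ D [set` S k :: rcons p3 (R l)] _ _ x DSk pp3 (fun _ h => h) xa.
  by rewrite last_rcons.
- by rewrite in_cons mem_rcons mem_head orbT.
- move=> i; rewrite in_cons mem_rcons in_cons => /or3P[/eqP/ne//|/eqP//|xp].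
  by case: (p3R _ (l + i) xp).
- move=> i; rewrite in_cons mem_rcons in_cons => /or3P[/eqP//|/eqP/esym/ne//|xp].
  by case: (p3S _ (k + i) xp).
- by move=> i j /ne.
Qed.

Lemma setup_exists U R st P S ts Q : infinite_set U -> fan D U R st P -> fan (rev_digraph D) U S ts Q ->
  ~ [/\ ray_along D R, ray_along (rev_digraph D) S & infinite_set [set i | exists j, R i = S j]] ->
  exists U' R' S' a, U' `<=` U /\ setup D U' R' st P S' ts Q a.
Proof.
move=> inf fR fS nv; have [l [k [a h]]] := hub_exists fR fS nv.
(* Each additional condition fails for finitely many members only: few paths start on the parts cut
   off from rays, and few meet the finite hub. *)
pose bad := [set u | U u /\ ~ exists2 i, l <= i & st u = R i] `|`
  ([set u | U u /\ ~ exists2 i, k <= i & ts u = S i] `|`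
  ([set u | U u /\ has (mem a) (P u)] `|` ([set u | U u /\ has (mem a) (Q u)] `|` [set` a]))).
have fbad : finite_set bad.
  rewrite /bad !finite_setU; do !split.
  - exact: fan_tail fR l.
  - exact: fan_tail fS k.
  - by apply: escape_seq => v; exact: fan_escape fR v.
  - by apply: escape_seq => v; exact: fan_escape fS v.
  - exact: finite_seq.
have good u : (U `\` bad) u -> [/\ U u, exists2 i, l <= i & st u = R i & exists2 i, k <= i & ts u = S i].
  move=> [Uu nb]; split=> //; apply: contrapT => no; apply: nb; first by left.
  by right; left.
exists (U `\` bad), (shift_seq R l), (shift_seq S k), a; split; first by move=> u [].
split=> //.
- exact: infinite_setD inf fbad.
- by apply: fan_sub (fan_shift l fR) => u /good[].
- by apply: fan_sub (fan_shift k fS) => u /good[].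
- move=> u x [Uu nb] xP; apply/negP => xa; apply: nb; right; right; left; split=> //.
  by apply/hasP; exists x.
- move=> u x [Uu nb] xP; apply/negP => xa; apply: nb; right; right; right; left; split=> //.
  by apply/hasP; exists x.
- by move=> u [Uu nb]; apply/negP => ua; apply: nb; do 4!right.
Qed.

Lemma setup_realizes U R st P S ts Q a : setup D U R st P S ts Q a ->
  realizes shaped_by_star D U \/ realizes chain_of_triangles D U.
Proof.
move=> su.
have noS U' : U' `<=` U -> infinite_set U' -> (forall u, U' u -> hits_ray S P u) ->
    realizes shaped_by_star D U \/ realizes chain_of_triangles D U.
  move=> UU inf' PS; have su' := setup_sub UU inf' su.
  have [inf2|inf2] := infinite_split [set u | hits_ray R Q u] inf'.
    right; apply: (@realizes_sub _ _ _ _ (U' `&` [set u | hits_ray R Q u])); first by move=> u [/UU].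
    by apply: (chain_case (setup_sub _ inf2 su')) => [u []//|u [Uu _]|u []//]; exact: PS.
  left; apply: (@realizes_sub _ _ _ _ (U' `\` [set u | hits_ray R Q u])); first by move=> u [/UU].
  apply: (dom_case (setup_sub _ inf2 su')) => [u []//|u [Uu _]|u x i [Uu no] xQ e]; first exact: PS.
  by apply: no; exists x => //; exists i.
have [inf|inf] := infinite_split [set u | hits_ray S P u] (setup_inf su).
  by apply: noS inf _ => u [].
left; have [inf2|inf2] := infinite_split [set u | hits_ray R Q u] inf.
  apply: (@realizes_sub _ _ _ _ ((U `\` [set u | hits_ray S P u]) `&` [set u | hits_ray R Q u])); first by move=> u [[]].
  (* Here only the paths [Q u] cross. Reversal exchanges [R] with [S] and reduces this to
     [dom_case]. *)
  apply: (@realizes_rev (@shaped_by_star)); first exact: rev_shaped_by_star.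
  apply: (dom_case (setup_sub _ inf2 (setup_rev su))) => [u [[]]//|u []//|u x i [[Uu no] _] xP e].
  by apply: no; exists x => //; exists i.
apply: (@realizes_sub _ _ _ _ (U `\` [set u | hits_ray S P u] `\` [set u | hits_ray R Q u])); first by move=> u [[]].
apply: (star_case (setup_sub _ inf2 su)) => [u [[]]//|u x i [[Uu no] _] xP e|u x i [_ no] xP e].
  by apply: no; exists x => //; exists i.
by apply: no; exists x => //; exists i.
Qed.

End Hubs.

(** * Strips and links *)

Section Links.
Variable V : Type.
Implicit Types (D : digraph V) (A B : set V).

(** Weaker than a path from [s] to [t]: strips and links can be concatenated without any
    disjointness, and a strip may be routed through any one of its vertices. *)
Definition strip D A s t := [/\ A s, A t & forall z, A z -> reach D A s z /\ reach D A z t].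

(* [A] is the interior of a link from [x] to [y]. *)
Definition link D x A y := (A = set0 /\ dE D x y) \/
  exists s t, [/\ dE D x s, dE D t y & strip D A s t].

Lemma strip_rev D A s t : strip D A s t -> strip (rev_digraph D) A t s.
Proof. by case=> As At r; split=> // z /r[sz zt]; split; exact: reach_rev. Qed.

Lemma link_rev D x A y : link D x A y -> link (rev_digraph D) y A x.
Proof.
by case=> [[-> e]|[s [t [e1 e2 r]]]]; [left|right; exists t, s; split=> //; exact: strip_rev].
Qed.

Lemma link_to D x A y z : link D x A y -> A z -> reach D (A `|` [set y]) z y.
Proof.
case=> [[-> //]|[s [t [_ e [As At r]]]] Az].
apply: reach_step e; last by right.
by have [_ zt] := r z Az; apply: reach_mono zt => v; left.
Qed.

Lemma link_from D x A y z : link D x A y -> A z -> reach D (A `|` [set x]) x z.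
Proof. by move=> /link_rev l Az; apply/reach_revE; exact: link_to l Az. Qed.

Lemma link_head D x A y : link D x A y -> exists2 z, (A `|` [set y]) z & dE D x z.
Proof.
by case=> [[-> e]|[s [t [e _ [As _ _]]]]]; [exists y => //; right|exists s => //; left].
Qed.

Lemma link_tail D x A y : link D x A y -> exists2 z, (A `|` [set x]) z & dE D z y.
Proof. by move=> /link_rev/link_head. Qed.

Lemma link_strip D x A y B z : link D x A y -> strip D B y z ->
  exists2 s, dE D x s & strip D (A `|` B) s z.
Proof.
move=> l [By Bz rB]; have BU : B `<=` A `|` B by right.
have AU : A `<=` A `|` B by left.
case: l => [[A0 e]|[s [t [e1 e2 [As At rA]]]]].
  by exists y => //; rewrite A0 set0U; split.
exists s => //.
have [_ yz] := rB y By; have [_ st] := rA s As.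
have sy : reach D (A `|` B) s y by apply: reach_step e2; [exact: reach_mono st|right].
split; [by left|by right|move=> v [/rA[sv vt]|/rB[yv vz]]]; split.
- exact: reach_mono sv.
- apply: (reach_trans (y := y)); last exact: reach_mono yz.
  by apply: reach_step e2; [exact: reach_mono vt|right].
- by apply: (reach_trans sy); exact: reach_mono yv.
- exact: reach_mono vz.
Qed.

Lemma strip_link D x A y C z : strip D A x y -> link D y C z ->
  exists2 t, dE D t z & strip D (A `|` C) x t.
Proof.
move=> /strip_rev sA /link_rev lC; have [t e /strip_rev sAC] := link_strip lC sA.
by exists t => //; rewrite setUC; rewrite rev_digraphK in sAC.
Qed.

Lemma link_cat D x A y B z C w : link D x A y -> strip D B y z -> link D z C w ->
  link D x (A `|` B `|` C) w.
Proof.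
move=> l sB l'; have [s e sAB] := link_strip l sB; have [t e' sABC] := strip_link sAB l'.
by right; exists s, t.
Qed.

Lemma strip_branch_b D A s t : strip D A s t -> branch D [set s] A s.
Proof.
case=> As At r; split=> //.
- by move=> x ->; apply: reach_refl => //; have [_] := reach_inr (r s As).1.
- by move=> x /r[].
Qed.

Lemma strip_branch_e D A s t : strip D A s t -> branch D A [set t] t.
Proof. by move=> sA; apply/branch_revE; exact: strip_branch_b (strip_rev sA). Qed.

End Links.

Section BranchLinks.
Variables (V : eqType) (D : digraph V).

Lemma absorb_in (I0 O0 J : set V) r b : branch D I0 O0 r -> I0 b ->
  (forall z, J z -> reach D (J `|` [set b]) z b) ->
  forall x, (I0 `|` J) x -> exists2 y, I0 y & reach D (I0 `|` J) x y.
Proof.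
move=> br I0b Jb x [Ix|Jx].
  exists x => //; apply: reach_refl; first by left.
  by have [] := reach_inl (branch_in br Ix).
by exists b => //; apply: reach_mono (Jb x Jx) => z [?|->]; [right|left].
Qed.

Lemma absorb_out (I0 O0 J : set V) r e : branch D I0 O0 r -> O0 e ->
  (forall z, J z -> reach D (J `|` [set e]) e z) ->
  forall x, (O0 `|` J) x -> exists2 y, O0 y & reach D (O0 `|` J) y x.
Proof.
move=> br O0e Je x [Ox|Jx].
  exists x => //; apply: reach_refl; first by left.
  by have [] := reach_inr (branch_out br Ox).
by exists e => //; apply: reach_mono (Je x Jx) => z [?|->]; [right|left].
Qed.

End BranchLinks.

Inductive label := Fw of nat | Core of nat | Bw of nat.

Definition label_index l := match l with Fw n | Core n | Bw n => n end.

Definition flip l := match l with Fw n => Bw n | Core n => Core n | Bw n => Fw n end.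

Lemma flipK l : flip (flip l) = l. Proof. by case: l. Qed.

Lemma flip_index l : label_index (flip l) = label_index l. Proof. by case: l. Qed.

(* [Core n] is a strip from [b n] to [e n]; [Fw n] is a link from [e n.-1] to
   [b n], and [Bw n] a link from [e n] to [b n.-1], for positive [n]. *)
Record ladder (V : eqType) (D : digraph V) (cls : label -> set V) (b e : nat -> V) : Prop := Ladder {
  ld_uniq : forall x l l', cls l x -> cls l' x -> l = l';
  ld_core : forall n, strip D (cls (Core n)) (b n) (e n);
  ld_fw : forall n, link D (e n) (cls (Fw n.+1)) (b n.+1);
  ld_bw : forall n, link D (e n.+1) (cls (Bw n.+1)) (b n);
  ld_fin : forall l, finite_set (cls l) }.

Lemma ladder_fw (V : eqType) (D : digraph V) cls b e n : ladder D cls b e -> 0 < n ->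
  link D (e n.-1) (cls (Fw n)) (b n).
Proof. by move=> ld n0; have := ld_fw ld n.-1; rewrite prednK. Qed.

Lemma ladder_bw (V : eqType) (D : digraph V) cls b e n : ladder D cls b e -> 0 < n ->
  link D (e n) (cls (Bw n)) (b n.-1).
Proof. by move=> ld n0; have := ld_bw ld n.-1; rewrite prednK. Qed.

Lemma ladder_rev (V : eqType) (D : digraph V) cls b e : ladder D cls b e ->
  ladder (rev_digraph D) (fun l => cls (flip l)) e b.
Proof.
case=> un co fw bw fi; split=> [x l l' xl xl'|n|n|n|l].
- by rewrite -(flipK l) -(flipK l') (un x _ _ xl xl').
- exact: strip_rev (co n).
- exact: link_rev (bw n).
- exact: link_rev (fw n).
- exact: fi.
Qed.

(** A window includes the links on both of its sides, up to index [hi.+1]. It is therefore adjacent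
    to the cores just outside of it. *)
Definition in_window lo hi l :=
  match l with Core n => lo <= n <= hi | Fw n | Bw n => lo <= n <= hi.+1 end.

(** * Attaching a single tooth to the ladder *)

Section Windows.
Variables (V : eqType) (D : digraph V) (cls : label -> set V) (b e : nat -> V).
Hypothesis ld : ladder D cls b e.

Definition region lo hi (G : set V) := [set x | exists2 l, in_window lo hi l & cls l x] `|` G.

Record window_data := WindowData { wT : tendril_data V; wI : bool -> set V; wO : bool -> set V; wR : bool -> V }.

(* The vertices of [wI true] and [wO true] are adjacent to the part of the
   ladder on the left, those of [wI false] and [wO false] to the part on the
   right. *)
Record window_spec (tri : bool) lo hi (G : set V) u (w : window_data) : Prop := WindowSpec {
  ws_td : tendril_of D (region lo hi G) u (wT w);
  ws_il : exists2 y, wI w true y & dE D (e lo.-1) y;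
  ws_ol : exists2 x, wO w true x & dE D x (b lo.-1);
  ws_ir : exists2 y, wI w false y & dE D (e hi.+1) y;
  ws_or : exists2 x, wO w false x & dE D x (b hi.+1);
  ws_tri : tri -> [/\ forall c, branch D (wI w c) (wO w c) (wR w c),
    forall c x, (wI w c `|` wO w c) x -> region lo hi G x,
    forall c x j, (wI w c `|` wO w c) x -> j <= tdK (wT w) ->
      ~ (tdI (wT w) j `|` tdO (wT w) j) x &
    forall x, (wI w true `|` wO w true) x -> ~ (wI w false `|` wO w false) x];
  ws_lq : tri -> exists x y, [/\ wO w true x, tdI (wT w) 0 y & dE D x y];
  ws_qr : tri -> exists x y, [/\ tdO (wT w) 0 x, wI w false y & dE D x y];
  ws_rl : tri -> exists x y, [/\ wO w false x, wI w true y & dE D x y];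
  ws_claw : ~~ tri -> forall c, wI w c = tdI (wT w) 0 /\ wO w c = tdO (wT w) 0 }.

Let ne x l l' : cls l x -> cls l' x -> l <> l' -> False.
Proof. by move=> xl xl'; apply; exact: (ld_uniq ld xl xl'). Qed.

Let b_core n : cls (Core n) (b n). Proof. by have [] := ld_core ld n. Qed.
Let e_core n : cls (Core n) (e n). Proof. by have [] := ld_core ld n. Qed.

(** This is the third side of a triangle. It uses only backward links and the cores between them, so
    that it avoids tendrils made of forward links. *)
Lemma back_chain lo hi : lo < hi -> exists2 C : set V, link D (e hi) C (b lo) &
  forall x, C x -> exists2 l, cls l x & match l with Core n => lo < n < hi | Bw n => lo < n <= hi | Fw _ => False end.
Proof.
elim: hi => // hi IH; rewrite ltnS leq_eqVlt => /orP[/eqP<-|lt].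
  exists (cls (Bw lo.+1)); first exact: ld_bw.
  by move=> x xl; exists (Bw lo.+1) => //; rewrite !ltnSn.
have [C lC CP] := IH lt.
exists (cls (Bw hi.+1) `|` cls (Core hi) `|` C); first exact: link_cat (ld_bw ld hi) (ld_core ld hi) lC.
move=> x [[xB|xC]|/CP[l xl lP]].
- by exists (Bw hi.+1) => //; rewrite leqnn andbT; exact: leqW.
- by exists (Core hi) => //; rewrite lt ltnSn.
- by exists l => //; case: (l) lP => [n //|n /andP[-> h]|n /andP[-> h]]; [exact: ltnW h|exact: leqW h].
Qed.

Section Spread.
Variables (a : nat) (I0 O0 : set V) (r : V).
Hypothesis a_pos : 0 < a.
Hypothesis br : branch D I0 O0 r.
Hypothesis I0b : I0 (b a).
Hypothesis O0e : O0 (e a).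
Hypothesis off : forall x l, (I0 `|` O0) x -> cls l x -> l = Core a.

(** A link goes to the side given by its direction: [Fw a] and [Bw a.+1] end in [b a], while
    [Fw a.+1] and [Bw a] start in [e a]. *)
Definition spreadI := I0 `|` (cls (Fw a) `|` cls (Bw a.+1)).
Definition spreadO := O0 `|` (cls (Fw a.+1) `|` cls (Bw a)).

Let lF := ladder_fw ld a_pos.
Let lB := ladder_bw ld a_pos.

Lemma spread_in x : spreadI x -> exists2 y, I0 y & reach D spreadI x y.
Proof.
apply: (absorb_in br I0b) => z [zF|zB].
  by apply: reach_mono (link_to lF zF) => v [?|->]; [left; left|right].
by apply: reach_mono (link_to (ld_bw ld a) zB) => v [?|->]; [left; right|right].
Qed.

Lemma spread_out x : spreadO x -> exists2 y, O0 y & reach D spreadO y x.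
Proof.
apply: (absorb_out br O0e) => z [zF|zB].
  by apply: reach_mono (link_from (ld_fw ld a) zF) => v [?|->]; [left; left|right].
by apply: reach_mono (link_from lB zB) => v [?|->]; [left; right|right].
Qed.

Lemma spread_meet x : spreadI x -> spreadO x -> I0 x /\ O0 x.
Proof.
have neS : a <> a.+1 by lia.
have out l : (I0 `|` O0) x -> cls l x -> l <> Core a -> False by move=> h1 h2; apply; exact: off h1 h2.
move=> [Ix|[xF|xB]] [Ox|[xF'|xB']] //.
- by case: (out _ (or_introl Ix) xF').
- by case: (out _ (or_introl Ix) xB').
- by case: (out _ (or_intror Ox) xF).
- by case: (ne xF xF') => -[].
- by case: (ne xF xB').
- by case: (out _ (or_intror Ox) xB).
- by case: (ne xB xF').
- by case: (ne xB xB') => -[/esym].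
Qed.

Lemma spread_branch : branch D spreadI spreadO r.
Proof.
apply: (branch_extend br); [by left|by left|exact: spread_in|exact: spread_out|exact: spread_meet].
Qed.

Lemma spread_sub G x : (forall y, (I0 `|` O0) y -> region a a G y) -> (spreadI `|` spreadO) x -> region a a G x.
Proof.
move=> sub [[Ix|[xF|xB]]|[Ox|[xF|xB]]].
- by apply: sub; left.
- by left; exists (Fw a) => //=; rewrite leqnn leqW.
- by left; exists (Bw a.+1) => //=; rewrite leqnn leqW.
- by apply: sub; right.
- by left; exists (Fw a.+1) => //=; rewrite leqnn leqW.
- by left; exists (Bw a) => //=; rewrite leqnn leqW.
Qed.

Lemma spread_ports : [/\ exists2 y, spreadI y & dE D (e a.-1) y, exists2 x, spreadO x & dE D x (b a.-1),
  exists2 y, spreadI y & dE D (e a.+1) y & exists2 x, spreadO x & dE D x (b a.+1)].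
Proof.
split.
- by have [y [yF|->] ey] := link_head lF; [exists y => //; right; left|exists (b a) => //; left].
- by have [y [yF|->] ey] := link_tail lB; [exists y => //; right; right|exists (e a) => //; left].
- by have [y [yF|->] ey] := link_head (ld_bw ld a); [exists y => //; right; right|exists (b a) => //; left].
- by have [y [yF|->] ey] := link_tail (ld_fw ld a); [exists y => //; right; left|exists (e a) => //; left].
Qed.

End Spread.

(** The tendril passes from [b a] through [u] to [e a], so its first branch can absorb the four
    links around the core and take the place of the core on the spine. *)
Lemma claw_core a G u d : 0 < a -> (forall x l, G x -> ~ cls l x) ->
  tendril_of D (cls (Core a) `|` G) u d -> tdS d = b a -> tdT d = e a ->
  exists w, window_spec false a a G u w.
Proof.
move=> a0 GM td ds dt.
have br := td_branch td (leq0n _).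
have I0b : tdI d 0 (b a) by rewrite -ds; exact: td_in td.
have O0e : tdO d 0 (e a) by rewrite -dt; exact: td_out td.
have sub x : (tdI d 0 `|` tdO d 0) x -> (cls (Core a) `|` G) x := td_sub td (leq0n _).
have offG x l : (cls (Core a) `|` G) x -> cls l x -> l = Core a.
  by move=> [xC|xG] xl; [exact: (ld_uniq ld xl xC)|case: (GM _ _ xG xl)].
have off x l : (tdI d 0 `|` tdO d 0) x -> cls l x -> l = Core a by move=> /sub; exact: offG.
have regG x : (cls (Core a) `|` G) x -> region a a G x.
  by move=> [xC|xG]; [left; exists (Core a) => //=; rewrite leqnn|right].
pose I' := spreadI a (tdI d 0); pose O' := spreadO a (tdO d 0).
have td' : tendril D (region a a G) (b a) (e a) u (tdK d) (upd0 I' (tdI d)) (upd0 O' (tdO d)) (tdR d).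
  apply: (@tendril_mono _ _ ((cls (Core a) `|` G) `|` (I' `|` O'))).
    move=> x [/regG//|]; apply: spread_sub => // y /sub; exact: regG.
  apply: (tendril_extend td).
  - by left.
  - by left.
  - exact: spread_in br I0b.
  - exact: spread_out br O0e.
  - have nl x : (cls (Core a) `|` G) x ->
      (cls (Fw a) `|` cls (Bw a.+1)) x \/ (cls (Fw a.+1) `|` cls (Bw a)) x -> False.
      by move=> xG [[]|[]] xl; have := offG x _ xG xl.
    by move=> x [[Ix|nx]|[Ox|nx]] xG; [left|case: (nl x xG); left|right|case: (nl x xG); right].
  - exact: spread_meet off.
  - by left.
  - by left.
have [p1 p2 p3 p4] := spread_ports a0 I0b O0e.
exists (WindowData (TendrilData (b a) (e a) (tdK d) (upd0 I' (tdI d)) (upd0 O' (tdO d)) (tdR d))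
  (fun _ => I') (fun _ => O') (fun _ => b a)).
by split.
Qed.

(** A vertex of class [l] can be placed on the out-side of core [exit_index l] and on the in-side of
    core [entry_index l], by the directions of the links. *)
Definition exit_index l := match l with Fw n => n.-1 | Core n => n | Bw n => n end.
Definition entry_index l := match l with Fw n => n | Core n => n | Bw n => n.-1 end.

(** The branch around core [a] needs [z] on its out-side and [y] on its in-side. The two ends have
    different classes, so at most one of them lies in the core, and the whole core can be given to
    the side that needs it. *)
Lemma claw_ear a (G : set V) u d lz ly z y : 0 < a -> (forall x l, G x -> ~ cls l x) ->
  tendril_of D G u d -> cls lz z -> cls ly y -> dE D z (tdS d) -> dE D (tdT d) y ->
  lz <> ly -> 0 < label_index lz -> 0 < label_index ly -> exit_index lz = a -> entry_index ly = a ->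
  exists w, window_spec false a a G u w.
Proof.
move=> a0 GM td zl yl ez ey nl lz0 ly0 xa ya.
have key I0 O0 r : branch D I0 O0 r -> I0 (b a) -> O0 (e a) -> (I0 `|` O0) `<=` cls (Core a) ->
    (lz = Core a -> O0 = cls (Core a)) -> (ly = Core a -> I0 = cls (Core a)) ->
    exists w, window_spec false a a G u w.
  move=> br I0b O0e sub zO yI.
  have off x l : (I0 `|` O0) x -> cls l x -> l = Core a.
    by move=> /sub xC xl; exact: (ld_uniq ld xl xC).
  have br' := spread_branch a0 br I0b O0e off.
  have inr x G' : (spreadI a I0 `|` spreadO a O0) x -> region a a G' x.
    by apply: spread_sub => v /sub vC; left; exists (Core a) => //=; rewrite leqnn.
  have Oz : spreadO a O0 z.
    case: lz zl lz0 xa {nl} zO => n /= zl lz0 xa zO.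
    - by right; left; rewrite -xa prednK.
    - by subst n; left; rewrite zO.
    - by subst n; right; right.
  have Iy : spreadI a I0 y.
    case: ly yl ly0 ya {nl} yI => n /= yl ly0 ya yI.
    - by subst n; right; left.
    - by subst n; left; rewrite yI.
    - by right; right; rewrite -ya prednK.
  have nG v : (spreadI a I0 `|` spreadO a O0) v -> ~ G v.
    by move=> /(inr _ set0)[[l _ vl]|//] vG; exact: GM vG vl.
  have Ib : spreadI a I0 (b a) by left.
  have Oe : spreadO a O0 (e a) by left.
  have td' := tendril_cons br' Ib Oe Oz ez Iy ey nG td.
  have [p1 p2 p3 p4] := spread_ports a0 I0b O0e.
  exists (WindowData (TendrilData (b a) (e a) (tdK d).+1 (ncons0 (spreadI a I0) (tdI d))
    (ncons0 (spreadO a O0) (tdO d)) (ncons0 r (tdR d))) (fun _ => spreadI a I0)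
    (fun _ => spreadO a O0) (fun _ => b a)).
  split=> //; rewrite /tendril_of /=; apply: tendril_mono td' => x [/inr//|xG]; by right.
have sC := ld_core ld a.
case: (pselect (lz = Core a)) => [lza|nz].
  apply: (key _ _ _ (strip_branch_b sC)) => //.
  - by move=> x [->|].
  - by move=> lya; case: nl; rewrite lza lya.
apply: (key _ _ _ (strip_branch_e sC)) => //.
by move=> x [|->].
Qed.

(* A triangle through the cores [lo] and [hi]: the forward links between them
   are replaced by the tendril. *)
Lemma triangle_window lo hi (G G0 EA FA : set V) u d z y : 0 < lo -> lo < hi ->
  (forall x l, G x -> ~ cls l x) ->
  tendril_of D G0 u d -> dE D z (tdS d) -> dE D (tdT d) y ->
  (forall x, G0 x -> G x \/ exists2 n, cls (Fw n) x & lo < n <= hi) ->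
  EA = set0 \/ EA = cls (Fw lo.+1) -> FA = set0 \/ FA = cls (Fw hi) ->
  (forall x, EA x -> ~ FA x) -> (forall x, G0 x -> ~ EA x) -> (forall x, G0 x -> ~ FA x) ->
  (cls (Core lo) `|` (cls (Bw lo) `|` EA)) z -> (cls (Core hi) `|` (cls (Bw hi.+1) `|` FA)) y ->
  exists w, window_spec true lo hi G u w.
Proof.
move=> lo0 lohi GM td ez ey G0P EAP FAP EF GE GF zP yP.
have [C lC CP] := back_chain lohi.
have lF := ladder_fw ld lo0; have lB := ladder_bw ld lo0.
have lFh := ladder_fw ld (leq_trans lo0 (ltnW lohi)).
(* The left vertex receives the return chain [C] and is left from core [lo]; the right vertex is
   entered in core [hi] and left from [e hi]. [EA] and [FA] add the outermost forward links when the
   ear starts or ends on them. *)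
pose IL := [set b lo] `|` (cls (Fw lo) `|` C).
pose OL := cls (Core lo) `|` (cls (Bw lo) `|` EA).
pose IR := cls (Core hi) `|` (cls (Bw hi.+1) `|` FA).
pose OR := [set e hi] `|` cls (Fw hi.+1).
have EAc x : EA x -> cls (Fw lo.+1) x by case: EAP => ->.
have FAc x : FA x -> cls (Fw hi) x by case: FAP => ->.
have bL : branch D IL OL (b lo).
  apply: (branch_extend (strip_branch_b (ld_core ld lo))); [by left|by left| | |].
  - apply: (absorb_in (strip_branch_b (ld_core ld lo))) => // v [vF|vC].
      by apply: reach_mono (link_to lF vF) => t [?|->]; [left; left|right].
    by apply: reach_mono (link_to lC vC) => t [?|->]; [left; right|right].
  - apply: (absorb_out (strip_branch_b (ld_core ld lo)) (e_core lo)) => v [vF|vC].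
      by apply: reach_mono (link_from lB vF) => t [?|->]; [left; left|right].
    case: EAP vC => -> // vC.
    by apply: reach_mono (link_from (ld_fw ld lo) vC) => t [?|->]; [left; right|right].
  - move=> x [->|[xF|/CP[l xl lP]]] [xO|[xB|/EAc xE]] //.
    + by case: (ne xF xO).
    + by case: (ne xF xB).
    + by case: (ne xF xE) => -[]; lia.
    + by case: (ne xl xO) => el; subst l; move: lP => /=; rewrite ltnn.
    + by case: (ne xl xB) => el; subst l; move: lP => /=; rewrite ltnn.
    + by case: (ne xl xE) => el; subst l.
have bR : branch D IR OR (e hi).
  apply: (branch_extend (strip_branch_e (ld_core ld hi))); [by left|by left| | |].
  - apply: (absorb_in (strip_branch_e (ld_core ld hi)) (b_core hi)) => v [vF|vC].
      by apply: reach_mono (link_to (ld_bw ld hi) vF) => t [?|->]; [left; left|right].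
    case: FAP vC => -> // vC.
    by apply: reach_mono (link_to lFh vC) => t [?|->]; [left; right|right].
  - apply: (absorb_out (strip_branch_e (ld_core ld hi))) => // v vF.
    exact: link_from (ld_fw ld hi) vF.
  - move=> x [xC|[xB|/FAc xF]] [xe|xF'] //.
    + by case: (ne xC xF').
    + by rewrite xe in xB; case: (ne xB (e_core hi)).
    + by case: (ne xB xF').
    + by rewrite xe in xF; case: (ne xF (e_core hi)).
    + by case: (ne xF xF') => -[]; lia.
have clsL x : (IL `|` OL) x -> (exists2 l, cls l x &
    match l with Core n => lo <= n < hi | Bw n => lo <= n <= hi | Fw n => n = lo end) \/ EA x.
  case=> [[->|[xF|/CP[l xl lP]]]|[xC|[xB|xE]]].
  - by left; exists (Core lo) => //; rewrite leqnn.
  - by left; exists (Fw lo).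
  - by left; exists l => //; case: (l) lP => // n /andP[/ltnW->].
  - by left; exists (Core lo) => //; rewrite leqnn.
  - by left; exists (Bw lo) => //; rewrite leqnn ltnW.
  - by right.
have clsR x : (IR `|` OR) x -> (exists2 l, cls l x &
    match l with Core n => n = hi | Bw n => n = hi.+1 | Fw n => n = hi.+1 end) \/ FA x.
  case=> [[xC|[xB|xF]]|[->|xF]].
  - by left; exists (Core hi).
  - by left; exists (Bw hi.+1).
  - by right.
  - by left; exists (Core hi).
  - by left; exists (Fw hi.+1).
have G0n x l : G0 x -> cls l x -> exists2 n, l = Fw n & lo < n <= hi.
  move=> /G0P[xG|[n xn nb]] xl; first by case: (GM _ _ xG xl).
  by exists n => //; exact: (ld_uniq ld xl xn).
have tdG j x : j <= tdK d -> (tdI d j `|` tdO d j) x -> G0 x by move=> jk; exact: (td_sub td jk).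
have G0reg x : G0 x -> region lo hi G x.
  by move=> /G0P[xG|[n xn nb]]; [right|left; exists (Fw n) => //=; lia].
pose w := WindowData d (fun c => if c then IL else IR) (fun c => if c then OL else OR)
  (fun c => if c then b lo else e hi).
exists w; split=> //=.
- exact: (tendril_mono G0reg td).
- by have [x [xF|->] ex] := link_head lF; [exists x => //; right; left|exists (b lo) => //; left].
- by have [x [xF|->] ex] := link_tail lB; [exists x => //; right; left|exists (e lo) => //; left].
- by have [x [xF|->] ex] := link_head (ld_bw ld hi); [exists x => //; right; left|exists (b hi) => //; left].
- by have [x [xF|->] ex] := link_tail (ld_fw ld hi); [exists x => //; right|exists (e hi) => //; left].
- move=> _; split.
  + by case.
  + case=> x.
      move=> /clsL[[l xl lP]|/EAc xE].
        by left; exists l => //; case: (l) lP => n /=; lia.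
      by left; exists (Fw lo.+1) => //=; lia.
    move=> /clsR[[l xl lP]|/FAc xF].
      by left; exists l => //; case: (l) lP => n /=; lia.
    by left; exists (Fw hi) => //=; lia.
  + move=> c x j xc jk /(tdG _ _ jk) xG; case: c xc.
      move=> /clsL[[l xl lP]|xE]; last exact: GE xG xE.
      by have [n el nb] := G0n _ _ xG xl; subst l; move: lP nb => /= ->; rewrite ltnn.
    move=> /clsR[[l xl lP]|xF]; last exact: GF xG xF.
    by have [n el nb] := G0n _ _ xG xl; subst l; move: lP nb => /= ->; rewrite ltnn andbF.
  + move=> x /clsL[[l xl lP]|xE] /clsR[[l' xl' lP']|xF].
    * have el := ld_uniq ld xl xl'; subst l'; case: (l) lP lP' => n /=; lia.
    * have el := ld_uniq ld xl (FAc _ xF); subst l; move: lP => /= el; lia.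
    * have el := ld_uniq ld xl' (EAc _ xE); subst l'; move: lP' => /= el; lia.
    * exact: EF xE xF.
- by move=> _; exists z, (tdS d); split=> //; exact: td_in td.
- by move=> _; exists (tdT d), y; split=> //; exact: td_out td.
- move=> _; have [x [xC|->] ex] := link_head lC.
    by exists (e hi), x; split=> //; [left|right; right].
  by exists (e hi), (b lo); split=> //; left.
Qed.

End Windows.

(* [u] lies on the ladder, or on a path outside of it from a vertex of class
   [lz] to a vertex of class [ly]. *)
Definition ear (V : eqType) (D : digraph V) (cls : label -> set V) (G : set V) u lz ly :=
  (cls lz u /\ lz = ly) \/
  exists s t z y, [/\ cls lz z /\ cls ly y, dE D z s, dE D t y, reach D G s u & reach D G u t].

Lemma ear_rev (V : eqType) (D : digraph V) cls (G : set V) u lz ly : ear D cls G u lz ly ->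
  ear (rev_digraph D) (fun l => cls (flip l)) G u (flip ly) (flip lz).
Proof.
case=> [[zu e]|[s [t [z [y [[zl yl] zs ty su ut]]]]]]; first by left; rewrite flipK -e.
by right; exists t, s, y, z; rewrite !flipK; split=> //; exact: reach_rev.
Qed.

Section EarWindows.
Variables (V : eqType) (D : digraph V) (cls : label -> set V) (b e : nat -> V).
Hypothesis ld : ladder D cls b e.
Variables (G : set V) (u : V).
Hypothesis GM : forall x l, G x -> ~ cls l x.

Lemma ear_same l s0 t0 : strip D (cls l) s0 t0 -> ear D cls G u l l ->
  reach D (cls l `|` G) s0 u /\ reach D (cls l `|` G) u t0.
Proof.
move=> [_ _ r]; have mono x y : reach D (cls l) x y -> reach D (cls l `|` G) x y.
  by apply: reach_mono; left.
have monoG x y : reach D G x y -> reach D (cls l `|` G) x y by apply: reach_mono; right.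
case=> [[lu _]|[s [t [z [y [[zl yl] zs ty su ut]]]]]].
  by have [su ut] := r u lu; split; exact: mono.
have [sz _] := r z zl; have [_ yt] := r y yl; split.
  apply: (reach_trans (mono _ _ sz)); apply: (reach_cons _ zs (monoG _ _ su)); by left.
by apply: (reach_trans _ (mono _ _ yt)); apply: (reach_step (monoG _ _ ut) _ ty); left.
Qed.

(** If both ends have the same class, a forward link becomes the tendril of a triangle between its
    two cores, and a core gives a claw. Otherwise the core where the ear leaves is compared with the
    one where it returns: a claw if they agree, a triangle if the latter comes later. Indices above
    1 keep [lo] positive. *)
Lemma forward_window lz ly : ear D cls G u lz ly -> 1 < label_index lz -> 1 < label_index ly ->
  exit_index lz <= entry_index ly -> (lz = ly -> lz <> Bw (label_index lz)) ->
  exists tri lo hi w, [/\ window_spec D cls b e tri lo hi G u w, 0 < lo, lo <= hi, tri = false -> lo = hi &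
    label_index lz <= lo.+1 \/ label_index ly <= lo.+1].
Proof.
move=> eu lz1 ly1 le nB.
case: (pselect (lz = ly)) => [el|nl].
  subst ly; case: lz eu lz1 {ly1 le} nB => n eu /= n1 nB; last by case: nB.
  - case: n n1 eu {nB} => // n n1 eu.
    have lF := ld_fw ld n; case: (lF) => [[F0 _]|[s0 [t0 [es et sF]]]].
      have [u' Fu] : exists u', cls (Fw n.+1) u'.
        by case: eu => [[Fu _]|[_ [_ [z [_ [[zl _] _ _ _ _]]]]]]; [exists u|exists z].
      by rewrite F0 in Fu.
    have [su ut] := ear_same sF eu; have [d [td ds dt]] := tendril_data_exists su ut.
    have [_ e_n _] := ld_core ld n; have [b_n _ _] := ld_core ld n.+1.
    have [w wP] : exists w, window_spec D cls b e true n n.+1 G u w.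
      apply: (triangle_window ld (z := e n) (y := b n.+1) (EA := set0) (FA := set0) n1 _ GM td) => //.
      - by rewrite ds.
      - by rewrite dt.
      - by move=> x [xF|xG]; [right; exists n.+1 => //; rewrite !ltnSn|left].
      - by left.
      - by left.
      - by move=> x _ [].
      - by move=> x _ [].
      - by left.
      - by left.
    by exists true, n, n.+1, w; split=> //; left.
  - have sC := ld_core ld n; have [su ut] := ear_same sC eu.
    have [d [td ds dt]] := tendril_data_exists su ut.
    have n0 : 0 < n by exact: ltnW.
    have [w wP] := claw_core ld n0 GM td ds dt.
    by exists false, n, n, w; split=> //; left.
case: eu => [[_ e0]|[s [t [z [y [[zl yl] zs ty su ut]]]]]]; first by case: nl.
have [d [td ds dt]] := tendril_data_exists su ut.
rewrite -ds in zs; rewrite -dt in ty.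
have a0 : 0 < exit_index lz by case: (lz) lz1 => n /=; lia.
have lzb : label_index lz <= (exit_index lz).+1 by case: (lz) lz1 => n /=; lia.
move: le; rewrite leq_eqVlt => /orP[/eqP eab|lt].
  have [||w wP] := claw_ear ld a0 GM td zl yl zs ty nl _ _ erefl (esym eab); try exact: ltnW.
  by exists false, (exit_index lz), (exit_index lz), w; split=> //; left.
(* Only an end on a forward link needs an additional piece; ends on cores and backward links are
   covered by the triangle vertices already. *)
pose EA := if lz is Fw n then cls (Fw n) else set0.
pose FA := if ly is Fw n then cls (Fw n) else set0.
have [w wP] : exists w, window_spec D cls b e true (exit_index lz) (entry_index ly) G u w.
  apply: (triangle_window ld (z := z) (y := y) (G0 := G) (EA := EA) (FA := FA) a0 lt GM td) => //.
  - by move=> x; left.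
  - by rewrite /EA; case: (lz) lz1 => [[|n]|n|n] //= _; [right|left|left].
  - by rewrite /FA; case: (ly) ly1 => [n|n|n] //= _; [right|left|left].
  - move=> x; rewrite /EA /FA; case: (lz) nl => // n nl xE; case: (ly) nl => n' nl xF; [|by case: xF|by case: xF].
    by apply: nl; exact: (ld_uniq ld xE xF).
  - by move=> x xG; rewrite /EA; case: (lz) => n; [exact: GM|by []|by []].
  - by move=> x xG; rewrite /FA; case: (ly) => n; [exact: GM|by []|by []].
  - rewrite /EA; case: (lz) zl lz1 => [[|n]|n|n] //= zl _; [by right; right|by left|by right; left].
  - rewrite /FA; case: (ly) yl ly1 => [n|n|[|n]] //= yl _; [by right; right|by left|by right; left].
exists true, (exit_index lz), (entry_index ly), w; split=> //; last by left.
exact: ltnW.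
Qed.

End EarWindows.

(** Flipping labels exchanges [exit_index] and [entry_index], so every ear leads forwards in the
    ladder or in its reversal; an ear with both ends in one [Bw] becomes one on a [Fw]. *)
Lemma window_exists (V : eqType) (D : digraph V) cls b e (G : set V) u lz ly :
  ladder D cls b e -> (forall x l, G x -> ~ cls l x) -> ear D cls G u lz ly ->
  1 < label_index lz -> 1 < label_index ly ->
  exists tri lo hi w, [/\ window_spec D cls b e tri lo hi G u w \/
      window_spec (rev_digraph D) (fun l => cls (flip l)) e b tri lo hi G u w,
    0 < lo, lo <= hi, tri = false -> lo = hi & label_index lz <= lo.+1 \/ label_index ly <= lo.+1].
Proof.
move=> ld GM eu lz1 ly1.
case: (pselect (exit_index lz <= entry_index ly /\ (lz = ly -> lz <> Bw (label_index lz)))) => [[le nB]|no].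
  have [tri [lo [hi [w [wP lo0 lohi tl lb]]]]] := forward_window ld GM eu lz1 ly1 le nB.
  by exists tri, lo, hi, w; split=> //; left.
have [||||tri [lo [hi [w [wP lo0 lohi tl lb]]]]] :=
  @forward_window _ _ _ _ _ (ladder_rev ld) G u (fun x l => GM x (flip l)) _ _ (ear_rev eu).
- by rewrite flip_index.
- by rewrite flip_index.
- have e1 l : exit_index (flip l) = entry_index l by case: l.
  have e2 l : entry_index (flip l) = exit_index l by case: l.
  rewrite e1 e2; rewrite leqNgt; apply/negP => lt; apply: no; split; first exact: ltnW.
  by move=> el; subst ly => lB; move: lt; rewrite lB /=; lia.
- move=> el; have el' : ly = lz by rewrite -(flipK ly) el flipK.
  subst ly; rewrite flip_index => lB; apply: no.
  by move: lB; case: (lz) => n //= _; split=> //; exact: leq_pred.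
rewrite !flip_index in lb.
exists tri, lo, hi, w; split=> //; [by right|by case: lb; [right|left]].
Qed.

(** * Assembling a comb along the ladder *)

Section CombAssembly.
Variables (V : eqType) (D : digraph V) (cls : label -> set V) (b e : nat -> V).
Hypothesis ld : ladder D cls b e.
Variables (U : set V) (tri : bool) (lo hi : nat -> nat) (G : nat -> set V) (u : nat -> V).
Variable w : nat -> window_data V.
Hypothesis wP : forall k, window_spec D cls b e tri (lo k) (hi k) (G k) (u k) (w k).
Hypothesis lo_pos : 0 < lo 0.
Hypothesis lo_hi : forall k, lo k <= hi k.
Hypothesis gap : forall k, (hi k).+1 < lo k.+1.
Hypothesis GM : forall k x l, G k x -> ~ cls l x.
Hypothesis Gdis : forall k l x, G k x -> G l x -> k = l.
Hypothesis uU : forall k, U (u k).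

Let gap_lt k l : k < l -> (hi k).+1 < lo l.
Proof.
elim: l => // l IHl; rewrite ltnS leq_eqVlt => /orP[/eqP->|/IHl lt]; first exact: gap.
by apply: (ltn_trans lt); apply: (leq_ltn_trans (lo_hi l)); apply: ltnW; exact: gap.
Qed.

Let lo_inj k l : lo k = lo l -> k = l.
Proof.
move=> el; case: (ltngtP k l) => // /gap_lt; rewrite ?el -?el => lt.
  by have := lo_hi k; rewrite el; lia.
by have := lo_hi l; rewrite -el; lia.
Qed.

(* The ladder is cut into consecutive intervals [st n, st n.+1): the windows
   and single positions between them. *)
Let isw j := exists k, j = lo k.
Let nxt kof j := if `[<isw j>] then (hi (kof j : nat)).+1 else j.+1.

(** Windows become the sites of the comb and the cores outside of them its remaining spine vertices.
    The point is to give every link to exactly one of these intervals. *)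
Lemma comb_assembly : realizes shaped_by_comb D U.
Proof.
have [kof kofP] : exists kof, forall j, isw j -> j = lo (kof j).
  apply: (@exists_choice _ _ (fun j k => isw j -> j = lo k)) => j.
  by case: (pselect (isw j)) => [[k ->]|]; [exists k|exists 0].
pose st n := iter n (nxt kof) 0.
pose win n := `[<isw (st n)>].
pose kk n := kof (st n).
have st_win n : win n -> st n = lo (kk n) by move=> /asboolP; exact: kofP.
have nxtS n : st n.+1 = if win n then (hi (kk n)).+1 else (st n).+1 by [].
have st_lt n : st n < st n.+1.
  rewrite nxtS; case: ifP => // /st_win ->; rewrite ltnS; exact: lo_hi.
have st_mono m n : m < n -> st m.+1 <= st n := incr_leq st_lt.
have st_inj m n : st m = st n -> m = n.
  move=> em; case: (ltngtP m n) => // /st_mono le.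
    by have := st_lt m; rewrite em ltnNge le.
  by have := st_lt n; rewrite -em ltnNge le.
(* An interval may start at the left end of a window but nowhere else in it; so no window is
   skipped. *)
have inv n k : ~~ (lo k < st n <= hi k).
  elim: n k => [|n IHn] k; first by rewrite ltn0.
  rewrite nxtS; case: ifP => [/st_win en|nw].
    apply/negP => /andP[h1 h2]; case: (ltngtP k (kk n)) => [/gap_lt lt|/gap_lt lt|ek].
    - by have := lo_hi (kk n); lia.
    - lia.
    - by rewrite ek ltnn in h2.
  apply/negP => /andP[h1 h2]; have := IHn k; rewrite (ltnW h2) andbT -leqNgt => le.
  have ek : st n = lo k by apply/eqP; rewrite eqn_leq le.
  by move/asboolP: nw => []; exists k.
have hit k : exists n, st n = lo k.
  have stn n : n <= st n by elim: n => // n IHn; apply: leq_ltn_trans (st_lt n).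
  have ex : exists n, st n <= lo k by exists 0.
  have bd n : st n <= lo k -> n <= lo k by exact: leq_trans.
  case: (ex_maxnP ex bd) => n le nmax; exists n.
  apply/eqP; rewrite eqn_leq le leqNgt; apply/negP => lt.
  have : lo k < st n.+1 by rewrite ltnNge; apply/negP => /nmax; rewrite ltnn.
  rewrite nxtS; case: ifP => [/st_win en|_]; last by rewrite ltnS leqNgt lt.
  rewrite ltnS => le'; case: (ltngtP k (kk n)) => [/gap_lt lt'|/gap_lt lt'|ek].
  - by have := lo_hi k; rewrite en in lt; lia.
  - lia.
  - by rewrite en ek ltnn in lt.
have [phi phiP] := exists_choice hit.
have phi_inj : injective phi by move=> k l ek; apply: lo_inj; rewrite -!phiP ek.
have lo0 k : 0 < lo k by case: k => // k; apply: leq_ltn_trans (gap k).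
have phi_pos k : 0 < phi k by rewrite lt0n; apply/eqP => ek; have := phiP k; have := lo0 k; rewrite ek /=; lia.
have win_phi k : win (phi k) by apply/asboolP; exists k; exact: phiP.
have kk_phi k : kk (phi k) = k by apply: lo_inj; rewrite -st_win.
have win_site n : `[<site phi n>] = win n.
  apply/asboolP/idP => [[k ->]//|wn]; exists (kk n); apply: st_inj; rewrite phiP; exact: st_win.
have no_adj n : win n -> ~~ win n.+1.
  move=> wn; apply/negP => wn'; have := st_win _ wn'; rewrite nxtS wn => ek.
  case: (ltngtP (kk n) (kk n.+1)) => [/gap_lt|/gap_lt|ek'].
  - by rewrite ek ltnn.
  - by have := lo_hi (kk n); have := lo_hi (kk n.+1); lia.
  - by have := lo_hi (kk n.+1); rewrite -ek ek' ltnn.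
have win0 : ~~ win 0 by apply/negP => /st_win /= e0; have := lo0 (kk 0); rewrite -e0.
(* A single position takes the links on its left, unless the previous interval is a window, which
   owns them already. *)
pose la n := (0 < n) && ~~ win n.-1.
pose IP n := [set b (st n)] `|` (if la n then cls (Fw (st n)) else set0).
pose OP n := cls (Core (st n)) `|` (if la n then cls (Bw (st n)) else set0).
have laS n : la n.+1 = ~~ win n by [].
have la_st n : la n -> ~~ win n -> exists2 m, st n = (st m).+1 & n = m.+1.
  by case: n => // n; rewrite laS nxtS => /negPf-> _; exists n.
have b_core n : cls (Core n) (b n) by have [] := ld_core ld n.
have e_core n : cls (Core n) (e n) by have [] := ld_core ld n.
have brP n : ~~ win n -> branch D (IP n) (OP n) (b (st n)).
  move=> nw; have br := strip_branch_b (ld_core ld (st n)).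
  rewrite /IP /OP; case: ifP => [lan|_]; last by rewrite !setU0.
  have [m em _] := la_st _ lan nw; rewrite !em in br *.
  apply: (branch_extend br); [by left|by left| | |].
  - by apply: (absorb_in br) => // z zF; exact: link_to (ld_fw ld (st m)) zF.
  - by apply: (absorb_out br (e_core _)) => z zF; exact: link_from (ld_bw ld (st m)) zF.
  - move=> x [->|xF] [xC|xB] //.
    + by have := ld_uniq ld xF xC.
    + by have := ld_uniq ld xF xB.
pose owns n l := if win n then in_window (lo (kk n)) (hi (kk n)) l else
  match l with Core i => i == st n | Fw i | Bw i => la n && (i == st n) end.
(* The classes of [m] have index at most [st m.+1], with equality only for links of a window; those
   of [n] have index at least [st n]. In the critical case [n] directly follows the window [m], so
   it is a single position without links. *)
have own_lt m n l : m < n -> owns m l -> owns n l -> False.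
  move=> mn; have le := st_mono _ _ mn; rewrite /owns.
  have bn : owns n l -> st n <= label_index l.
    by rewrite /owns; case: ifP => [/st_win->|_]; case: (l) => i /=; do ?[by case/andP]; try (by move=> /eqP->); move=> /andP[_ /eqP->].
  have bm : owns m l -> label_index l <= st m.+1 /\ (win m \/ label_index l < st m.+1).
    rewrite /owns nxtS; case: ifP => [wm|_]; last first.
      by case: (l) => i /=; [move=> /andP[_ /eqP->]|move=> /eqP->|move=> /andP[_ /eqP->]]; split=> //; right.
    case: (l) => i /= /andP[_ il]; split=> //; try (by left); exact: leqW.
  have cm : owns m l -> forall i, l = Core i -> i < st m.+1.
    rewrite /owns nxtS; case: ifP => [wm|_] + i el; rewrite el /=; first by case/andP.
    by move=> /eqP->.
  rewrite -/(owns m l) -/(owns n l) => om on.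
  have [b1 b2] := bm om; have b3 := bn on.
  have eq1 : label_index l = st n by apply/eqP; rewrite eqn_leq b3 andbT (leq_trans b1).
  have eq2 : st n = st m.+1 by apply/eqP; rewrite eqn_leq le andbT -eq1.
  have en := st_inj _ _ eq2.
  case: b2 => [wm|]; last by rewrite eq1 eq2 ltnn.
  case el: l => [i|i|i]; last 1 first.
  - by move: on; rewrite en /owns (negPf (no_adj _ wm)) el laS wm.
  - by move: on; rewrite en /owns (negPf (no_adj _ wm)) el laS wm.
  - by have := cm om i el; move: eq1; rewrite el /= eq2 => ->; rewrite ltnn.
have own_inj m n l : owns m l -> owns n l -> m = n.
  by move=> om on; case: (ltngtP m n) => // /own_lt h; case: (h l).
pose Reg n := if win n then region cls (lo (kk n)) (hi (kk n)) (G (kk n)) else [set x | exists2 l, owns n l & cls l x].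
have RegP n x : Reg n x -> (exists2 l, owns n l & cls l x) \/ (win n /\ G (kk n) x).
  rewrite /Reg; case: ifP => wn; last by left.
  by case=> [[l ol xl]|xG]; [left; exists l => //; rewrite /owns wn|right].
have Regdis m n x : Reg m x -> Reg n x -> m = n.
  move=> /RegP[[l ol xl]|[wm xG]] /RegP[[l' ol' xl']|[wn xG']].
  - by have el := ld_uniq ld xl xl'; subst l'; exact: own_inj ol ol'.
  - by case: (GM xG' xl).
  - by case: (GM xG xl').
  - by apply: st_inj; rewrite !st_win // (Gdis xG xG').
have PReg n x : ~~ win n -> (IP n `|` OP n) x -> Reg n x.
  move=> nw; have ow l : owns n l = match l with Core i => i == st n | Fw i | Bw i => la n && (i == st n) end.
    by rewrite /owns (negPf nw).
  rewrite /Reg (negPf nw) /IP /OP; case=> [[->|]|[xC|]].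
  - by exists (Core (st n)); rewrite ?ow ?eqxx.
  - by case: ifP => // lan xF; exists (Fw (st n)) => //; rewrite ow lan eqxx.
  - by exists (Core (st n)); rewrite ?ow ?eqxx.
  - by case: ifP => // lan xF; exists (Bw (st n)) => //; rewrite ow lan eqxx.
pose dn n := if win n then wT (w (kk n)) else
  TendrilData (b (st n)) (e (st n)) 0 (fun _ => IP n) (fun _ => OP n) (fun _ => b (st n)).
pose un n := if win n then u (kk n) else b (st n).
have td n : tendril D (Reg n) (tdS (dn n)) (tdT (dn n)) (un n) (tdK (dn n)) (tdI (dn n)) (tdO (dn n)) (tdR (dn n)).
  rewrite /dn /un; case: ifP => [wn|/negbT nw].
    by have := ws_td (wP (kk n)); rewrite /Reg wn.
  split=> //=.
  - by move=> j _; exact: brP.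
  - by move=> j x _; exact: PReg.
  - by move=> x [|i] [|j].
  - by left.
  - by left; exact: e_core.
pose PI n c := if win n then wI (w (kk n)) c else IP n.
pose PO n c := if win n then wO (w (kk n)) c else OP n.
have fwd n : exists x y, [/\ PO n false x, PI n.+1 true y & dE D x y].
  rewrite /PI /PO; case: (boolP (win n)) => [wn|nw].
    rewrite (negPf (no_adj _ wn)); have [x Ox ex] := ws_or (wP (kk n)).
    by exists x, (b (st n.+1)); split=> //; [left|rewrite nxtS wn].
  have eS : st n.+1 = (st n).+1 by rewrite nxtS (negPf nw).
  case: (boolP (win n.+1)) => [wn'|nw'].
    have [y Iy ey] := ws_il (wP (kk n.+1)); exists (e (st n)), y; split=> //; first by left; exact: e_core.
    by rewrite -(st_win _ wn') eS in ey.
  have [z zP ez] := link_head (ld_fw ld (st n)).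
  exists (e (st n)), z; split=> //; first by left; exact: e_core.
  by rewrite /IP laS nw eS; case: zP => [zF|->]; [right|left].
have bwd n : exists x y, [/\ PO n.+1 true x, PI n false y & dE D x y].
  rewrite /PI /PO; case: (boolP (win n)) => [wn|nw].
    rewrite (negPf (no_adj _ wn)); have [y Iy ey] := ws_ir (wP (kk n)).
    by exists (e (st n.+1)), y; split=> //; [left; exact: e_core|rewrite nxtS wn].
  have eS : st n.+1 = (st n).+1 by rewrite nxtS (negPf nw).
  case: (boolP (win n.+1)) => [wn'|nw'].
    have [x Ox ex] := ws_ol (wP (kk n.+1)); exists x, (b (st n)); split=> //; first by left.
    by rewrite -(st_win _ wn') eS in ex.
  have [z zP ez] := link_tail (ld_bw ld (st n)).
  exists z, (b (st n)); split=> //; last by left.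
  by rewrite /OP laS nw eS; case: zP => [zF|->]; [right|left; exact: e_core].
have unU k : U (un (phi k)) by rewrite /un win_phi kk_phi.
case etri: tri wP => wP'.
- have wtri n : win n -> _ := fun _ => ws_tri (wP' (kk n)) isT.
  apply: (@triangle_comb_realizes V D U (fun n => tdK (dn n)) phi Reg (fun n => tdS (dn n)) (fun n => tdT (dn n)) un
    (fun n => tdI (dn n)) (fun n => tdO (dn n)) (fun n => tdR (dn n)) (fun n => wI (w (kk n)))
    (fun n => wO (w (kk n))) (fun n => wR (w (kk n))) td Regdis [set n | win n]) => //.
  + by move=> n c wn; have [h _ _ _] := wtri n wn; exact: h.
  + by move=> n c x wn xc; have [_ h _ _] := wtri n wn; rewrite /Reg wn; exact: h xc.
  + by move=> n c x j wn; rewrite /dn wn; have [_ _ h _] := wtri n wn; exact: h.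
  + by move=> n x wn; have [_ _ _ h] := wtri n wn; exact: h.
  + by move=> k; have := ws_lq (wP' k) isT; rewrite /dn win_phi kk_phi.
  + by move=> k; have := ws_qr (wP' k) isT; rewrite /dn win_phi kk_phi.
  + by move=> k; have := ws_rl (wP' k) isT; rewrite kk_phi.
  + move=> n; have := fwd n; rewrite /PI /PO !win_site /dn; case: ifP; case: ifP => //.
  + move=> n; have := bwd n; rewrite /PI /PO !win_site /dn; case: ifP; case: ifP => //.
- have PIE n c : PI n c = tdI (dn n) 0.
    by rewrite /PI /dn; case: ifP => // _; have [] := ws_claw (wP' (kk n)) isT c.
  have POE n c : PO n c = tdO (dn n) 0.
    by rewrite /PO /dn; case: ifP => // _; have [] := ws_claw (wP' (kk n)) isT c.
  apply: (@comb_realizes (fun n => tdK (dn n)) phi phi_inj V D U Reg (fun n => tdS (dn n)) (fun n => tdT (dn n)) un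
    (fun n => tdI (dn n)) (fun n => tdO (dn n)) (fun n => tdR (dn n)) td Regdis unU).
  + by move=> n; have := fwd n; rewrite PIE POE.
  + by move=> n; have := bwd n; rewrite PIE POE.
Qed.

End CombAssembly.

Lemma ray_strip (V : Type) (D : digraph V) (R : nat -> V) x y : (forall l, dE D (R l) (R l.+1)) -> x <= y ->
  strip D [set R l | l in [set l | x <= l <= y]] (R x) (R y).
Proof.
move=> RE xy; split; [by exists x; rewrite //= leqnn|by exists y; rewrite //= leqnn andbT|].
move=> _ [l /= /andP[xl ly] <-]; split; apply: ray_reach => // i /andP[i1 i2]; exists i => //=.
  by rewrite i1 (leq_trans i2).
by rewrite i2 andbT (leq_trans xl).
Qed.

Lemma ray_link (V : Type) (D : digraph V) (R : nat -> V) x y : (forall l, dE D (R l) (R l.+1)) -> x < y ->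
  link D (R x) [set R l | l in [set l | x < l < y]] (R y).
Proof.
move=> RE; rewrite leq_eqVlt => /orP[/eqP<-|xy].
  left; split=> //; apply/seteqP; split=> // _ [l /= lb _].
  by move: lb; rewrite ltnS; case: (ltnP x l) => //= lt; rewrite leqNgt lt.
right; exists (R x.+1), (R y.-1); have y0 : y = y.-1.+1 by rewrite prednK // (leq_trans _ xy).
split=> //; first by rewrite {2}y0.
have := @ray_strip V D R x.+1 y.-1 RE; rewrite -ltnS -y0 => /(_ xy).
congr (strip D _ _ _); apply/seteqP; split=> _ [l /= lb <-]; exists l => //=; move: lb; rewrite -[l <= y.-1]ltnS -y0 //.
Qed.

(** * Cutting two rays that meet infinitely often into a ladder *)

Section LadderOfRays.
Variables (V : eqType) (D : digraph V) (R S : nat -> V).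
Hypothesis Rray : ray_along D R.
Hypothesis Sray : ray_along (rev_digraph D) S.
Hypothesis meet : infinite_set [set i | exists j, R i = S j].

(* One step of the ladder beyond [R s] and [S t]: the core runs along [R] from
   [R j' = S i'] to [R j = S i]. *)
Let stepP (x : nat * nat) (y : (nat * nat) * (nat * nat)) :=
  let: (s, t) := x in let: ((i, j), (i', j')) := y in
  [/\ [/\ t <= i, s <= j, S i = R j & forall i0 j0, t <= i0 < i -> s <= j0 -> S i0 <> R j0],
      i <= i', s <= j' <= j, S i' = R j' & forall i0 j0, i' < i0 -> s <= j0 <= j -> S i0 <> R j0].

(** [i] is the first index of [S] from [t] on that lies on [R] from [s] on, and [i'] is the last
    index of [S] on the finite piece [R s, ..., R j]. Only finitely many meetings involve the parts
    before [s] and [t], so [i] exists. *)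
Let step_exists x : exists y, stepP x y.
Proof.
case: x => s t; have [Rinj _] := Rray; have [Sinj _] := Sray.
have ex : exists i, (t <= i) && `[<exists2 j, s <= j & S i = R j>].
  have fin : finite_set ([set i | i < s] `|` [set i | exists2 j, R i = S j & j < t]).
    rewrite finite_setU; split; first exact: finite_II.
    apply: (@sub_finite_set _ _ (\bigcup_(j in `I_t) [set i | R i = S j])).
      by move=> i [j e jt]; exists j.
    apply: bigcup_finite; first exact: finite_II.
    by move=> j _; apply: finite_at_most_one => i i' /= <- /Rinj.
  have [i [[j e] no]] := infinite_setN0 (infinite_setD meet fin).
  exists j; apply/andP; split.
    by rewrite leqNgt; apply/negP => jt; apply: no; right; exists j.
  apply: asboolT; exists i => //.
  by rewrite leqNgt; apply/negP => it; apply: no; left.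
case: (ex_minnP ex) => i /andP[ti /asboolP[j sj e]] imin.
have [n nP] := @ray_bound V S [seq R l | l <- iota s (j - s).+1] Sinj.
pose Q i' := `[<exists2 j', s <= j' <= j & S i' = R j'>].
have exQ : exists i', Q i' by exists i; apply: asboolT; exists j; rewrite ?sj ?leqnn.
have bdQ i' : Q i' -> i' <= n.
  move=> /asboolP[j' jb e']; apply: nP; apply/mapP; exists j' => //; rewrite mem_iota; move: jb; lia.
case: (ex_maxnP exQ bdQ) => i' /asboolP[j' jb e'] imax.
exists ((i, j), (i', j')); split=> //; first split=> //.
- move=> i0 j0 /andP[ti0 i0i] sj0 e0; have := imin i0; rewrite ti0 asboolT; last by exists j0.
  by move=> /(_ isT); rewrite leqNgt i0i.
- by apply: imax; apply: asboolT; exists j; rewrite ?sj ?leqnn.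
- move=> i0 j0 i'0 jb0 e0; have : i0 <= i' by apply: imax; apply: asboolT; exists j0.
  by rewrite leqNgt i'0.
Qed.

Lemma ladder_of_rays : exists cls b e (ii : nat -> nat),
  [/\ ladder D cls b e, forall i, exists l, cls l (R i), forall n, e n = S (ii n) & forall n, n <= ii n].
Proof.
have [Rinj RE] := Rray; have [Sinj SE] := Sray.
have [f fP] := exists_choice step_exists.
pose x n := iter n (fun x => ((f x).1.2.+1, (f x).2.1.+1)) (0, 0).
pose s n := (x n).1; pose t n := (x n).2.
pose i n := (f (x n)).1.1; pose j n := (f (x n)).1.2.
pose i' n := (f (x n)).2.1; pose j' n := (f (x n)).2.2.
have P n : [/\ [/\ t n <= i n, s n <= j n, S (i n) = R (j n) & forall i0 j0, t n <= i0 < i n -> s n <= j0 -> S i0 <> R j0],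
      i n <= i' n, s n <= j' n <= j n, S (i' n) = R (j' n) & forall i0 j0, i' n < i0 -> s n <= j0 <= j n -> S i0 <> R j0].
  have := fP (x n); rewrite /i /j /i' /j' /s /t /stepP.
  by case: (x n) => ? ?; case: (f _) => [[? ?] [? ?]].
have sS n : s n.+1 = (j n).+1 by [].
have tS n : t n.+1 = (i' n).+1 by [].
have ti n : t n <= i n by have [[]] := P n.
have sj n : s n <= j n by have [[]] := P n.
have e1 n : S (i n) = R (j n) by have [[]] := P n.
have minP n i0 j0 : t n <= i0 < i n -> s n <= j0 -> S i0 <> R j0 by have [[_ _ _ h] _ _ _ _] := P n; exact: h.
have ii' n : i n <= i' n by have [] := P n.
have sj' n : s n <= j' n by have [_ _ /andP[]] := P n.
have j'j n : j' n <= j n by have [_ _ /andP[]] := P n.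
have e2 n : S (i' n) = R (j' n) by have [] := P n.
have maxP n i0 j0 : i' n < i0 -> s n <= j0 <= j n -> S i0 <> R j0 by have [_ _ _ _ h] := P n; exact: h.
have s_incr n : s n < s n.+1 by rewrite sS ltnS.
have t_incr n : t n < t n.+1 by rewrite tS ltnS; apply: leq_trans (ti n) (ii' n).
have s_mono m n : m <= n -> s m <= s n.
  by rewrite leq_eqVlt => /orP[/eqP->//|/(incr_leq s_incr)]; exact: leq_trans (ltnW (s_incr m)).
have idle (F : nat -> nat) : (forall n, F n < F n.+1) -> forall n, n <= F n.
  by move=> FF; elim=> // n IHn; exact: leq_ltn_trans (FF n).
have sn := idle _ s_incr; have tn := idle _ t_incr.
pose cls l := match l with
  | Fw n => [set R k | k in [set k | s n <= k < j' n]]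
  | Core n => [set R k | k in [set k | j' n <= k <= j n]]
  | Bw n => [set S k | k in [set k | t n <= k < i n]] end.
have onR l y : cls l y -> (exists k, [/\ y = R k, s (label_index l) <= k <= j (label_index l) &
    l = if k < j' (label_index l) then Fw (label_index l) else Core (label_index l)]) \/
    (exists2 k, y = S k & t (label_index l) <= k < i (label_index l) /\ l = Bw (label_index l)).
  case: l => n [k /= /andP[k1 k2] <-]; [left|left|right]; exists k; rewrite ?k1 ?k2 //.
    by split=> //; apply: ltnW; apply: leq_trans k2 (j'j n).
  by split=> //; [rewrite andbT; apply: leq_trans (sj' n) k1|rewrite ltnNge k1].
(* The backward stretches avoid [R]: the minimality of [i l] excludes [R] from [s l] on, and for
   earlier pieces the maximality of [i' m] applies. *)
have RB k m l : s m <= k <= j m -> t l <= i l -> forall y, t l <= y < i l -> S y <> R k.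
  move=> /andP[k1 k2] _ y /andP[y1 y2]; case: (leqP l m) => [lm|ml].
    by apply: (minP l); rewrite ?y1 // (leq_trans (s_mono _ _ lm)).
  by apply: (maxP m); rewrite ?k1 // -tS (leq_trans (incr_leq t_incr ml)).
exists cls, (fun n => R (j' n)), (fun n => R (j n)), i; split.
- split.
  + move=> y l l' /onR[[k [ek kb el]]|[k ek [kb el]]] /onR[[k' [ek' kb' el']]|[k' ek' [kb' el']]].
    * have e0 : k = k' by apply: Rinj; rewrite -ek.
      subst k'; have en : label_index l = label_index l' by apply: (incr_interval (i := k) s_incr).
      by rewrite el el' en.
    * by case: (RB _ _ (label_index l') kb (ti _) k' kb'); rewrite -ek -ek'.
    * by case: (RB _ _ (label_index l) kb' (ti _) k kb); rewrite -ek -ek'.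
    * have e0 : k = k' by apply: Sinj; rewrite -ek.
      subst k'; rewrite el el'; congr Bw; apply: (incr_interval (i := k) t_incr); rewrite tS ltnS.
      - by case/andP: kb => -> /ltnW h; apply: leq_trans h (ii' _).
      - by case/andP: kb' => -> /ltnW h; apply: leq_trans h (ii' _).
  + by move=> n; exact: ray_strip.
  + by move=> n; exact: (@ray_link _ D R (j n) (j' n.+1) RE (sj' n.+1)).
  + move=> n; have lt : i' n < i n.+1 := ti n.+1.
    have := link_rev (@ray_link _ _ S _ _ SE lt).
    by rewrite rev_digraphK e1 e2.
  + case=> n; apply: finite_image; [apply: sub_finite_set (finite_II (j' n))|apply: sub_finite_set (finite_II (j n).+1)|
      apply: sub_finite_set (finite_II (i n))]; move=> k /= /andP[_ //].
- move=> k; have ex : exists n, s n <= k by exists 0.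
  have bd n : s n <= k -> n <= k by apply: leq_trans.
  case: (ex_maxnP ex bd) => n le nmax.
  have kj : k <= j n by rewrite -ltnS -sS ltnNge; apply/negP => /nmax; rewrite ltnn.
  case: (ltnP k (j' n)) => [lt|ge]; first by exists (Fw n); exists k => //=; rewrite le.
  by exists (Core n); exists k => //=; rewrite ge.
- by move=> n; rewrite e1.
- by move=> n; exact: leq_trans (tn n) (ti n).
Qed.

End LadderOfRays.

Lemma last_in_set (V : eqType) (E : digraph V) (M : set V) x p : path (darc E) x p -> M x ->
  exists (z : V) (q : seq V), [/\ M z, z \in x :: p, {subset q <= p}, forall v, v \in q -> ~ M v &
    path (darc E) z q /\ last z q = last x p].
Proof.
move=> px Mx.
have [|p1 [z [q [e /asboolP Mz nq]]]] := @last_hit _ (fun v => `[<M v>]) (x :: p).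
  by rewrite /= asboolT.
exists z, q; split=> //.
- by rewrite e mem_cat mem_head orbT.
- by case: p1 e => [|y p1] [_ ->] v vq //; rewrite mem_cat in_cons vq !orbT.
- by move=> v vq Mv; case/hasP: nq; exists v => //; exact: asboolT.
- split; last by rewrite -[last x p]/(last x (x :: p)) e last_cat.
  have : sorted (darc E) (x :: p) by [].
  by rewrite e => /cat_sorted2[].
Qed.

(** * The rays meet infinitely often: combs *)

Section CombCase.
Variables (V : eqType) (D : digraph V) (U : set V).
Variables (R S : nat -> V) (st ts : V -> V) (P Q : V -> seq V).
Hypothesis U_inf : infinite_set U.
Hypothesis fR : fan D U R st P.
Hypothesis fS : fan (rev_digraph D) U S ts Q.
Hypothesis Rray : ray_along D R.
Hypothesis Sray : ray_along (rev_digraph D) S.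
Variables (cls : label -> set V) (b e : nat -> V) (ii : nat -> nat).
Hypothesis ld : ladder D cls b e.
Hypothesis R_on : forall i, exists l, cls l (R i).
Hypothesis e_S : forall n, e n = S (ii n).
Hypothesis ii_ge : forall n, n <= ii n.

Let M : set V := [set x | exists l, cls l x].

(* The reversed path [S k, ..., ts u, Q u] from the ladder to [u]. *)
Lemma back_paths : exists B : V -> seq V, (forall v, finite_set [set u | U u /\ v \in B u]) /\
  finite_set [set u | U u /\ ~ exists x p, [/\ B u = x :: p, M x, path (darc (rev_digraph D)) x p & last x p = u]].
Proof.
have [Sinj SE] := Sray.
have [mu muP] : exists mu : V -> nat, forall u, U u -> ts u = S (mu u).
  apply: (@exists_choice _ _ (fun u m => U u -> ts u = S m)) => u.
  by case: (pselect (U u)) => [/(fan_start fS)[m em]|]; [exists m|exists 0].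
have few n : finite_set [set u | U u /\ mu u < n].
  apply: sub_finite_set (fan_tail fS n) => u [Uu lt]; split=> // -[i ni].
  by rewrite (muP u Uu) => /Sinj ei; rewrite -ei leqNgt lt in ni.
(* [S (ii (nu u))] is the last core end on [S] that does not come after [ts u]. The path is
   prolonged to it because [ts u] itself need not lie on the ladder. *)
have [nu nuP] : exists nu : V -> nat, forall u, ii 0 <= mu u ->
    ii (nu u) <= mu u /\ forall n, ii n <= mu u -> n <= nu u.
  apply: (@exists_choice _ _ (fun u n => ii 0 <= mu u -> ii n <= mu u /\ forall n', ii n' <= mu u -> n' <= n)) => u.
  case: (pselect (ii 0 <= mu u)) => [h|]; last by exists 0.
  have ex : exists n, ii n <= mu u by exists 0.
  have bd n : ii n <= mu u -> n <= mu u by apply: leq_trans.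
  by case: (ex_maxnP ex bd) => n le nmax; exists n.
pose seg u := [seq S l | l <- iota (ii (nu u)).+1 (mu u - ii (nu u))].
exists (fun u => S (ii (nu u)) :: seg u ++ Q u); split.
  move=> v; apply: (@sub_finite_set _ _ ([set u | U u /\ v \in Q u] `|`
      [set u | U u /\ v \in S (ii (nu u)) :: seg u])).
    by move=> u [Uu]; rewrite -cat_cons mem_cat => /orP[]; [right|left].
  rewrite finite_setU; split; first exact: fan_escape fS v.
  case: (pselect (exists l, v = S l)) => [[l ->]|no]; last first.
    apply: sub_finite_set (finite_set0 V) => u [_]; rewrite in_cons => /orP[/eqP ev|/mapP[k _ ev]];
    by case: no; eexists; exact: ev.
  (* Once [mu u] reaches [ii l.+1], the added segment starts beyond index [l]; so only the finitely
     many [u] with smaller [mu u] can contain [S l]. *)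
  apply: (@sub_finite_set _ _ ([set u | U u /\ mu u < ii l.+1] `|` [set u | U u /\ mu u < ii 0])).
    move=> u [Uu vu]; case: (ltnP (mu u) (ii 0)) => [lt0|ge0]; [by right|left; split=> //].
    rewrite ltnNge; apply/negP => ge; have [_ nmax] := nuP u ge0.
    have lt : l < ii (nu u) by apply: leq_trans (ii_ge _); exact: nmax.
    move: vu; rewrite in_cons => /orP[/eqP/Sinj el|/mapP[k]].
      by rewrite -el ltnn in lt.
    by rewrite mem_iota => /andP[k1 _] /Sinj el; rewrite -el leqNgt ltnW in k1.
  by rewrite finite_setU; split; exact: few.
apply: (@sub_finite_set _ _ [set u | U u /\ mu u < ii 0]); last exact: few.
move=> u [Uu no]; split=> //; rewrite ltnNge; apply/negP => ge0; apply: no.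
have [le _] := nuP u ge0; have [pQ lQ _] := fan_path fS Uu.
have sp k m : path (darc (rev_digraph D)) (S k) [seq S l | l <- iota k.+1 m] /\
    last (S k) [seq S l | l <- iota k.+1 m] = S (k + m).
  elim: m k => [|m IHm] k /=; first by rewrite addn0.
  by have [-> ->] := IHm k.+1; rewrite addSnnS andbT; split=> //; apply/asboolP; exact: SE.
have [p1 l1] := sp (ii (nu u)) (mu u - ii (nu u)); rewrite subnKC // in l1.
exists (S (ii (nu u))), (seg u ++ Q u); split=> //.
- by exists (Core (nu u)); rewrite -e_S; have [] := ld_core ld (nu u).
- by rewrite cat_path p1 l1 -muP.
- by rewrite last_cat l1 -muP.
Qed.

Record ear_data := EarData { earG : seq V; earZ : label; earY : label; ear_tri : bool;
  ear_lo : nat; ear_hi : nat; ear_w : window_data V }.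

Lemma comb_case : realizes shaped_by_comb D U.
Proof.
have [B [Besc Bbad]] := back_paths.
pose supp u := st u :: P u ++ B u.
have esc v : finite_set [set u | U u /\ v \in supp u].
  apply: (@sub_finite_set _ _ ([set u | U u /\ st u = v] `|` ([set u | U u /\ v \in P u] `|` [set u | U u /\ v \in B u]))).
    by move=> u [Uu]; rewrite in_cons mem_cat => /or3P[/eqP vs|vP|vB]; [left|right; left|right; right].
  rewrite !finite_setU; split; first exact: fan_start_escape Rray fR.
  by split; [exact: fan_escape fR v|exact: Besc].
have [low lowP] : exists low : nat -> seq V, forall n x l, cls l x -> label_index l <= n -> x \in low n.
  have fl l : exists s : seq V, forall x, cls l x -> x \in s.
    by have [s es] := (finite_seqP _).1 (ld_fin ld l); exists s => x; rewrite es.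
  have [s sP] := exists_choice fl.
  exists (fun n => flatten [seq s (Fw i) ++ s (Core i) ++ s (Bw i) | i <- iota 0 n.+1]) => n x l xl ln.
  apply/flattenP; exists (s (Fw (label_index l)) ++ s (Core (label_index l)) ++ s (Bw (label_index l))).
    by apply/mapP; exists (label_index l) => //; rewrite mem_iota.
  by rewrite !mem_cat; case: l xl {ln} => n' /sP -> //=; rewrite !orbT.
pose bad := [set u | U u /\ ~ exists x p, [/\ B u = x :: p, M x, path (darc (rev_digraph D)) x p & last x p = u]]
  `|` [set u | U u /\ has (mem (low 1)) (supp u)].
have fbad : finite_set bad by rewrite finite_setU; split=> //; exact: escape_seq.
(* The ear starts at the last ladder vertex of the path from [R] to [u], and it ends at the last
   ladder vertex of [B u], which is the first one on the way back from [u]. *)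
have ears u : (U `\` bad) u -> exists (G : seq V) lz ly, [/\ ear D cls [set` G] u lz ly, {subset G <= supp u},
    forall x l, x \in G -> ~ cls l x, exists2 z, z \in supp u & cls lz z & exists2 y, y \in supp u & cls ly y].
  move=> [Uu nb].
  have [x [p [eB Mx pp lp]]] : exists x p, [/\ B u = x :: p, M x, path (darc (rev_digraph D)) x p & last x p = u].
    by apply: contrapT => no; apply: nb; left.
  have [pP lP _] := fan_path fR Uu; have [i ei] := fan_start fR Uu.
  have Ms : M (st u) by rewrite ei; exact: R_on.
  have uB : u \in x :: p by rewrite -lp mem_last.
  have us : u \in supp u by rewrite /supp in_cons mem_cat eB uB !orbT.
  have [z [p1 [[lz zl] zs p1P p1M [pz lz']]]] := last_in_set pP Ms.
  have [y [q1 [[ly yl] ys q1P q1M [qy ly']]]] := last_in_set pp Mx.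
  rewrite lP in lz'; rewrite lp in ly'.
  case: (pselect (M u)) => [[l ul]|nM].
    by exists [::], l, l; split=> //; [left|exists u|exists u].
  case: p1 p1P p1M pz lz' => [|s p1] p1P p1M /=; first by move=> _ zu; case: nM; exists lz; rewrite -zu.
  move=> /andP[/asboolP zs' ps] lu.
  case: q1 q1P q1M qy ly' => [|t q1] q1P q1M /=; first by move=> _ zu; case: nM; exists ly; rewrite -zu.
  move=> /andP[/asboolP yt pt] lu'.
  have Psup v : v \in P u -> v \in supp u by rewrite /supp in_cons mem_cat => ->; rewrite orbT.
  have Bsup v : v \in x :: p -> v \in supp u by move=> vp; rewrite /supp in_cons mem_cat eB vp !orbT.
  exists ((s :: p1) ++ (t :: q1)), lz, ly; split.
  - right; exists s, t, z, y; split=> //.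
      rewrite -[X in reach _ _ _ X]lu; apply: path_reach => //; first by have [] := dE_V zs'.
      by move=> v vp; rewrite /= -cat_cons mem_cat vp.
    apply/reach_revE; rewrite -[X in reach _ _ _ X]lu'; apply: path_reach => //; first by have [] := dE_V yt.
    by move=> v vp; rewrite /= -cat_cons mem_cat vp orbT.
  - move=> v; rewrite mem_cat => /orP[/p1P/Psup//|/q1P vq].
    by apply: Bsup; rewrite in_cons vq orbT.
  - by move=> v l; rewrite mem_cat => /orP[/p1M|/q1M] nv vl; apply: nv; exists l.
  - exists z => //; move: zs; rewrite in_cons => /orP[/eqP->|/Psup//].
    by rewrite /supp mem_head.
  - by exists y => //; exact: Bsup.
pose fwd u w := window_spec D cls b e (ear_tri w) (ear_lo w) (ear_hi w) [set` earG w] u (ear_w w).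
pose bwd u w := window_spec (rev_digraph D) (fun l => cls (flip l)) e b (ear_tri w) (ear_lo w) (ear_hi w)
  [set` earG w] u (ear_w w).
pose spec u w := [/\ fwd u w \/ bwd u w, {subset earG w <= supp u}, forall x l, x \in earG w -> ~ cls l x,
  [/\ 0 < ear_lo w, ear_lo w <= ear_hi w & label_index (earZ w) <= (ear_lo w).+1 \/ label_index (earY w) <= (ear_lo w).+1] &
  (exists2 z, z \in supp u & cls (earZ w) z) /\ (exists2 y, y \in supp u & cls (earY w) y)].
have [w wP] : exists w, forall u, (U `\` bad) u -> spec u (w u).
  apply: (@exists_choice _ _ (fun u w => (U `\` bad) u -> spec u w)) => u.
  case: (pselect ((U `\` bad) u)) => [Bu|nB]; last first.
    exists (EarData [::] (Core 0) (Core 0) true 0 0 (WindowData (TendrilData u u 0 (fun _ => set0) (fun _ => set0) (fun _ => u))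
      (fun _ => set0) (fun _ => set0) (fun _ => u))) => Bu.
    by case: nB.
  have [G [lz [ly [eu Gs GM [z zs zl] [y ys yl]]]]] := ears u Bu.
  have big l v : v \in supp u -> cls l v -> 1 < label_index l.
    move=> vs vl; rewrite ltnNge; apply/negP => le; case: Bu => Uu; apply; right; split=> //.
    by apply/hasP; exists v => //; exact: lowP vl le.
  have [tri [lo [hi [w [wsp lo0 lohi _ lb]]]]] := window_exists ld (fun x l xG => GM x l xG) eu (big _ _ zs zl) (big _ _ ys yl).
  exists (EarData G lz ly tri lo hi w) => _; split=> //.
  by split; [exists z|exists y].
(* Stated for any ladder of any digraph, so as to serve both [ld] and its reversal. *)
have final (E : digraph V) c b' e' U' tri : ladder E c b' e' -> (forall l x, c l x -> M x) ->
    U' `<=` U `\` bad -> infinite_set U' -> (forall u, U' u -> ear_tri (w u) = tri) ->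
    (forall u, U' u -> window_spec E c b' e' (ear_tri (w u)) (ear_lo (w u)) (ear_hi (w u))
      [set` earG (w u)] u (ear_w (w u))) -> realizes shaped_by_comb E U.
  move=> lde cM UB inf' et wf.
  have esc' v : finite_set [set u | U' u /\ v \in supp u].
    by apply: sub_finite_set (esc v) => u [/UB[]].
  have [f [fU supp_dis fdis]] := select (fun u => low (ear_hi (w u)).+3) inf' esc'.
  have fP k := wP _ (UB _ (fU k)).
  apply: (@comb_assembly V E c b' e' lde U tri (fun k => ear_lo (w (f k))) (fun k => ear_hi (w (f k)))
    (fun k => [set` earG (w (f k))]) f (fun k => ear_w (w (f k)))).
  - by move=> k; rewrite -(et _ (fU k)); exact: wf.
  - by have [_ _ _ []] := fP 0.
  - by move=> k; have [_ _ _ []] := fP k.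
  (* Later supports avoid the ladder up to index [hi + 3], and one end of the ear has index at most
     [lo + 1]; this leaves a gap between consecutive windows. *)
  - move=> k; have [_ _ _ [_ _ lb] [[z zs zl] [y ys yl]]] := fP k.+1.
    have far l v : v \in supp (f k.+1) -> cls l v -> (ear_hi (w (f k))).+3 < label_index l.
      move=> vs vl; rewrite ltnNge; apply/negP => le.
      by have := fdis k k.+1 v (ltnSn k) vs; rewrite (lowP _ _ _ vl le).
    by case: lb => lb; [have := far _ _ zs zl|have := far _ _ ys yl]; move: lb; clear; lia.
  - by move=> k x l xG /cM[l' xl]; have [_ _ h _ _] := fP k; exact: h xG xl.
  - move=> k l x xk xl; have [_ Gk _ _ _] := fP k; have [_ Gl _ _ _] := fP l.
    exact: supp_dis (Gk _ xk) (Gl _ xl).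
  - by move=> k; have [] := UB _ (fU k).
have fin_bwd U' tri : U' `<=` U `\` bad -> infinite_set U' -> (forall u, U' u -> ear_tri (w u) = tri) ->
    (forall u, U' u -> bwd u (w u)) -> realizes shaped_by_comb D U.
  move=> UB inf' et wf; apply: (@realizes_rev (@shaped_by_comb)); first exact: rev_shaped_by_comb.
  by apply: (final _ _ _ _ U' tri (ladder_rev ld)) => // l x xl; exists (flip l).
have fin_fwd U' tri := @final D cls b e U' tri ld (fun l x xl => ex_intro _ l xl).
have infB := infinite_setD U_inf fbad.
(* All windows must belong to the same orientation of the ladder and be of the same kind, triangle
   or claw: two pigeonhole steps. *)
have [inf1|inf1] := infinite_split [set u | fwd u (w u)] infB;
  have [inf2|inf2] := infinite_split [set u | ear_tri (w u)] inf1.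
- by apply: (fin_fwd _ true) inf2 _ _ => u [[]].
- by apply: (fin_fwd _ false) inf2 _ _ => u [[]] // _ _ /negP/negbTE.
- by apply: (fin_bwd _ true) inf2 _ _ => u [[Bu nf]] //; have [[]] := wP u Bu.
- by apply: (fin_bwd _ false) inf2 _ _ => u [[Bu nf]] // nt; [exact/negbTE/negP|have [[]] := wP u Bu].
Qed.

End CombCase.

Lemma realizes_model (shape : forall W, digraph W -> set W -> Prop) (V : Type) (D : digraph V) (U : set V) :
  realizes shape D U -> exists (W : Type) (H : digraph W) (Y : set W) (M : tree_like_model H D),
    shape W H Y /\ forall y, Y y -> U (root_of M y).
Proof.
move=> [W [H [Y [I [O [r [mo sh YU]]]]]]]; have [M Mr] := set_model_tree_like mo.
by exists W, H, Y, M; split=> // y /YU; rewrite Mr.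
Qed.

Lemma strong_realizes (V : eqType) (D : digraph V) (U : set V) :
  (forall x y, dV D x -> dV D y -> reach D setT x y) -> U `<=` dV D -> infinite_set U ->
  [\/ realizes shaped_by_star D U, realizes shaped_by_comb D U | realizes chain_of_triangles D U].
Proof.
move=> strong UD inf; have [r Ur] := infinite_setN0 inf; have Dr := UD _ Ur.
have [U1 [R [st [P [U1U inf1 fR]]]]] := fan_exists Dr (fun u Uu => strong _ _ Dr (UD u Uu)) inf.
have [|U2 [S [ts [Q [U2U inf2 fS]]]]] := @fan_exists V (rev_digraph D) r U1 Dr _ inf1.
  by move=> u /U1U/UD Du; apply/reach_revE; exact: strong.
have fR2 := fan_sub U2U fR; have sub : U2 `<=` U by move=> u /U2U/U1U.
case: (pselect [/\ ray_along D R, ray_along (rev_digraph D) S & infinite_set [set i | exists j, R i = S j]]) => [[Rray Sray meet]|no].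
  have [cls [b [e [ii [ld Ron eS iige]]]]] := ladder_of_rays Rray Sray meet.
  by apply: Or32; apply: realizes_sub sub _; exact: (comb_case inf2 fR2 fS Rray Sray ld Ron eS iige).
have [U3 [R' [S' [a [U3U su]]]]] := setup_exists strong inf2 fR2 fS no.
have sub3 : U3 `<=` U by move=> u /U3U/sub.
by case: (setup_realizes su) => h; [apply: Or31|apply: Or33]; exact: realizes_sub h.
Qed.

Lemma dreach_reach (V : Type) (D : digraph V) x y : dreach D x y -> reach D setT x y.
Proof.
move=> [n [p [[pV pE _] <- <-]]]; elim: n pV pE => [|n IHn] pV pE.
  by apply: reach_refl => //; exact: pV.
apply: (reach_step _ _ (pE n (ltnSn n))) => //.
by apply: IHn => i il; [apply: pV|apply: pE]; exact: leqW.
Qed.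

Theorem theorem1p3 (V : Type) (D : digraph V) (U : set V)
    (D_strong : strongly_connected D)
    (U_D : U `<=` dV D) (U_infinite : infinite_set U) :
  exists (W : Type) (H : digraph W) (Y : set W) (M : tree_like_model H D),
    [\/ shaped_by_star H Y, shaped_by_comb H Y | chain_of_triangles H Y] /\
    forall y, Y y -> U (root_of M y).
Proof.
have strong x y : dV D x -> dV D y -> reach D setT x y.
  by move=> Dx Dy; apply: dreach_reach; exact: D_strong.
(* [{classic V}] equips [V] with the decidable equality that vertex sequences need. *)
by case: (@strong_realizes {classic V} D U strong U_D U_infinite) => /realizes_model[W [H [Y [M [sh YU]]]]];
  exists W, H, Y, M; split=> //; [apply: Or31|apply: Or32|apply: Or33].
Qed.
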